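(* Fix an integer $q\ge 2$. For $c\in[0,1)$ let $f_c(x)=\log\left|\frac{\sin q\pi(x+c)}{\sin \pi(x+c)}\right|$ on $\mathbb{T}=\mathbb{R}/\mathbb{Z}$, let $T:\mathbb{T}\to\mathbb{T}$, $Tx=qx \bmod 1$, and let $\beta(c)=\sup_{\mu\in\mathcal{M}_T}\int_{\mathbb{T}} f_c\,d\mu$, where $\mathcal{M}_T$ is the set of $T$-invariant Borel probability measures on $\mathbb{T}$. Then: (1) The supremum defining $\beta(c)$ is attained by a unique measure, and this measure is $q$-Sturmian. (2) The set of parameters $c$ for which this $q$-Sturmian maximizing measure is not periodic (i.e. not supported on a single periodic orbit of $T$) has Hausdorff dimension zero. (3) Let $\gamma(c)=\beta(c)/\log q$. There is a constant $C>0$ such that for all $x\in\mathbb{T}$ and all $N\ge 1$, $$\left|\sum_{n=0}^{N-1} t_n^{(q;c)} e^{2\pi i n x}\right|\le C N^{\gamma(c)},$$ where $t_n^{(q;c)}=e^{2\pi i c S_q(n)}$.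
   Context: $S_q(n)$ denotes the sum of the digits of the base-$q$ expansion of the nonnegative integer $n$. A $q$-Sturmian measure is a $T$-invariant Borel probability measure on $\mathbb{T}$ whose support is contained in a closed arc of length $1/q$. The Gelfond exponent $\gamma(c)$ is the infimum of all $\gamma$ with $\sup_x|\sum_{n=0}^{N-1}t_n^{(q;c)}e^{2\pi i n x}|=O(N^\gamma)$; the paper shows it equals $\beta(c)/\log q$. *)

(* Defs.v *)
(* R : realType; the torus T = R/Z is modelled by
   the fundamental domain [0,1) with its Borel sigma-algebra (inherited from
   the Borel sigma-algebra of R). *)
From HB Require Import structures.
From mathcomp Require Import all_boot all_order all_algebra.
From mathcomp Require Import all_classical all_reals all_analysis.
Set Implicit Arguments. Unset Strict Implicit. Unset Printing Implicit Defensive.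
Import Order.TTheory GRing.Theory Num.Theory.
Import numFieldNormedType.Exports.
Local Open Scope classical_set_scope.
Local Open Scope ring_scope.

Section Defs.
Variable R : realType.

Definition frac (x : R) : R := x - (Num.floor x)%:~R.

Definition torus : set R := [set x | 0 <= x < 1].

Definition Tmap (q : nat) (x : R) : R := frac (q%:R * x).

Definition tdist (x y : R) : R := Num.min (frac (x - y)) (frac (y - x)).

(* S_q(n): sum of base-q digits of n (the k-th digit is (n / q^k) mod q;
   digits of index >= n+1 vanish since q >= 2) *)
Definition digsum (q n : nat) : nat := (\sum_(k < n.+1) ((n %/ q ^ k) %% q))%N.

(* |sin(q pi y) / sin(pi y)|, extended continuously (value q) where
   sin(pi y) = 0 *)
Definition dirichlet_abs (q : nat) (y : R) : R :=
  if sin (pi * y) == 0 then q%:R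
  else `| sin (q%:R * pi * y) / sin (pi * y) |.

Definition fc (q : nat) (c : R) (x : R) : \bar R :=
  if dirichlet_abs q (x + c) == 0 then -oo%E
  else (ln (dirichlet_abs q (x + c)))%:E.

Definition inv_prob (q : nat) (mu : {measure set R -> \bar R}) : Prop :=
  mu torus = 1%E /\ mu (~` torus) = 0%E /\
  forall A : set R, measurable A -> A `<=` torus ->
    mu (torus `&` Tmap q @^-1` A) = mu A.

Definition integral_fc (q : nat) (c : R) (mu : {measure set R -> \bar R}) : \bar R :=
  (\int[mu]_(x in torus) fc q c x)%E.

Definition beta (q : nat) (c : R) : \bar R :=
  ereal_sup [set integral_fc q c mu | mu in [set mu | inv_prob q mu]].

Definition tball (x e : R) : set R := [set y | torus y /\ tdist x y < e].
Definition support (mu : {measure set R -> \bar R}) : set R :=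
  [set x | torus x /\ forall e : R, 0 < e -> (0 < mu (tball x e))%E].

Definition arc (q : nat) (a : R) : set R :=
  [set y | torus y /\ frac (y - a) <= q%:R^-1].

Definition sturmian (q : nat) (mu : {measure set R -> \bar R}) : Prop :=
  inv_prob q mu /\ exists a : R, support mu `<=` arc q a.

Definition periodic_measure (q : nat) (mu : {measure set R -> \bar R}) : Prop :=
  exists x0 : R, exists n : nat, torus x0 /\ (0 < n)%N /\
    iter n (Tmap q) x0 = x0 /\
    mu [set y | exists k : nat, (k < n)%N /\ y = iter k (Tmap q) x0] = 1%E.

Definition diam (U : set R) : \bar R :=
  ereal_sup [set (`|x - y|)%:E | x in U & y in U].

Definition hterm (s : R) (U : set R) : \bar R :=
  if pselect (U = set0) then 0%E else (powR (fine (diam U)) s)%:E.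

Definition hcontent (s delta : R) (E : set R) : \bar R :=
  ereal_inf [set (\sum_(0 <= i <oo) hterm s (U i))%E |
             U in [set U : nat -> set R |
                   E `<=` \bigcup_i U i /\ forall i, (diam (U i) <= delta%:E)%E]].

Definition hausdorff_measure (s : R) (E : set R) : \bar R :=
  ereal_sup [set hcontent s delta E | delta in [set d : R | 0 < d]].

Definition hausdorff_dim (E : set R) : \bar R :=
  ereal_inf [set s%:E | s in [set s : R | 0 <= s /\ hausdorff_measure s E = 0%E]].

End Defs.

(* Main.v *)
Require Import Defs.
From HB Require Import structures.
From mathcomp Require Import all_boot all_order all_algebra.
From mathcomp Require Import all_classical all_reals all_analysis.
From mathcomp Require Import measurable_realfun zify ring lra.
Set Implicit Arguments. Unset Strict Implicit. Unset Printing Implicit Defensive.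
Import Order.TTheory GRing.Theory Num.Theory.
Import numFieldNormedType.Exports.
Local Open Scope classical_set_scope.
Local Open Scope ring_scope.

(** In the coordinate [t = pi (x + c)] the potential is the logarithm of the
    Dirichlet kernel [|sin (q t) / sin t|].  For every arc of length [1/q] the
    cohomological equation along the inverse branches with values in that arc
    has a solution, and the intermediate value theorem selects an arc around
    [t = 0] for which this solution takes equal values at the two endpoints.
    It then extends to a Lipschitz sub-action [psi] on the whole circle: with
    [be = beta c], [f_c + psi - psi o T <= be], with equality on the arc and
    strict inequality off it.  This inequality is where the shape of the kernel
    enters, and it needs explicit estimates for small [q].

    Integrating the inequality shows that the maximizing measures are exactly
    the invariant measures carried by the arc.  Collapsing the complement of
    the arc turns [T] into a degree-one circle map, whose rotation number
    determines the measure, whence uniqueness.  A rational rotation number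
    gives a periodic orbit.  For irrational ones, the number of rotation codes
    of length [n] is polynomial in [n], while parameters sharing such a code
    are exponentially close, whence dimension zero.  The exponential sum over
    [n < q ^ k] factors as a product of Dirichlet kernels along an orbit, which
    the sub-action bounds by a constant times [exp (k be)]; splitting [N] by its
    base-[q] digits yields the Gelfond bound. *)

(** The [q] preimages of a point are t + k w with w = pi / q, and the kernel has the same numerator
    |sin (q t)| at all of them. The sub-action inequality thus says that, for t in the arc, the
    sub-action increases less from t to t + k w than ln |sin| does. All that is known of the
    sub-action is the range of its slopes and its equation on the arc, and between the two ends of
    the arc the comparison is an equality. Neighbouring preimages therefore need a comparison of
    rates starting from an end, while the others leave a definite margin. For q = 2 the slope range
    is too wide for this, and the sub-action has to be pulled back once more. Exponential closeness
    of parameters with a common code rests on the strong concavity of ln (sin (q t) / sin t). A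
    common code only brings the left ends of the arcs together. Concavity makes the condition of
    equal end values strictly monotone in the arc parameter [al], so the left end determines [al],
    and with it c, up to an exponential loss; codes of double length pay for that loss. *)

Local Notation frac := Defs.frac.

(** * The Dirichlet kernel *)

Section Calculus.
Variable R : realType.
Implicit Types (f g df : R -> R) (a b x y : R).

(* [is_derive] is a type class; this alias keeps instance search out of the way. *)
Definition hderiv f x (d : R) : Prop := is_derive x 1 f d.

Lemma hderiv_continuous f (d : R) x : hderiv f x d -> {for x, continuous f}.
Proof. by move=> [h _]; apply: differentiable_continuous; apply/derivable1_diffP. Qed.

Lemma hderiv_congr f (d d' : R) x : hderiv f x d -> d = d' -> hderiv f x d'.
Proof. by move=> h <-. Qed.

Lemma mvt_cc f df a b : a < b ->
  (forall x, a <= x <= b -> hderiv f x (df x)) ->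
  exists c, a < c < b /\ f b - f a = df c * (b - a).
Proof.
move=> ab h; have [||c cab e] := @MVT R f df a b ab.
- by move=> x; rewrite in_itv /= => /andP[h1 h2]; apply: h; rewrite !ltW.
- apply: continuous_in_subspaceT => x; rewrite inE /= in_itv /= => hx.
  exact: (hderiv_continuous (h _ hx)).
by exists c; split => //; move: cab; rewrite in_itv.
Qed.

Lemma derive_ge0_le f df a b : a <= b ->
  (forall x, a <= x <= b -> hderiv f x (df x)) ->
  (forall x, a < x < b -> 0 <= df x) -> f a <= f b.
Proof.
rewrite le_eqVlt => /predU1P[->//|ab] h h0.
have [c [cab e]] := mvt_cc ab h.
by rewrite -subr_ge0 e mulr_ge0 ?h0 // subr_ge0 ltW.
Qed.

Lemma hderivD f g (u v : R) x : hderiv f x u -> hderiv g x v ->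
  hderiv (fun y => f y + g y) x (u + v).
Proof. by move=> hf hg; exact: (is_deriveD hf hg). Qed.

Lemma hderivB f g (u v : R) x : hderiv f x u -> hderiv g x v ->
  hderiv (fun y => f y - g y) x (u - v).
Proof. by move=> hf hg; exact: (is_deriveB hf hg). Qed.

Lemma hderivM f g (u v : R) x : hderiv f x u -> hderiv g x v ->
  hderiv (fun y => f y * g y) x (u * g x + f x * v).
Proof.
move=> hf hg; apply: (hderiv_congr (is_deriveM hf hg)).
by rewrite /GRing.scale /= addrC mulrC; congr (_ + _); rewrite mulrC.
Qed.

Lemma hderiv_comp f g (u v : R) x : hderiv f (g x) u -> hderiv g x v ->
  hderiv (fun y => f (g y)) x (u * v).
Proof. by move=> hf hg; exact: (@is_derive1_comp R f g x u v hf hg). Qed.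

Lemma hderivV g (v : R) x : g x != 0 -> hderiv g x v ->
  hderiv (fun y => (g y)^-1) x (- (v / g x ^+ 2)).
Proof.
move=> g0 hg; apply: (hderiv_congr (@is_deriveV R g x v 1 g0 hg)).
by rewrite /GRing.scale /= mulNr mulrC.
Qed.

Lemma hderiv_cst (k : R) x : hderiv (fun _ : R => k) x 0.
Proof. exact: is_derive_cst. Qed.

Lemma hderiv_id x : hderiv (fun y : R => y) x 1.
Proof. exact: is_derive_id. Qed.

Lemma hderiv_lin (k : R) x : hderiv (fun y : R => k * y) x k.
Proof. by apply: (hderiv_congr (hderivM (hderiv_cst k x) (hderiv_id x))); rewrite mul0r add0r mulr1. Qed.

Lemma hderiv_sin x : hderiv sin x (cos x).
Proof. exact: is_derive_sin. Qed.

Lemma hderiv_cos x : hderiv cos x (- sin x).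
Proof. exact: is_derive_cos. Qed.

Lemma hderiv_ln0 x : 0 < x -> hderiv (@ln R) x x^-1.
Proof. exact: is_derive1_ln. Qed.

Lemma hderiv_ln g (v : R) x : 0 < g x -> hderiv g x v ->
  hderiv (fun y => ln (g y)) x (v / g x).
Proof. by move=> g0 hg; rewrite mulrC; apply: hderiv_comp => //; exact: hderiv_ln0. Qed.

(** First term of the expansion of ln x in powers of (x - 1) / (x + 1), all of whose terms are
    nonnegative for x >= 1. It is sharper than 1 - 1 / x and turns ratios of sines into rational
    expressions. *)
Lemma ln_ratio_ge x : 1 <= x -> 2 * (x - 1) / (x + 1) <= ln x.
Proof.
move=> x1.
pose g y : R := ln y + 4 * (y + 1)^-1.
suff h : g 1 <= g x.
  have e : 2 * (x - 1) / (x + 1) = 2 - 4 * (x + 1)^-1 by field; lra.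
  have e1 : (1 + 1 : R)^-1 = 2^-1 by [].
  move: h; rewrite /g ln1 add0r e e1; lra.
apply: (@derive_ge0_le g (fun y => y^-1 + (0 * (y + 1)^-1 + 4 * - ((1 + 0) / (y + 1) ^+ 2)))) => // y /andP[y1 y2].
  have y0 : 0 < y by rewrite (lt_le_trans _ y1).
  apply: hderivD; first exact: hderiv_ln0.
  apply: hderivM; first exact: hderiv_cst.
  apply: hderivV; first lra.
  by apply: hderivD; [exact: hderiv_id|exact: hderiv_cst].
have y0 : 0 < y by rewrite (lt_trans _ y1).
have -> : y^-1 + (0 / (y + 1) + 4 * - ((1 + 0) / (y + 1) ^+ 2)) = (y - 1) ^+ 2 / (y * (y + 1) ^+ 2).
  by field; apply/andP; split; lra.
by rewrite divr_ge0 ?sqr_ge0 // mulr_ge0 ?sqr_ge0 // ltW.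
Qed.

Lemma sin_le x : 0 <= x -> sin x <= x.
Proof.
move=> x0; pose g y : R := y - sin y.
suff : g 0 <= g x by rewrite /g sin0 subr0 subr_ge0.
apply: (@derive_ge0_le g (fun y => 1 - cos y)) => // y hy.
by apply: hderivB; [exact: hderiv_id|exact: hderiv_sin].
Qed.

Lemma hderiv_mono n (y : R) : hderiv (fun z => z ^+ n.+1) y (n.+1%:R * y ^+ n).
Proof.
elim: n => [|n IH]; first by rewrite expr0 mulr1; exact: hderiv_id.
under eq_fun do rewrite exprS.
apply: (hderiv_congr (hderivM (hderiv_id y) IH)).
by rewrite mul1r -[n.+2%:R]natr1 mulrDl mul1r addrC exprS mulrCA.
Qed.

Lemma cos_ge2 x : 0 <= x -> 1 - x ^+ 2 / 2 <= cos x.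
Proof.
move=> x0; pose g y : R := cos y - (1 - 2^-1 * y ^+ 2).
suff : g 0 <= g x by rewrite /g cos0; lra.
apply: (@derive_ge0_le g (fun y => (- sin y) - (0 - (0 * y ^+ 2 + 2^-1 * (2 * y ^+ 1))))) => // y hy.
  apply: hderivB; first exact: hderiv_cos.
  apply: hderivB; first exact: hderiv_cst.
  by apply: hderivM; [exact: hderiv_cst|exact: (hderiv_mono 1)].
have := @sin_le y; rewrite expr1; lra.
Qed.

Lemma sin_ge3 x : 0 <= x -> x - x ^+ 3 / 6 <= sin x.
Proof.
move=> x0; pose g y : R := sin y - (y - 6^-1 * y ^+ 3).
suff : g 0 <= g x by rewrite /g sin0; lra.
apply: (@derive_ge0_le g (fun y => cos y - (1 - (0 * y ^+ 3 + 6^-1 * (3 * y ^+ 2))))) => // y hy.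
  apply: hderivB; first exact: hderiv_sin.
  apply: hderivB; first exact: hderiv_id.
  by apply: hderivM; [exact: hderiv_cst|exact: (hderiv_mono 2)].
have := @cos_ge2 y; lra.
Qed.

Lemma cos_le4 x : 0 <= x -> cos x <= 1 - x ^+ 2 / 2 + x ^+ 4 / 24.
Proof.
move=> x0; pose g y : R := (1 - 2^-1 * y ^+ 2 + 24^-1 * y ^+ 4) - cos y.
suff : g 0 <= g x by rewrite /g cos0; lra.
apply: (@derive_ge0_le g (fun y => (0 - (0 * y ^+ 2 + 2^-1 * (2 * y ^+ 1)) + (0 * y ^+ 4 + 24^-1 * (4 * y ^+ 3))) - - sin y)) => // y hy.
  apply: hderivB; last exact: hderiv_cos.
  apply: hderivD; last by apply: hderivM; [exact: hderiv_cst|exact: (hderiv_mono 3)].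
  apply: hderivB; first exact: hderiv_cst.
  by apply: hderivM; [exact: hderiv_cst|exact: (hderiv_mono 1)].
have := @sin_ge3 y; rewrite expr1; lra.
Qed.

Lemma sin_le5 x : 0 <= x -> sin x <= x - x ^+ 3 / 6 + x ^+ 5 / 120.
Proof.
move=> x0; pose g y : R := (y - 6^-1 * y ^+ 3 + 120^-1 * y ^+ 5) - sin y.
suff : g 0 <= g x by rewrite /g sin0; lra.
apply: (@derive_ge0_le g (fun y => (1 - (0 * y ^+ 3 + 6^-1 * (3 * y ^+ 2)) + (0 * y ^+ 5 + 120^-1 * (5 * y ^+ 4))) - cos y)) => // y hy.
  apply: hderivB; last exact: hderiv_sin.
  apply: hderivD; last by apply: hderivM; [exact: hderiv_cst|exact: (hderiv_mono 4)].
  apply: hderivB; first exact: hderiv_id.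
  by apply: hderivM; [exact: hderiv_cst|exact: (hderiv_mono 2)].
have := @cos_le4 y; lra.
Qed.

(** Otherwise 19/12 <= pi / 2 would have a nonnegative cosine; but with z = 19/24 the cubic minorant
    of sin z already gives 2 sin^2 z > 1. *)
Lemma pi_lt : pi < 19 / 6 :> R.
Proof.
rewrite ltNge; apply/negP => h.
have p0 := @pi_gt0 R.
pose z : R := 19 / 24.
have c0 : 0 <= cos (z + z).
  by apply: cos_ge0_pihalf; rewrite /z; apply/andP; split; lra.
have s1 : z - z ^+ 3 / 6 <= sin z by apply: sin_ge3; rewrite /z; lra.
have z2 : 5 / 8 <= z ^+ 2 <= 63 / 100 by rewrite /z expr2; apply/andP; split; lra.
move: c0; rewrite cosD -!expr2 cos2sin2.
have z0 : 0 <= z by rewrite /z; lra.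
have e : (z - z ^+ 3 / 6) ^+ 2 = z ^+ 2 * (1 - z ^+ 2 / 6) ^+ 2 by field.
have : (z - z ^+ 3 / 6) ^+ 2 <= sin z ^+ 2.
  rewrite ler_sqr ?nnegrE //.
    by rewrite (_ : _ - _ = z * (1 - z ^+ 2 / 6)); [rewrite mulr_ge0 //; lra|field].
  apply: le_trans s1.
  by rewrite (_ : _ - _ = z * (1 - z ^+ 2 / 6)); [rewrite mulr_ge0 //; lra|field].
rewrite e.
have q1 : (179 / 200) ^+ 2 <= (1 - z ^+ 2 / 6) ^+ 2 by rewrite ler_sqr ?nnegrE; lra.
have q2 : 4 / 5 <= (179 / 200 : R) ^+ 2 by rewrite expr2; lra.
have : 5 / 8 * (801/1000) <= z ^+ 2 * (1 - z ^+ 2 / 6) ^+ 2.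
  by apply: ler_pM; lra.
lra.
Qed.

End Calculus.

(** * The kernel sin (n t) / sin t and the strong concavity of its logarithm *)

Section DirichletKernel.
Variable R : realType.
Implicit Types (t x y : R) (n : nat).

(* The trigonometric polynomial sin (n t) / sin t, together with its first two derivatives. *)
Fixpoint U n t : R := if n is m.+1 then U m t * cos t + cos (m%:R * t) else 0.
Fixpoint dU n t : R :=
  if n is m.+1 then dU m t * cos t - U m t * sin t - m%:R * sin (m%:R * t) else 0.
Fixpoint ddU n t : R :=
  if n is m.+1 then
    ddU m t * cos t - 2 * dU m t * sin t - U m t * cos t - m%:R ^+ 2 * cos (m%:R * t)
  else 0.

Lemma natS_mul n t : n.+1%:R * t = n%:R * t + t.
Proof. by rewrite -natr1 mulrDl mul1r. Qed.

Lemma U_sin n t : U n t * sin t = sin (n%:R * t).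
Proof.
elim: n => [|n IH]; first by rewrite !mul0r sin0.
by rewrite (natS_mul n t) sinD -IH /=; ring.
Qed.

Lemma dU_sin n t : dU n t * sin t = n%:R * cos (n%:R * t) - U n t * cos t.
Proof.
elim: n => [|n IH]; first by rewrite /=; ring.
rewrite (natS_mul n t) cosD /= -[n.+1%:R]natr1 -U_sin.
have h : dU n t * cos t * sin t = (n%:R * cos (n%:R * t) - U n t * cos t) * cos t by rewrite -IH; ring.
rewrite !mulrBl h; ring.
Qed.

Lemma ddU_sin n t : ddU n t * sin t = U n t * sin t - 2 * dU n t * cos t - n%:R ^+ 2 * (U n t * sin t).
Proof.
elim: n => [|n IH]; first by rewrite /=; ring.
have e1 := dU_sin n t; have e0 := U_sin n t; have e2 := cos2Dsin2 t.
have -> : ddU n.+1 t * sin t = (ddU n t * sin t) * cos t - 2 * dU n t * sin t * sin t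
   - U n t * cos t * sin t - n%:R ^+ 2 * cos (n%:R * t) * sin t by rewrite /=; ring.
have -> : dU n.+1 t = dU n t * cos t - U n t * sin t - n%:R * (U n t * sin t) by rewrite /= -U_sin.
have -> : U n.+1 t = U n t * cos t + cos (n%:R * t) by [].
rewrite IH -[n.+1%:R]natr1.
have ek : n%:R * cos (n%:R * t) = dU n t * sin t + U n t * cos t by rewrite e1; ring.
have e2' : (sin t) ^+ 2 = 1 - cos t ^+ 2 by rewrite -e2; ring.
move: ek; set k := n%:R; set K := cos (k * t); set s := sin t in e2' *; set c := cos t in e2' *.
set u := U n t; set d := dU n t => ek.
have -> : k ^+ 2 * K * s = k * (k * K) * s by ring.
have -> : (k + 1) ^+ 2 * ((u * c + K) * s) = (k + 1) ^+ 2 * u * c * s + k * (k * K) * s + 2 * (k * K) * s + K * s by ring.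
rewrite ek.
transitivity (u * c * s - 2 * d * c ^+ 2 - k ^+ 2 * u * s * c - 2 * d * (s ^+ 2) - u * c * s - k * (d * s + u * c) * s); first by ring.
rewrite e2'.
transitivity (- 2 * d - k ^+ 2 * u * s * c - k * (d * s + u * c) * s); first by ring.
transitivity (- 2 * d * c ^+ 2 - 2 * d * (s ^+ 2) + 2 * u * s * c - 2 * u * s * c  - k ^+ 2 * u * s * c - k * (d * s + u * c) * s); first by rewrite e2'; ring.
ring.
Qed.

Lemma hderiv_U n t : hderiv (U n) t (dU n t).
Proof.
elim: n => [|n IH]; first exact: hderiv_cst.
apply: hderiv_congr; first apply: hderivD.
- exact: (hderivM IH (hderiv_cos t)).
- exact: (hderiv_comp (hderiv_cos _) (hderiv_lin n%:R t)).
by rewrite /=; ring.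
Qed.

Lemma hderiv_dU n t : hderiv (dU n) t (ddU n t).
Proof.
elim: n => [|n IH]; first exact: hderiv_cst.
apply: hderiv_congr; first apply: hderivB; first apply: hderivB.
- exact: (hderivM IH (hderiv_cos t)).
- exact: (hderivM (hderiv_U n t) (hderiv_sin t)).
- exact: (hderivM (hderiv_cst n%:R t) (hderiv_comp (hderiv_sin _) (hderiv_lin n%:R t))).
by rewrite /=; ring.
Qed.

Lemma UN n t : U n (- t) = U n t.
Proof. by elim: n => [//|n IH] /=; rewrite IH mulrN !cosN. Qed.

Lemma dUN n t : dU n (- t) = - dU n t.
Proof. by elim: n => [|n IH] /=; rewrite ?oppr0 // IH UN mulrN cosN !sinN; ring. Qed.

Lemma U0 n : U n 0 = n%:R.
Proof. by elim: n => [//|n IH] /=; rewrite IH mulr0 cos0 mulr1 natr1. Qed.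

Lemma dU0 n : dU n 0 = 0.
Proof. by elim: n => [//|n IH] /=; rewrite IH !mulr0 sin0 !(mul0r, mulr0) !subr0. Qed.

Lemma ddU0 n : (2 <= n)%N -> ddU n 0 <= - (n%:R / 2).
Proof.
elim: n => [//|[//|n] IH]; rewrite ltnS leq_eqVlt => /predU1P[|]; last first.
  move=> hn; have {}IH := IH hn.
  rewrite -[ddU n.+2 0]/(ddU n.+1 0 * cos 0 - 2 * dU n.+1 0 * sin 0 - U n.+1 0 * cos 0 - n.+1%:R ^+ 2 * cos (n.+1%:R * 0)).
  rewrite U0 mulr0 sin0 cos0 !mulr1 mulr0 subr0 -[n.+2%:R]natr1.
  have k1 : 1 <= n.+1%:R :> R by rewrite ler1n.
  nra.
case=> <-; rewrite /= !mulr0 !mul0r sin0 cos0; lra.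
Qed.

Lemma U_le n t : (0 < n)%N -> `|U n t| <= (n%:R - 1) * `|cos t| + 1.
Proof.
case: n => // n _; elim: n => [|n IH].
  by rewrite /= !mul0r !add0r cos0 normr1 subrr mul0r add0r.
rewrite -[U n.+2 t]/(U n.+1 t * cos t + cos (n.+1%:R * t)).
apply: (le_trans (ler_normD _ _)); rewrite normrM lerD ?cos_max //.
rewrite ler_wpM2r //.
have c1 : `|cos t| <= 1 by exact: cos_max.
have n0 : 0 <= n%:R :> R by [].
move: IH; rewrite -!natr1; have := normr_ge0 (cos t); nra.
Qed.

Lemma U_sqr_le n t : (2 <= n)%N -> U n t ^+ 2 * (1 + sin t ^+ 2 / 2) <= n%:R ^+ 2.
Proof.
move=> n2; have n1 : (0 < n)%N by exact: ltn_trans n2.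
have h := U_le t n1.
have c1 : `|cos t| <= 1 by exact: cos_max.
have c0 := normr_ge0 (cos t).
rewrite sin2cos2 -(real_normK (num_real (cos t))) -(real_normK (num_real (U n t))).
have u0 := normr_ge0 (U n t).
set C := `|cos t| in h c1 c0 *; set u := `|U n t| in h u0 *.
have k2 : 2 <= n%:R :> R by rewrite ler_nat.
set k := n%:R in h k2 *.
have e1 : 1 + (1 - C ^+ 2) / 2 <= (1 + (1 - C) / 2) ^+ 2 by nra.
have e2 : u * (1 + (1 - C) / 2) <= k by nra.
have e3 : 0 <= u * (1 + (1 - C) / 2) by rewrite mulr_ge0 //; lra.
have e4 : (u * (1 + (1 - C) / 2)) ^+ 2 <= k ^+ 2 by rewrite ler_sqr ?nnegrE //; lra.
by apply: le_trans e4; rewrite exprMn ler_wpM2l ?sqr_ge0.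
Qed.

(** Where the kernel does not vanish, (ln |U|)'' = 1 / sin^2 t - n^2 / sin^2 (n t), so the
    right-hand side times sin^2 t is n^2 - U^2, and [U_sqr_le] applies. The resulting bound (ln U)''
    <= - 1/2 gives the monotonicity of [dlogU] and, quantitatively, the dependence of the arc on its
    left end. *)
Lemma U_curv n t : (2 <= n)%N -> sin t != 0 ->
  U n t ^+ 2 / 2 <= dU n t ^+ 2 - ddU n t * U n t.
Proof.
move=> n2 s0.
have s2 : 0 < sin t ^+ 2 by rewrite exprn_even_gt0.
rewrite -(ler_pM2r s2).
have -> : (dU n t ^+ 2 - ddU n t * U n t) * sin t ^+ 2 =
  n%:R ^+ 2 - U n t ^+ 2.
  have -> : (dU n t ^+ 2 - ddU n t * U n t) * sin t ^+ 2 =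
    (dU n t * sin t) ^+ 2 - (ddU n t * sin t) * (U n t * sin t) by ring.
  rewrite ddU_sin.
  have -> : (dU n t * sin t) ^+ 2 - (U n t * sin t - 2 * dU n t * cos t - n%:R ^+ 2 * (U n t * sin t)) * (U n t * sin t)
   = (dU n t * sin t + U n t * cos t) ^+ 2 - U n t ^+ 2 * (cos t ^+ 2 + sin t ^+ 2) + n%:R ^+ 2 * (U n t * sin t) ^+ 2 by ring.
  rewrite dU_sin cos2Dsin2 U_sin subrK exprMn.
  by rewrite cos2sin2; ring.
by have := U_sqr_le t n2; lra.
Qed.

Variables (q : nat) (hq : (2 <= q)%N).

Definition omega : R := pi / q%:R.
Definition logU t : R := ln (U q t).
Definition dlogU t : R := dU q t / U q t.

Lemma q_ge2 : 2 <= q%:R :> R. Proof. by rewrite ler_nat. Qed.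
Lemma q_gt0 : 0 < q%:R :> R. Proof. by have := q_ge2; lra. Qed.
Lemma omega_gt0 : 0 < omega. Proof. by rewrite divr_gt0 ?pi_gt0 ?q_gt0. Qed.
Lemma q_omega : q%:R * omega = pi. Proof. by rewrite mulrC divfK // gt_eqF ?q_gt0. Qed.
Lemma omega_le : omega <= pi / 2.
Proof. have := q_omega; have := omega_gt0; have := q_ge2; nra. Qed.

Lemma sin_gt0_omega t : 0 < t < omega -> 0 < sin t.
Proof. by move=> /andP[t0 t1]; apply: sin_gt0_pihalf; have := omega_le; lra. Qed.

Lemma sinq_gt0 t : 0 < t < omega -> 0 < sin (q%:R * t).
Proof.
move=> /andP[t0 t1]; apply: sin_gt0_pi; rewrite mulr_gt0 ?q_gt0 //=.
by rewrite -q_omega ltr_pM2l ?q_gt0.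
Qed.

Lemma U_gt0 t : - omega < t < omega -> 0 < U q t.
Proof.
have pos z : 0 < z < omega -> 0 < U q z.
  move=> hz; rewrite -(pmulr_lgt0 _ (sin_gt0_omega hz)) U_sin; exact: sinq_gt0.
move=> /andP[t1 t2]; case: (ltgtP t 0) => ht; last by rewrite ht U0 q_gt0.
  by rewrite -UN; apply: pos; lra.
by apply: pos; rewrite ht.
Qed.

Lemma LUN t : logU (- t) = logU t. Proof. by rewrite /logU UN. Qed.
Lemma VN t : dlogU (- t) = - dlogU t. Proof. by rewrite /dlogU UN dUN mulNr. Qed.

Lemma hderiv_LU t : - omega < t < omega -> hderiv logU t (dlogU t).
Proof. by move=> ht; apply: hderiv_ln; [exact: U_gt0|exact: hderiv_U]. Qed.

Lemma hderiv_V t : - omega < t < omega ->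
  hderiv dlogU t ((ddU q t * U q t - dU q t ^+ 2) / U q t ^+ 2).
Proof.
move=> ht; have u0 : U q t != 0 by rewrite gt_eqF ?U_gt0.
apply: hderiv_congr; first exact: (hderivM (hderiv_dU q t) (hderivV u0 (hderiv_U q t))).
by rewrite /=; move: (U q t) (dU q t) (ddU q t) u0 => u d e u0; field.
Qed.

Lemma dV_le t : - omega < t < omega ->
  (ddU q t * U q t - dU q t ^+ 2) / U q t ^+ 2 <= - 2^-1.
Proof.
move=> ht; have u0 := U_gt0 ht.
rewrite ler_pdivrMr ?exprn_gt0 //.
(* At t = 0 the identities multiplied by sin t carry no information, so the second derivative is
   computed separately. *)
case: (eqVneq t 0) => [->|t0].
  by rewrite U0 dU0; have := ddU0 hq; have := q_ge2; nra.
have s0 : sin t != 0.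
  move/andP: ht => [h1 h2]; case: (ltgtP t 0) t0 => // h _.
    by rewrite -oppr_eq0 -sinN gt_eqF // sin_gt0_omega //; lra.
  by rewrite gt_eqF // sin_gt0_omega // h.
by have := U_curv hq s0; lra.
Qed.

Lemma V_decr x y : - omega < x -> x <= y -> y < omega -> dlogU y - dlogU x <= - ((y - x) / 2).
Proof.
move=> hx; rewrite le_eqVlt => /predU1P[->|xy] hy; first by lra.
have [z hz|c [hc ->]] := @mvt_cc _ dlogU (fun t => (ddU q t * U q t - dU q t ^+ 2) / U q t ^+ 2) _ _ xy.
  by apply: hderiv_V; lra.
have hV : (ddU q c * U q c - dU q c ^+ 2) / U q c ^+ 2 <= - 2^-1 by apply: dV_le; lra.
nra.
Qed.

Lemma V_nincr x y : - omega < x -> x <= y -> y < omega -> dlogU y <= dlogU x.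
Proof. by move=> h1 h2 h3; have := V_decr h1 h2 h3; lra. Qed.

Lemma LU_bounds x y : - omega < x -> x <= y -> y < omega ->
  dlogU y * (y - x) <= logU y - logU x <= dlogU x * (y - x).
Proof.
move=> hx; rewrite le_eqVlt => /predU1P[->|xy] hy; first by rewrite !subrr !mulr0 lexx.
have [z hz|c [/andP[c1 c2] ->]] := @mvt_cc _ logU dlogU _ _ xy; first by apply: hderiv_LU; lra.
have d0 : 0 <= y - x by lra.
by rewrite !ler_wpM2r // V_nincr //; lra.
Qed.

Lemma LU_concave x y d : - omega < x -> x <= y -> 0 <= d -> y + d < omega ->
  logU (y + d) - logU y <= logU (x + d) - logU x.
Proof.
move=> hx xy; rewrite le_eqVlt => /predU1P[<-|d0] hy; first by rewrite !addr0 !subrr.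
pose g z := logU (z + y) - logU (z + x).
suff : g d <= g 0 by rewrite /g !add0r ![d + _]addrC; lra.
rewrite -lerN2; apply: (@derive_ge0_le _ (fun z => - g z) (fun z => (dlogU (z + x) * (1 + 0) - dlogU (z + y) * (1 + 0)))); first exact: ltW.
  move=> z hz; rewrite /g; under eq_fun do rewrite opprB.
  apply: hderivB; (apply: hderiv_comp; [apply: hderiv_LU; lra|]);
   by apply: hderivD; [exact: hderiv_id|exact: hderiv_cst].
by move=> z hz; rewrite !addr0 !mulr1 subr_ge0; apply: V_nincr; lra.
Qed.

Lemma V_cot t : - omega < t < omega -> t != 0 ->
  dlogU t = q%:R * (cos (q%:R * t) / sin (q%:R * t)) - cos t / sin t.
Proof.
move=> ht t0; have u0 := U_gt0 ht.
have s0 : sin t != 0.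
  move/andP: ht => [h1 h2]; case: (ltgtP t 0) t0 => // h _.
    by rewrite -oppr_eq0 -sinN gt_eqF // sin_gt0_omega //; lra.
  by rewrite gt_eqF // sin_gt0_omega // h.
rewrite -U_sin /dlogU.
have -> : dU q t = (q%:R * cos (q%:R * t) - U q t * cos t) / sin t by rewrite -dU_sin mulfK.
by field; rewrite s0 gt_eqF.
Qed.

Lemma lnU_abs t : sin (q%:R * t) != 0 -> ln `|U q t| = ln `|sin (q%:R * t)| - ln `|sin t|.
Proof.
move=> s0; have : U q t * sin t != 0 by rewrite U_sin.
rewrite mulf_eq0 negb_or => /andP[u0 t0].
by rewrite -ln_div ?posrE ?normr_gt0 // -U_sin normrM mulfK // normr_eq0.
Qed.

Lemma LU_abs t : - omega < t < omega -> logU t = ln `|U q t|.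
Proof. by move=> /U_gt0 u0; rewrite /logU gtr0_norm. Qed.

End DirichletKernel.

(** * The sub-action inequality *)

Section Core.
Variables (R : realType) (q : nat) (hq : (2 <= q)%N).
Implicit Types (al ka be t x y d : R) (P : R -> R) (k : nat).
Notation w := (omega R q).
Notation LU := (@logU R q).
Notation V := (@dlogU R q).

(* In the coordinate t = pi (x + c) the circle is R / pi Z, the map is t |-> q t - ka, and P is a
   candidate sub-action for the arc [- al, w - al], on which it is given by the inverse branch. *)
Definition sturmian_eq al ka be P : Prop :=
  [/\ 0 < al < w,
      forall x, P (x + pi) = P x,
      forall x y, x <= y ->
        V (w - al) / (q%:R - 1) * (y - x) <= P y - P x <= V (- al) / (q%:R - 1) * (y - x)
    & forall t, - al <= t <= w - al -> P (q%:R * t - ka) = LU t + P t - be].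

(** The reflection t -> - t exchanges the two ends of the arc, so the estimates below may assume al
    <= w / 2. *)
Lemma sturmian_eqN al ka be P : sturmian_eq al ka be P ->
  sturmian_eq (w - al) (- ka) be (fun x => P (- x)).
Proof.
move=> [hal hper hsl heq]; split.
- lra.
- by move=> x; rewrite opprD -(hper (- x - pi)) subrK.
- move=> x y xy; have := hsl (- y) (- x); rewrite lerN2 => /(_ xy).
  have -> : w - (w - al) = al by ring.
  rewrite !VN !opprK; move: (V (w - al)) (V al) => a b.
  by rewrite !mulNr; lra.
- move=> t ht; have := heq (- t); rewrite LUN => <-; last by lra.
  by congr P; ring.
Qed.

Section WithP.
Variables (al ka be : R) (P : R -> R).
Hypothesis H : sturmian_eq al ka be P.
(** Formally q P'(q t - ka) = V t + P' t, so P' is a sum of values of [V] on the arc with weights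
    q^-n, n >= 1, of total 1 / (q - 1). As [V] decreases, its values at the two ends give the
    extreme slopes [A] and [B]. *)
Let A := V (w - al) / (q%:R - 1).
Let B := V (- al) / (q%:R - 1).

Let hal : 0 < al < w. Proof. by case: H. Qed.
Let hper x : P (x + pi) = P x. Proof. by case: H. Qed.
Let hA x y : x <= y -> A * (y - x) <= P y - P x.
Proof. by case: H => _ _ + _ => /[apply] /andP[]. Qed.
Let hB x y : x <= y -> P y - P x <= B * (y - x).
Proof. by case: H => _ _ + _ => /[apply] /andP[]. Qed.
Let heq t : - al <= t <= w - al -> P (q%:R * t - ka) = LU t + P t - be.
Proof. by case: H => _ _ _ h; exact: h. Qed.
Let q2 : 2 <= q%:R :> R. Proof. exact: q_ge2. Qed.
Let w0 : 0 < w. Proof. exact: omega_gt0. Qed.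
Let qw : q%:R * w = pi. Proof. exact: q_omega. Qed.

Ltac facts := pose proof hal; pose proof q2; pose proof w0.

Lemma periodZ (m : int) x : P (x + m%:~R * pi) = P x.
Proof.
facts.
have pos (n : nat) y : P (y + n%:R * pi) = P y.
  elim: n => [|n IH]; first by rewrite mul0r addr0.
  by rewrite -natr1 mulrDl mul1r addrA hper.
case: m => n; first exact: pos.
by rewrite NegzE mulrNz mulNr -[LHS](pos n.+1) subrK.
Qed.

Lemma arc_repr x : exists t (m : int), - al <= t < w - al /\ x = q%:R * t - ka + m%:~R * pi.
Proof.
facts.
pose m : int := Num.floor ((x + ka + q%:R * al) / pi).
exists ((x + ka - m%:~R * pi) / q%:R), m.
have p0 := @pi_gt0 R.
split; last by field; lra.
have /andP[h1 h2] := floor_itv ((x + ka + q%:R * al) / pi).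
move: h1 h2; rewrite -/m intrD ler_pdivlMr // ltr_pdivrMr // => h1 h2.
rewrite ler_pdivlMr ?ltr_pdivrMr; [|lra|lra].
have e : (w - al) * q%:R = pi - q%:R * al by rewrite -qw; ring.
rewrite -[1%:~R]/(1 : R) in h2.
rewrite e; move: (m%:~R) h1 h2 => z h1 h2.
by apply/andP; split; lra.
Qed.

(** Since q w = pi, both ends of the arc have the same image modulo the period. *)
Lemma ends_eq : LU (w - al) + P (w - al) = LU (- al) + P (- al).
Proof.
facts.
have h1 : P (q%:R * (w - al) - ka) = LU (w - al) + P (w - al) - be by apply: heq; lra.
have h2 : P (q%:R * (- al) - ka) = LU (- al) + P (- al) - be by apply: heq; lra.
have e : q%:R * (w - al) - ka = q%:R * (- al) - ka + pi by rewrite -qw; ring.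
by move: h1; rewrite e hper h2; lra.
Qed.

Lemma piece_eq t d : - al <= t -> 0 <= d -> t + d <= w - al ->
  P (q%:R * t - ka + q%:R * d) - P (q%:R * t - ka) = LU (t + d) - LU t + (P (t + d) - P t).
Proof.
facts.
move=> h1 h2 h3.
have -> : q%:R * t - ka + q%:R * d = q%:R * (t + d) - ka by ring.
by rewrite !heq; lra.
Qed.

(** Pull the segment back to the arc. By concavity [LU] grows most from the left end. If the
    pulled-back segment runs over the right end, it re-enters at - al without a jump by [ends_eq],
    and concavity allows its first piece to be moved behind the second one. *)
Lemma incr_le x d : 0 <= d <= w ->
  P (x + q%:R * d) - P x <= LU (- al + d) - LU (- al) + B * d.
Proof.
facts.
move=> /andP[d0 dw]; have [t [m [/andP[t1 t2] ->]]] := arc_repr x.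
rewrite addrAC !periodZ.
case: (leP (t + d) (w - al)) => td.
  rewrite piece_eq //.
  have := hB (_ : t <= t + d); rewrite lerDl d0 => /(_ isT).
  have -> : t + d - t = d by ring.
  have := @LU_concave R q hq (- al) t d; lra.
pose e := w - al - t; pose f := t + d - w.
have -> : q%:R * t - ka + q%:R * d = q%:R * f - ka + pi by rewrite /f -qw; ring.
have f1 : P (q%:R * f - ka) = LU f + P f - be by apply: heq; rewrite /f; lra.
have f2 : P (q%:R * t - ka) = LU t + P t - be by apply: heq; lra.
rewrite hper f1 f2.
have E := ends_eq.
have b1 : P (w - al) - P t <= B * (w - al - t) by apply: hB; lra.
have b2 : P f - P (- al) <= B * (f - - al) by apply: hB; rewrite /f; lra.
have eB : B * d = B * (w - al - t) + B * (f - - al) by rewrite /f; ring.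
have c1 : LU (t + (w - al - t)) - LU t <= LU (f + (w - al - t)) - LU f.
  by apply: LU_concave => //; rewrite /f; lra.
have e1 : t + (w - al - t) = w - al by ring.
have e2 : f + (w - al - t) = - al + d by rewrite /f; ring.
by rewrite e1 e2 in c1; lra.
Qed.

Lemma sin_al_gt0 : 0 < sin al. Proof. facts; by apply: (sin_gt0_omega hq); exact: hal. Qed.
Lemma sin_wal_gt0 : 0 < sin (w - al). Proof. facts; by apply: (sin_gt0_omega hq); lra. Qed.

Lemma LU_al : LU (- al) = ln (sin (q%:R * al)) - ln (sin al).
Proof.
facts.
have s1 := sinq_gt0 hq hal; have s2 := sin_al_gt0.
rewrite LUN LU_abs //; last by lra.
by rewrite lnU_abs ?gt_eqF // !gtr0_norm.
Qed.

Lemma LU_wal : LU (w - al) = ln (sin (q%:R * al)) - ln (sin (w - al)).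
Proof.
facts.
have h : 0 < w - al < w by lra.
have s1 := sinq_gt0 hq hal; have s2 := sin_wal_gt0.
have e : sin (q%:R * (w - al)) = sin (q%:R * al).
  by rewrite mulrBr qw sinB sinpi cospi mul0r mulN1r sub0r opprK.
rewrite LU_abs //; last by lra.
by rewrite lnU_abs e ?gt_eqF // !gtr0_norm.
Qed.

Lemma P_ends : P (w - al) - P (- al) = ln (sin (w - al)) - ln (sin al).
Proof. facts; by have := ends_eq; rewrite LU_al LU_wal; lra. Qed.

(** As q (w - al) = pi - q al, the cotangents of q al cancel between the two ends, and cot al + cot
    (w - al) remains. *)
Lemma slopes_diff : (B - A) * (q%:R - 1) = sin w / (sin al * sin (w - al)).
Proof.
facts.
have s1 := sinq_gt0 hq hal; have s2 := sin_al_gt0; have s3 := sin_wal_gt0.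
have q1 : q%:R - 1 != 0 :> R by lra.
rewrite /A /B -mulrBl divfK // VN.
rewrite !V_cot //; [|lra|lra|lra|lra].
have -> : sin (q%:R * (w - al)) = sin (q%:R * al).
  by rewrite mulrBr qw sinB sinpi cospi mul0r mulN1r sub0r opprK.
have -> : cos (q%:R * (w - al)) = - cos (q%:R * al).
  by rewrite mulrBr qw cosB sinpi cospi mul0r mulN1r addr0.
have -> : sin w = sin (w - al) * cos al + cos (w - al) * sin al by rewrite -sinD subrK.
by field; rewrite !gt_eqF.
Qed.

Lemma ln_sin_ratio_mvt v u : 0 < v -> v < u -> u < w -> exists c, v < c < u /\
  (ln (sin (w - v)) - ln (sin v)) - (ln (sin (w - u)) - ln (sin u)) =
  (u - v) * (sin w / (sin c * sin (w - c))).
Proof.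
facts.
move=> v0 vu uw.
pose N x := ln (sin (w - x)) - ln (sin x).
have [x hx|c [hc e]] := @mvt_cc R N (fun x => cos (w - x) * (0 - 1) / sin (w - x) - cos x / sin x) _ _ vu.
  rewrite /N /=; apply: hderivB; (apply: hderiv_ln; first by apply: (sin_gt0_omega hq); lra).
    by apply: hderiv_comp; [exact: hderiv_sin|apply: hderivB; [exact: hderiv_cst|exact: hderiv_id]].
  exact: hderiv_sin.
exists c; split => //; rewrite -/(N v) -/(N u) -opprB e.
have c1 : 0 < sin c by apply: (sin_gt0_omega hq); lra.
have c2 : 0 < sin (w - c) by apply: (sin_gt0_omega hq); lra.
have -> : sin w = sin (w - c) * cos c + cos (w - c) * sin c by rewrite -sinD subrK.
by field; rewrite !gt_eqF.
Qed.

Lemma sin_prod x : sin x * sin (w - x) = sin (w / 2) ^+ 2 - sin (w / 2 - x) ^+ 2.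
Proof.
have key (a b : R) : sin (a - b) * sin (a + b) = sin a ^+ 2 - sin b ^+ 2.
  rewrite sinB sinD; transitivity (sin a ^+ 2 * cos b ^+ 2 - cos a ^+ 2 * sin b ^+ 2); first by ring.
  by rewrite !cos2sin2; ring.
by rewrite -key; congr (sin _ * sin _); field.
Qed.

Lemma sin_prod_lt c : 0 < c -> c < al -> al <= w / 2 ->
  sin c * sin (w - c) < sin al * sin (w - al).
Proof.
facts.
move=> c0 ca aw; rewrite !sin_prod ltrD2l ltrN2.
have W := omega_le R hq; have p0 := @pi_gt0 R.
rewrite ltr_sqr ?nnegrE.
- by rewrite ltr_sin ?in_itv /=; lra.
- by apply: sin_ge0_pi; lra.
- by apply: sin_ge0_pi; lra.
Qed.

(** At t = - al both sides agree by [P_ends]. Moving away from that end, the left side grows at rate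
    at most B - A, the right side at rate sin w / (sin c * sin (w - c)), which for c < al <= w / 2
    exceeds (q - 1) (B - A) by [slopes_diff]. *)
Lemma near_left t : al <= w / 2 -> - al < t < 0 ->
  P (t + w) - P t < ln `|sin (t + w)| - ln `|sin t|.
Proof.
facts.
move=> aw ht; pose v := - t.
have sv : 0 < sin v by apply: (sin_gt0_omega hq); rewrite /v; lra.
have swv : 0 < sin (w - v) by apply: (sin_gt0_omega hq); rewrite /v; lra.
have -> : t + w = w - v by rewrite /v; ring.
have -> : `|sin t| = sin v by rewrite -[t]opprK -/v sinN normrN gtr0_norm.
rewrite gtr0_norm //.
have [c [hc e]] : exists c, v < c < al /\ (ln (sin (w - v)) - ln (sin v)) -
   (ln (sin (w - al)) - ln (sin al)) = (al - v) * (sin w / (sin c * sin (w - c))).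
  by apply: ln_sin_ratio_mvt; rewrite /v; lra.
have b1 : P (w - v) - P (w - al) <= B * ((w - v) - (w - al)) by apply: hB; rewrite /v; lra.
have b2 : A * (t - - al) <= P t - P (- al) by apply: hA; lra.
have e2 : B * ((w - v) - (w - al)) - A * (t - - al) = (B - A) * (al - v) by rewrite /v; ring.
have E := P_ends.
have D := slopes_diff.
have c1 : 0 < sin c by apply: (sin_gt0_omega hq); rewrite /v in hc; lra.
have c2 : 0 < sin (w - c) by apply: (sin_gt0_omega hq); rewrite /v in hc; lra.
have sw : 0 < sin w by apply: sin_gt0_pi; have := omega_le R hq; have := @pi_gt0 R; lra.
have s2 := sin_al_gt0; have s3 := sin_wal_gt0.
have lt1 : (B - A) * (q%:R - 1) < sin w / (sin c * sin (w - c)).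
  rewrite D ltr_pM2l // ltf_pV2 ?posrE ?mulr_gt0 //.
  by apply: sin_prod_lt => //; rewrite /v in hc; lra.
have BA : 0 <= B - A.
  rewrite -(@pmulr_lge0 _ (q%:R - 1)) ?D; last by lra.
  by rewrite divr_ge0 ?mulr_ge0 ?ltW.
have lt2 : (B - A) * (al - v) < (al - v) * (sin w / (sin c * sin (w - c))).
  rewrite mulrC ltr_pM2l; last by rewrite /v; lra.
  by apply: le_lt_trans lt1; rewrite ler_peMr //; lra.
by lra.
Qed.

(** The same comparison of rates from the right end. Here c may come close to w / 2, where the rate
    of the right side is smallest, namely sin w / sin^2 (w / 2); the hypothesis says that even this
    beats B - A. For q = 2 it can never hold, because sin al * sin (w - al) <= sin^2 (w / 2). *)
Lemma near_right t : sin (w / 2) ^+ 2 < (q%:R - 1) * (sin al * sin (w - al)) ->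
  0 < t < w - al -> P (t - w) - P t < ln `|sin (t - w)| - ln `|sin t|.
Proof.
facts.
move=> hs ht.
have st : 0 < sin t by apply: (sin_gt0_omega hq); lra.
have swt : 0 < sin (w - t) by apply: (sin_gt0_omega hq); lra.
have -> : `|sin (t - w)| = sin (w - t) by rewrite -opprB sinN normrN gtr0_norm.
rewrite gtr0_norm //.
have [c [hc e]] : exists c, t < c < w - al /\ (ln (sin (w - t)) - ln (sin t)) -
   (ln (sin (w - (w - al))) - ln (sin (w - al))) = (w - al - t) * (sin w / (sin c * sin (w - c))).
  by apply: ln_sin_ratio_mvt; lra.
have ea : w - (w - al) = al by ring.
rewrite ea in e.
have b1 : P (w - al) - P t <= B * (w - al - t) by apply: hB; lra.
have b2 : A * (- al - (t - w)) <= P (- al) - P (t - w) by apply: hA; lra.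
have e2 : B * (w - al - t) - A * (- al - (t - w)) = (B - A) * (w - al - t) by ring.
have E := P_ends.
have D := slopes_diff.
have c1 : 0 < sin c by apply: (sin_gt0_omega hq); lra.
have c2 : 0 < sin (w - c) by apply: (sin_gt0_omega hq); lra.
have sw : 0 < sin w by apply: sin_gt0_pi; have := omega_le R hq; have := @pi_gt0 R; lra.
have s2 := sin_al_gt0; have s3 := sin_wal_gt0.
have q1 : 0 < q%:R - 1 :> R by lra.
have lt1 : B - A < sin w / (sin c * sin (w - c)).
  rewrite ltr_pdivlMr ?mulr_gt0 //.
  have D' : sin w = (B - A) * ((q%:R - 1) * (sin al * sin (w - al))).
    by rewrite mulrA D divfK // gt_eqF ?mulr_gt0.
  have BA : 0 < B - A by rewrite -(pmulr_lgt0 _ q1) D divr_gt0 ?mulr_gt0.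
  rewrite D' ltr_pM2l //; apply: le_lt_trans hs.
  by rewrite sin_prod gerBl sqr_ge0.
have lt2 : (B - A) * (w - al - t) < (w - al - t) * (sin w / (sin c * sin (w - c))).
  by rewrite mulrC ltr_pM2l //; lra.
by lra.
Qed.

End WithP.
End Core.

(** * Numerical inequalities for the explicit estimates *)

Section Numeric.
Variable R : realType.
Implicit Types x y : R.

Lemma xcos_le_sin x : 0 <= x <= pi -> x * cos x <= sin x.
Proof.
move=> /andP[x0 xp].
pose g y : R := sin y - y * cos y.
suff : g 0 <= g x by rewrite /g sin0 mul0r subr0; lra.
apply: (@derive_ge0_le R g (fun y => cos y - (1 * cos y + y * - sin y))) => // y hy.
  apply: hderivB; first exact: hderiv_sin.
  by apply: hderivM; [exact: hderiv_id|exact: hderiv_cos].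
have -> : cos y - (1 * cos y + y * - sin y) = y * sin y by ring.
by rewrite mulr_ge0 ?sin_ge0_pi //; lra.
Qed.

Lemma ln_le_half x : 1 <= x -> ln x <= (x - x^-1) / 2.
Proof.
move=> x1.
pose g y : R := (y - y^-1) * 2^-1 - ln y.
suff : g 1 <= g x by rewrite /g ln1 invr1; lra.
apply: (@derive_ge0_le R g (fun y => ((1 - - (1 / y ^+ 2)) * 2^-1 + (y - y^-1) * 0) - y^-1)) => // y hy.
  apply: hderivB; last by apply: hderiv_ln0; lra.
  apply: hderivM; last exact: hderiv_cst.
  apply: hderivB; first exact: hderiv_id.
  by apply: hderivV; [lra|exact: hderiv_id].
have y0 : y != 0 by lra.
have -> : (1 - - (1 / y ^+ 2)) * 2^-1 + (y - y^-1) * 0 - y^-1 = (1 - y^-1) ^+ 2 / 2 by field.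
by rewrite divr_ge0 ?sqr_ge0.
Qed.

Lemma sin_ge_mid (a x : R) : 0 <= a <= pi / 2 -> a <= x <= pi - a -> sin a <= sin x.
Proof.
move=> ha hx; rewrite -subr_ge0.
pose u := (x + a) / 2; pose v := (x - a) / 2.
have -> : sin x - sin a = 2 * (cos u * sin v).
  have {1}-> : x = u + v by rewrite /u /v; field.
  have {1}-> : a = u - v by rewrite /u /v; field.
  by rewrite sinD sinB; ring.
rewrite mulr_ge0 // mulr_ge0 //.
  by apply: cos_ge0_pihalf; rewrite /u; have := @pi_gt0 R; lra.
by apply: sin_ge0_pi; rewrite /v; have := @pi_gt0 R; lra.
Qed.

Lemma U_abs_le (q : nat) x : (0 < q)%N -> `|U q x| <= q%:R.
Proof.
move=> q0; apply: (le_trans (U_le x q0)).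
have : `|cos x| <= 1 by exact: cos_max.
have : 1 <= q%:R :> R by rewrite ler1n.
by have := normr_ge0 (cos x); nra.
Qed.

Lemma cos_pi3 : cos (omega R 3) = 2^-1.
Proof.
have h := q_omega R (isT : (2 <= 3)%N); set w := omega R 3 in h *.
have w0 : 0 < w by exact: omega_gt0.
have s0 : 0 < sin w by apply: sin_gt0_pi; have := @pi_gt0 R; lra.
have : sin (pi - w) = sin w by rewrite sinB sinpi cospi mul0r mulN1r sub0r opprK.
have -> : pi - w = w + w by rewrite -h; ring.
rewrite sinD => e; have {}e : 2 * cos w * sin w = 1 * sin w by rewrite mul1r -[RHS]e; ring.
by have := mulIf (lt0r_neq0 s0) e; lra.
Qed.

Lemma sin_pi3_sqr : sin (omega R 3) ^+ 2 = 3 / 4.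
Proof. by rewrite sin2cos2 cos_pi3; field. Qed.

(** As pi < 19/6, the number 19/30 exceeds pi / 5: this is a lower bound for w cot w valid for all q
    >= 5. *)
Lemma w_cot_w x : 0 < x -> x < 19 / 30 -> 427 / 500 * sin x <= x * cos x.
Proof.
move=> x0 x1.
have y2 : x ^+ 2 <= 361 / 900 by nra.
have y0 : 0 <= x ^+ 2 by apply: sqr_ge0.
have h1 := sin_le5 (ltW x0); have h2 := cos_ge2 (ltW x0).
have e1 : x - x ^+ 3 / 6 + x ^+ 5 / 120 = x * (1 - x ^+ 2 / 6 + (x ^+ 2) ^+ 2 / 120) by field.
rewrite e1 in h1; clear e1 x1; move: (x ^+ 2) (sin x) (cos x) y0 y2 h1 h2 => y s c y0 y2 h1 h2.
have y3 : y ^+ 2 <= y * (361 / 900) by rewrite expr2 ler_wpM2l.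
have k : 427 / 500 * (1 - y / 6 + y ^+ 2 / 120) <= c by lra.
have : x * (427 / 500 * (1 - y / 6 + y ^+ 2 / 120)) <= x * c by rewrite ler_pM2l.
move: h1; rewrite mulrCA; move: (x * _) (x * _) => a b; lra.
Qed.

(** Here t = tan al for q = 4, and t^2 + 2 t <= 1 expresses al <= w / 2 = pi / 8. The left side
    majorizes the slope term: 19/144 is 2 pi / 48 with 19/6 for pi, and 5 t / (1 - t^2) bounds
    [V (- al)]. *)
Lemma tan_ineq4 (t : R) : 0 < t -> t ^+ 2 + 2 * t <= 1 ->
  19 / 144 * (5 * t / (1 - t ^+ 2)) < 2 * (t - t ^+ 2) / (1 + t).
Proof.
move=> t0 t1.
have t2 : 0 < 1 - t ^+ 2 by nra.
have -> : 2 * (t - t ^+ 2) / (1 + t) = (2 * t * (1 - t) ^+ 2) / (1 - t ^+ 2).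
  have n1 : 1 + t != 0 by apply: lt0r_neq0; lra.
  have n2 : 1 - t != 0 by apply: lt0r_neq0; nra.
  have -> : 1 - t ^+ 2 = (1 - t) * (1 + t) by ring.
  by field; rewrite n1 n2.
rewrite mulrA ltr_pM2r ?invr_gt0 //.
have t3 : t < 83 / 200 by rewrite ltNge; apply/negP => h; nra.
have t4 : 1 - t > 117 / 200 by lra.
have -> : 19 / 144 * (5 * t) = t * (95 / 144) by field.
have -> : 2 * t * (1 - t) ^+ 2 = t * (2 * (1 - t) ^+ 2) by ring.
by rewrite ltr_pM2l //; clear -t4; nra.
Qed.

(** With c = cos al the argument of the logarithm is the ratio of sin (w + al) to sin (w - al) times
    U 4 (- al) / 4. Replacing c^3 by the smaller c^4 makes it a square, to which ln y >= 1 - 1 / y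
    applies. *)
Lemma ln_tan4 (t c : R) : 0 < t -> 0 < c <= 1 -> c ^+ 2 * (1 + t ^+ 2) = 1 ->
  2 * (t - t ^+ 2) / (1 + t) <= ln ((1 + t) ^+ 2 * c ^+ 3).
Proof.
move=> t0 /andP[c0 c1] h.
have n3 : 0 < 1 + t ^+ 2 by nra.
have c2 : c ^+ 2 = (1 + t ^+ 2)^-1 by apply: (mulIf (lt0r_neq0 n3)); rewrite h mulVf ?gt_eqF.
have e4 : ((1 + t) / (1 + t ^+ 2)) ^+ 2 <= (1 + t) ^+ 2 * c ^+ 3.
  rewrite exprMn ler_pM2l ?exprn_gt0 //; last lra.
  by rewrite -c2 -exprM ler_wiXn2l // ltW.
have e5 : 0 < (1 + t) / (1 + t ^+ 2) by rewrite divr_gt0 //; lra.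
apply: (@le_trans _ _ (ln (((1 + t) / (1 + t ^+ 2)) ^+ 2))); last first.
  by rewrite ler_ln ?posrE ?exprn_gt0 // mulr_gt0 ?exprn_gt0 //; lra.
rewrite lnXn // -[X in _ <= X]mulr_natl.
rewrite -[X in ln X]invrK lnV ?posrE ?invr_gt0 //.
have b := @le_ln1Dx R (((1 + t) / (1 + t ^+ 2))^-1 - 1).
have e6 : 1 + (((1 + t) / (1 + t ^+ 2))^-1 - 1) = ((1 + t) / (1 + t ^+ 2))^-1 by ring.
rewrite e6 in b.
have {}b : ln ((1 + t) / (1 + t ^+ 2))^-1 <= ((1 + t) / (1 + t ^+ 2))^-1 - 1.
  by apply: b; rewrite ltrBrDl subrr invr_gt0.
have -> : 2 * (t - t ^+ 2) / (1 + t) = 2 * - (((1 + t) / (1 + t ^+ 2))^-1 - 1).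
  by field; rewrite !gt_eqF //; lra.
by rewrite ler_pM2l // lerN2.
Qed.

Lemma U4E (x : R) : U 4 x = 4 * cos x * (2 * cos x ^+ 2 - 1).
Proof.
rewrite /= !mul0r add0r cos0 !mul1r.
have -> : 2%:R * x = x + x by ring.
have -> : 3%:R * x = x + (x + x) by ring.
rewrite !cosD sinD; transitivity (4 * cos x * (cos x ^+ 2 - sin x ^+ 2)); first by ring.
by rewrite sin2cos2; ring.
Qed.

Lemma dU4E (x : R) : dU 4 x = - (4 * sin x * (6 * cos x ^+ 2 - 1)).
Proof.
rewrite /= !mul0r add0r cos0 !mul1r.
have -> : 2%:R * x = x + x by ring.
have -> : 3%:R * x = x + (x + x) by ring.
rewrite !sinD !cosD; transitivity (- (4 * sin x * (5 * cos x ^+ 2 - sin x ^+ 2))); first by ring.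
by rewrite sin2cos2; ring.
Qed.

End Numeric.

(** * Non-neighbouring preimages for q at least 4 *)

Section Far.
Variables (R : realType) (q : nat) (hq : (2 <= q)%N) (hq3 : (3 <= q)%N).
Implicit Types (al x y d t : R) (k : nat).
Notation w := (omega R q).
Notation LU := (@logU R q).
Notation V := (@dlogU R q).

(* The left side bounds the increments of the sub-action over k / q of the circle; the right side is
   the least gain of the Dirichlet kernel when passing to a preimage outside (- w, w). *)
Definition far_gain al : Prop := forall k, (0 < k)%N -> (k.+1 < q)%N ->
  LU (- al + k%:R * w / q%:R) - LU (- al) + V (- al) / (q%:R - 1) * (k%:R * w / q%:R)
  < ln (sin (w + al)) - ln (sin (w - al)).

Lemma omega_le3 : w <= pi / 3.
Proof.
have := q_omega R hq; have := omega_gt0 R hq.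
have : 3 <= q%:R :> R by rewrite (ler_nat _ 3).
nra.
Qed.

Lemma V_neg_ge0 al : 0 <= al < w -> 0 <= V (- al).
Proof.
move=> hal; have v0 : V 0 = 0 by rewrite /dlogU dU0 mul0r.
by rewrite -v0; apply: V_nincr => //; lra.
Qed.

(** The concave [LU] lies above its chord over [- w / 2, 0], whose end values are - ln (sin (w / 2))
    and ln q. *)
Lemma kernel_drop al : 0 < al <= w / 2 ->
  (ln q%:R - LU (- al)) * (w / 2) <= al * ln (q%:R * sin (w / 2)).
Proof.
move=> hal; have w0 := omega_gt0 R hq.
have b1 : LU 0 - LU (- al) <= V (- al) * (0 - - al).
  by have /andP[] : V 0 * (0 - - al) <= LU 0 - LU (- al) <= V (- al) * (0 - - al)
    by apply: LU_bounds => //; lra.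
have b2 : V (- al) * (- al - - (w / 2)) <= LU (- al) - LU (- (w / 2)).
  by have /andP[] : V (- al) * (- al - - (w / 2)) <= LU (- al) - LU (- (w / 2)) <=
    V (- (w / 2)) * (- al - - (w / 2)) by apply: LU_bounds => //; lra.
have hs : 0 < sin (w / 2) by apply: (sin_gt0_omega hq); lra.
have e0 : LU 0 = ln q%:R by rewrite /logU U0.
have e1 : LU (- (w / 2)) = - ln (sin (w / 2)).
  have e : sin (q%:R * (w / 2)) = 1 by rewrite mulrA q_omega // sin_pihalf.
  rewrite LUN LU_abs //; last by lra.
  by rewrite lnU_abs e ?oner_eq0 // normr1 ln1 gtr0_norm // sub0r.
rewrite lnM ?posrE ?(q_gt0 R hq) //.
rewrite e0 in b1; rewrite e1 in b2; clear e0 e1 hs.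
move: (ln q%:R) (LU (- al)) (V (- al)) (ln (sin (w / 2))) b1 b2 => a b c d b1 b2.
have h1 : (a - b) * (w / 2 - al) <= c * (0 - - al) * (w / 2 - al) by rewrite ler_wpM2r //; lra.
have h2 : al * (c * (- al - - (w / 2))) <= al * (b - - d) by rewrite ler_wpM2l //; lra.
lra.
Qed.

Lemma V_neg_le al : 0 < al <= w / 2 -> V (- al) <= q%:R * (q%:R * al) / 2.
Proof.
move=> hal; have w0 := omega_gt0 R hq.
have sa : 0 < sin al by apply: (sin_gt0_omega hq); lra.
have sx : 0 < sin (q%:R * al) by apply: (sinq_gt0 hq); lra.
have p0 := @pi_gt0 R; have W := omega_le R hq; have Q := q_gt0 R hq.
have a0 : 0 < al by lra.
have x0 : 0 < q%:R * al by exact: mulr_gt0.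
have x1 : q%:R * al <= pi / 2.
  by rewrite -(q_omega R hq) -mulrA ler_pM2l //; lra.
rewrite VN V_cot //; [|lra|lra].
have c1 : cos al / sin al <= al^-1.
  rewrite ler_pdivrMr // mulrC ler_pdivlMr //.
  by rewrite mulrC; apply: xcos_le_sin; lra.
have c2 : (1 - (q%:R * al) ^+ 2 / 2) / (q%:R * al) <= cos (q%:R * al) / sin (q%:R * al).
  apply: (@le_trans _ _ (cos (q%:R * al) / (q%:R * al))).
    by rewrite ler_pM2r ?invr_gt0 //; apply: cos_ge2; exact: ltW.
  apply: ler_wpM2l; first by apply: cos_ge0_pihalf; lra.
  by rewrite lef_pV2 ?posrE //; apply: sin_le; exact: ltW.
have e : q%:R * ((1 - (q%:R * al) ^+ 2 / 2) / (q%:R * al)) = al^-1 - q%:R * (q%:R * al) / 2.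
  by field; rewrite !gt_eqF.
have : q%:R * ((1 - (q%:R * al) ^+ 2 / 2) / (q%:R * al)) <= q%:R * (cos (q%:R * al) / sin (q%:R * al)).
  by rewrite ler_pM2l.
by rewrite e; lra.
Qed.

(** [ln_ratio_ge] at (a + b) / (a - b) gives 2 b / a, which is 2 cot w tan al here. *)
Lemma sin_ratio_ln al : 0 < al <= w / 2 ->
  2 * (cos w * sin al) / (sin w * cos al) <= ln (sin (w + al)) - ln (sin (w - al)).
Proof.
move=> hal; have w0 := omega_gt0 R hq.
have p0 := @pi_gt0 R; have W := omega_le3.
have sw : 0 < sin w by apply: sin_gt0_pi; lra.
have ca : 0 < cos al by apply: cos_gt0_pihalf; lra.
have sa : 0 < sin al by apply: (sin_gt0_omega hq); lra.
have cw : 0 < cos w by apply: cos_gt0_pihalf; lra.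
have swa : 0 < sin (w - al) by apply: (sin_gt0_omega hq); lra.
have swa2 : 0 < sin (w + al) by apply: sin_gt0_pi; lra.
rewrite -ln_div ?posrE //.
move: swa swa2; rewrite sinB sinD.
have a0 : 0 < sin w * cos al by exact: mulr_gt0.
have b0 : 0 < cos w * sin al by exact: mulr_gt0.
clear hal w0 p0 W sw ca sa cw.
move: (sin w * cos al) (cos w * sin al) a0 b0 => a b a0 b0 ab1 ab2.
have r1 : 1 <= (a + b) / (a - b) by rewrite ler_pdivlMr //; lra.
apply: le_trans (ln_ratio_ge r1).
have n1 : a - b != 0 by rewrite gt_eqF.
have n2 : a != 0 by rewrite gt_eqF.
have -> : (a + b) / (a - b) - 1 = 2 * b / (a - b) by field.
have -> : (a + b) / (a - b) + 1 = 2 * a / (a - b) by field.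
by rewrite le_eqVlt; apply/orP; left; apply/eqP; field; rewrite n1 n2.
Qed.

Lemma LU_step_le al k : 0 < al <= w / 2 -> (0 < k < q)%N ->
  LU (- al + k%:R * w / q%:R) <= ln q%:R.
Proof.
move=> hal /andP[k0 kq]; have w0 := omega_gt0 R hq; have Q := q_gt0 R hq.
have hk : k%:R <= q%:R :> R by rewrite ler_nat ltnW.
have d0 : 0 <= k%:R * w / q%:R by rewrite divr_ge0 // mulr_ge0 // ltW.
have d1 : k%:R * w / q%:R <= w by rewrite ler_pdivrMr // mulrC ler_pM2l.
move: (k%:R * w / q%:R) d0 d1 => d d0 d1.
have hu : 0 < U q (- al + d) by apply: (U_gt0 hq); lra.
rewrite /logU ler_ln ?posrE //.
by apply: (le_trans (ler_norm _)); apply: U_abs_le; exact: leq_ltn_trans kq.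
Qed.

Lemma slope_step_le al k : 0 < al <= w / 2 -> (k.+1 < q)%N ->
  V (- al) / (q%:R - 1) * (k%:R * w / q%:R) <=
  2 * al / w * ((q%:R - 2) / (q%:R * (q%:R - 1)) * (pi ^+ 2 / 4)).
Proof.
move=> hal kq; have w0 := omega_gt0 R hq; have Q := q_gt0 R hq.
have Q3 : 3 <= q%:R :> R by rewrite (ler_nat _ 3).
have kle : k%:R <= q%:R - 2 :> R by have := kq; rewrite -(ler_nat R) -!natr1; lra.
have v1 := V_neg_le hal.
have v0 : 0 <= V (- al) by apply: V_neg_ge0; lra.
have -> : 2 * al / w * ((q%:R - 2) / (q%:R * (q%:R - 1)) * (pi ^+ 2 / 4)) =
  (q%:R * (q%:R * al) / 2) / (q%:R - 1) * ((q%:R - 2) * w / q%:R).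
  have n0 : q%:R - 1 != 0 :> R by apply: lt0r_neq0; lra.
  by rewrite -(q_omega R hq); field; rewrite n0 !gt_eqF.
have q1 : 0 < (q%:R - 1)^-1 :> R by rewrite invr_gt0; lra.
have b1 : 0 <= V (- al) / (q%:R - 1) by rewrite mulr_ge0 // ltW.
have b2 : 0 <= k%:R * w / q%:R by rewrite divr_ge0 // mulr_ge0 // ltW.
have b3 : V (- al) / (q%:R - 1) <= q%:R * (q%:R * al) / 2 / (q%:R - 1) by rewrite ler_pM2r.
have b4 : k%:R * w / q%:R <= (q%:R - 2) * w / q%:R by rewrite ler_pM2r ?invr_gt0 // ler_pM2r.
exact: ler_pM.
Qed.

Lemma ln_half_pi : ln (q%:R * sin (w / 2)) <= 58 / 125.
Proof.
have w0 := omega_gt0 R hq; have Q := q_gt0 R hq; have pl := @pi_lt R.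
have hs : 0 < sin (w / 2) by apply: (sin_gt0_omega hq); lra.
have h1 : q%:R * sin (w / 2) <= 19 / 12.
  apply: (@le_trans _ _ (q%:R * (w / 2))); first by rewrite ler_pM2l // sin_le //; lra.
  by rewrite mulrA q_omega //; lra.
(* [ln_le_half] is sharp only near 1, so 19/12 is split into two factors closer to 1. *)
have h2 : ln (q%:R * sin (w / 2)) <= ln (5 / 4 * (19 / 15)).
  by rewrite ler_ln ?posrE; [lra|exact: mulr_gt0|lra].
have h3 : ln (5 / 4 : R) <= (5 / 4 - (5 / 4)^-1) / 2 by apply: ln_le_half; lra.
have h4 : ln (19 / 15 : R) <= (19 / 15 - (19 / 15)^-1) / 2 by apply: ln_le_half; lra.
have e5 : ln (5 / 4 * (19 / 15) : R) = ln (5 / 4) + ln (19 / 15).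
  by rewrite lnM // posrE; lra.
have h5 : (5 / 4 : R)^-1 = 4 / 5 by field.
have h6 : (19 / 15 : R)^-1 = 15 / 19 by field.
by rewrite e5 in h2; rewrite h5 in h3; rewrite h6 in h4; clear -h2 h3 h4; lra.
Qed.

(** Every term is bounded linearly in s = 2 al / w: the drop of the kernel costs at most 58/125 s,
    the slope term at most 361/960 s, and the ratio of sines gains at least 427/500 s. The margin is
    about 0.014 s. *)
Lemma far_gain5 al : (5 <= q)%N -> 0 < al <= w / 2 -> far_gain al.
Proof.
move=> q5 hal k k0 kq.
have Q5 : 5 <= q%:R :> R by rewrite (ler_nat _ 5).
have w0 := omega_gt0 R hq.
have m1 : LU (- al + k%:R * w / q%:R) <= ln q%:R by apply: LU_step_le => //; rewrite k0 ltnW.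
have m2 := kernel_drop hal; have m3 := slope_step_le hal kq; have m4 := sin_ratio_ln hal.
have m5 := ln_half_pi.
have pl := @pi_lt R; have p0 := @pi_gt0 R.
have w5 : w < 19 / 30 by have := q_omega R hq; clear -Q5 pl w0; nra.
have m6 := w_cot_w w0 w5.
have a0 : 0 < al by lra.
have ca : 0 < cos al by apply: cos_gt0_pihalf; have := omega_le R hq; lra.
have m7 : al * cos al <= sin al by apply: xcos_le_sin; have := omega_le R hq; lra.
have sw : 0 < sin w by apply: sin_gt0_pi; have := omega_le R hq; lra.
pose s := 2 * al / w.
have es : al = s * (w / 2) by rewrite /s; field; lra.
have s0 : 0 < s by rewrite divr_gt0 // mulr_gt0.
have n2 : ln q%:R - LU (- al) <= s * (58 / 125).
  have w2 : 0 < w / 2 by lra.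
  rewrite -(ler_pM2r w2); apply: (le_trans m2).
  have -> : s * (58 / 125) * (w / 2) = al * (58 / 125) by rewrite [in RHS]es; ring.
  by rewrite ler_pM2l.
have n3 : V (- al) / (q%:R - 1) * (k%:R * w / q%:R) <= s * (361 / 960).
  apply: (le_trans m3); rewrite -/s ler_pM2l //.
  have f1 : (q%:R - 2) / (q%:R * (q%:R - 1)) <= 3 / 20 :> R.
    by clear -Q5; rewrite ler_pdivrMr; nra.
  have f0 : 0 <= (q%:R - 2) / (q%:R * (q%:R - 1)) :> R by clear -Q5; rewrite divr_ge0 ?mulr_ge0; lra.
  have f2 : pi ^+ 2 / 4 <= 361 / 144 :> R by clear -p0 pl; nra.
  have f3 : 0 <= pi ^+ 2 / 4 :> R by rewrite divr_ge0 // sqr_ge0.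
  by have h := ler_pM f0 f3 f1 f2; clear -h; lra.
have n4 : s * (427 / 500) <= 2 * (cos w * sin al) / (sin w * cos al).
  rewrite ler_pdivlMr ?mulr_gt0 //.
  have -> : s * (427 / 500) * (sin w * cos al) = s * cos al * (427 / 500 * sin w) by ring.
  apply: (@le_trans _ _ (s * cos al * (w * cos w))).
    by rewrite ler_pM2l; [exact: m6|exact: mulr_gt0].
  have es2 : s * w = 2 * al by rewrite [in RHS]es; field.
  have -> : s * cos al * (w * cos w) = 2 * cos w * (al * cos al).
    by transitivity (s * w * cos al * cos w); [ring|rewrite es2; ring].
  have -> : 2 * (cos w * sin al) = 2 * cos w * sin al by ring.
  have cw : 0 < cos w by apply: cos_gt0_pihalf; have := omega_le3; lra.
  by rewrite ler_pM2l // mulr_gt0.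
by move: s s0 n2 n3 n4 {es} => s s0 n2 n3 n4; clear -m1 n2 n3 n4 m4 s0; lra.
Qed.

Lemma sin_al_le al : 0 < al <= w / 2 -> sin al <= sin (w - al).
Proof.
move=> hal; apply: sin_ge_mid; have := omega_le3; have := @pi_gt0 R; lra.
Qed.

Lemma tan_exists al : 0 < al <= w / 2 -> exists2 t : R, 0 < t &
  sin al = t * cos al /\ cos al ^+ 2 * (1 + t ^+ 2) = 1.
Proof.
move=> hal; have w0 := omega_gt0 R hq; have p0 := @pi_gt0 R; have W := omega_le R hq.
have ca : 0 < cos al by apply: cos_gt0_pihalf; lra.
have sa : 0 < sin al by apply: (sin_gt0_omega hq); lra.
have st : sin al = sin al / cos al * cos al by rewrite divfK // gt_eqF.
exists (sin al / cos al); first by rewrite divr_gt0.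
split => //.
by rewrite mulrDr mulr1 -exprMn [cos al * _]mulrC -st cos2Dsin2.
Qed.

(** The linear bounds are no longer enough, since w cot w has fallen to pi / 4. Instead the kernel
    and its logarithmic derivative are written exactly in terms of t = tan al and cos al. *)
Lemma far_gain4 al : q = 4 -> 0 < al <= w / 2 -> far_gain al.
Proof.
move=> q4 hal k k0 kq.
have w0 := omega_gt0 R hq; have p0 := @pi_gt0 R.
have Q4 : q%:R = 4 :> R by rewrite q4.
have w4 : w = pi / 4 by rewrite /omega Q4.
have [t t0 [st h']] := tan_exists hal.
have sas := sin_al_le hal.
have ca : 0 < cos al by apply: cos_gt0_pihalf; lra.
have cw : 0 < cos w by apply: cos_gt0_pihalf; lra.
have swa : 0 < sin (w - al) by apply: (sin_gt0_omega hq); lra.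
have swa2 : 0 < sin (w + al) by apply: sin_gt0_pi; lra.
have Ual : 0 < U q (- al) by apply: (U_gt0 hq); lra.
have v0 : 0 <= V (- al) by apply: V_neg_ge0; lra.
have m1 : LU (- al + k%:R * w / q%:R) <= ln q%:R by apply: LU_step_le => //; rewrite k0 ltnW.
have sw : sin w = cos w.
  have := tan_piquarter R; rewrite -w4 /tan => h.
  by rewrite -[RHS]mul1r -h divfK // gt_eqF.
have cw2 : cos w ^+ 2 = 1 / 2 by have := cos2Dsin2 w; rewrite sw => h; clear -h; lra.
have e3 : sin (w + al) = cos w * cos al * (1 + t) by rewrite sinD sw st; ring.
have e4 : sin (w - al) = cos w * cos al * (1 - t) by rewrite sinB sw st; ring.
have e2 : 2 * cos al ^+ 2 - 1 = (1 - t ^+ 2) * cos al ^+ 2 by rewrite -[X in _ - X]h'; ring.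
have e6 : 6 * cos al ^+ 2 - 1 = (5 - t ^+ 2) * cos al ^+ 2 by rewrite -[X in _ - X]h'; ring.
have t1 : t ^+ 2 + 2 * t <= 1.
  move: sas; rewrite e4 st => h.
  have {}h : t <= cos w * (1 - t).
    by rewrite -(ler_pM2r ca); apply: le_trans h _; rewrite mulrAC.
  have h1 : 0 < 1 - t by rewrite -(pmulr_rgt0 _ cw); apply: lt_le_trans h.
  have : t ^+ 2 <= (cos w * (1 - t)) ^+ 2.
    by rewrite ler_sqr ?nnegrE // ?(ltW t0) // mulr_ge0 // ltW.
  by rewrite exprMn cw2 => h2; clear -h2; nra.
have t2 : 0 < 1 - t ^+ 2 by clear -t0 t1; nra.
have n2 : 1 - t != 0 by apply: lt0r_neq0; clear -t0 t1; nra.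
have C0 : cos al ^+ 2 != 0 by rewrite expf_neq0 // gt_eqF.
have UalE : U q (- al) = 4 * cos al * ((1 - t ^+ 2) * cos al ^+ 2) by rewrite UN q4 U4E e2.
have v1 : V (- al) = t * (5 - t ^+ 2) / (1 - t ^+ 2).
  rewrite VN /dlogU q4 U4E dU4E st e6 e2; move: (cos al ^+ 2) C0 => C C0.
  by field; rewrite C0 !gt_eqF.
have v2 : V (- al) <= 5 * t / (1 - t ^+ 2).
  by rewrite v1 ler_pM2r ?invr_gt0 //; clear -t0; nra.
have m2 : V (- al) / (q%:R - 1) * (k%:R * w / q%:R) <= 19 / 144 * (5 * t / (1 - t ^+ 2)).
  have kle : k%:R <= 2 :> R by move: kq; rewrite q4 !ltnS -(ler_nat R).
  have -> : V (- al) / (q%:R - 1) * (k%:R * w / q%:R) = (k%:R * pi / 48) * V (- al) by rewrite Q4 w4; field.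
  apply: ler_pM => //; first by rewrite divr_ge0 // mulr_ge0 // ltW.
  by have pl := @pi_lt R; have : 0 <= k%:R :> R by []; clear -kle pl p0; nra.
have c1 : 0 < cos al <= 1 by rewrite ca cos_le1.
have L := ln_tan4 t0 c1 h'; have F := tan_ineq4 t0 t1.
have L2 : ln ((1 + t) ^+ 2 * cos al ^+ 3) = ln (sin (w + al)) - ln (sin (w - al)) + LU (- al) - ln q%:R.
  rewrite /logU -ln_div ?posrE // -lnM ?posrE ?divr_gt0 // -ln_div ?posrE //; last 2 first.
  - by rewrite mulr_gt0 // divr_gt0.
  - by rewrite Q4.
  congr ln; rewrite UalE e3 e4 Q4 -mulf_div divff ?mulf_neq0 ?gt_eqF //.
  by field.
by clear -m1 m2 L F L2; lra.
Qed.

End Far.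

(** * Non-neighbouring preimages for q = 3 *)

Section Far3.
Variable R : realType.
Implicit Types (al x y d t : R).
Notation w := (omega R 3).
Notation LU := (@logU R 3).
Notation V := (@dlogU R 3).

Lemma U3E (x : R) : U 3 x = 4 * cos x ^+ 2 - 1.
Proof.
rewrite /= !mul0r add0r cos0 !mul1r.
have -> : 2%:R * x = x + x by ring.
rewrite !cosD; transitivity (3 * cos x ^+ 2 - sin x ^+ 2); first by ring.
by rewrite sin2cos2; ring.
Qed.

Lemma dU3E (x : R) : dU 3 x = - (8 * sin x * cos x).
Proof.
rewrite /= !mul0r add0r cos0 !mul1r.
have -> : 2%:R * x = x + x by ring.
by rewrite !sinD; ring.
Qed.

(* With v = tan al / tan w, the first bound on LU is used for v <= 3/10 and the second for v >= 3/10. *)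
Lemma far3_ineq1 (v : R) : 0 < v -> v <= 3 / 10 ->
  163 / 200 * v / (1 - v ^+ 2) < ln ((1 + v) ^+ 2 / (1 + 3 * v ^+ 2)).
Proof.
move=> v0 v1.
have d0 : 0 < 1 + 3 * v ^+ 2 by nra.
have d1 : 0 < 1 - v ^+ 2 by nra.
have r1 : 1 <= (1 + v) ^+ 2 / (1 + 3 * v ^+ 2) by rewrite ler_pdivlMr //; nra.
apply: lt_le_trans (ln_ratio_ge r1).
have -> : 2 * ((1 + v) ^+ 2 / (1 + 3 * v ^+ 2) - 1) / ((1 + v) ^+ 2 / (1 + 3 * v ^+ 2) + 1) =
  v * (2 * (1 - v) / (1 + v + 2 * v ^+ 2)).
  have n1 : 1 + 3 * v ^+ 2 != 0 by rewrite gt_eqF.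
  have n2 : 1 + v + 2 * v ^+ 2 != 0 by apply: lt0r_neq0; nra.
  have -> : (1 + v) ^+ 2 / (1 + 3 * v ^+ 2) - 1 = 2 * v * (1 - v) / (1 + 3 * v ^+ 2) by field.
  have -> : (1 + v) ^+ 2 / (1 + 3 * v ^+ 2) + 1 = 2 * (1 + v + 2 * v ^+ 2) / (1 + 3 * v ^+ 2) by field.
  by field; rewrite n1 n2.
have -> : 163 / 200 * v / (1 - v ^+ 2) = v * (163 / 200 / (1 - v ^+ 2)) by field; rewrite gt_eqF.
rewrite ltr_pM2l // ltr_pdivrMr // mulrAC ltr_pdivlMr; last by nra.
have v2 : v ^+ 2 <= 9 / 100 by nra.
have h1 : 2 * (7 / 10) * (91 / 100) <= 2 * (1 - v) * (1 - v ^+ 2).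
  by apply: ler_pM => //; lra.
have h2 : 163 / 200 * (1 + v + 2 * v ^+ 2) <= 163 / 200 * (148 / 100) by rewrite ler_pM2l //; lra.
lra.
Qed.

Lemma far3_ineq2 (v D : R) : 3 / 10 <= v -> v <= 1 / 3 ->
  0 < D -> D <= 251 / 100 + 457 / 100 * v - 3 / 2 * v ^+ 2 ->
  163 / 200 * v / (1 - v ^+ 2) < ln (3 * (1 + v) ^+ 2 / D).
Proof.
move=> v0 v1 D0 D1.
have d1 : 0 < 1 - v ^+ 2 by nra.
have r1 : 1 <= 3 * (1 + v) ^+ 2 / D by rewrite ler_pdivlMr //; nra.
apply: lt_le_trans (ln_ratio_ge r1).
have n1 : D != 0 by rewrite gt_eqF.
have np : 0 < 3 * (1 + v) ^+ 2 + D by nra.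
have -> : 2 * (3 * (1 + v) ^+ 2 / D - 1) / (3 * (1 + v) ^+ 2 / D + 1) =
  2 * (3 * (1 + v) ^+ 2 - D) / (3 * (1 + v) ^+ 2 + D).
  have n2 : 3 * (1 + v) ^+ 2 + D != 0 by rewrite gt_eqF.
  have -> : 3 * (1 + v) ^+ 2 / D - 1 = (3 * (1 + v) ^+ 2 - D) / D by field.
  have -> : 3 * (1 + v) ^+ 2 / D + 1 = (3 * (1 + v) ^+ 2 + D) / D by field.
  by field; rewrite n1 n2.
rewrite ltr_pdivrMr // [X in _ < X]mulrAC ltr_pdivlMr //.
set N := 3 * (1 + v) ^+ 2 in np r1 *.
have k1 : 0 < 2 * (1 - v ^+ 2) + 163 / 200 * v by nra.
have k2 : D * (2 * (1 - v ^+ 2) + 163 / 200 * v) <= (251 / 100 + 457 / 100 * v - 3 / 2 * v ^+ 2) * (2 * (1 - v ^+ 2) + 163 / 200 * v).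
  by rewrite ler_pM2r.
have w2 : v ^+ 2 <= 1 / 9 by nra.
have w3 : v ^+ 3 <= 1 / 27 by rewrite exprS; have := sqr_ge0 v; clear -w2 v0 v1; nra.
have w4 : v ^+ 4 <= 1 / 81.
  have -> : v ^+ 4 = (v ^+ 2) ^+ 2 by ring.
  apply: (@le_trans _ _ ((1 / 9) ^+ 2)); last by lra.
  by rewrite ler_sqr ?nnegrE ?sqr_ge0 //; lra.
by rewrite /N; clear -k2 w2 w3 w4 v1; lra.
Qed.

(** For q = 3 the step w / 3 is pi / 9, whose sine and cosine have no convenient form; the slightly
    larger angle phi = arctan (3/8) has a rational tangent. The comparison is read off the sign of
    sin (3 phi - pi / 3). *)
Lemma pi9_le_atan : exists2 phi : R, pi / 9 <= phi & phi < pi / 2 /\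
  [/\ 0 < cos phi, sin phi = 3 / 8 * cos phi & cos phi ^+ 2 = 64 / 73].
Proof.
pose phi := atan (3 / 8 : R).
have p0 := @pi_gt0 R.
have hp : phi < pi / 2 by exact: atan_ltpi2.
have h0 : 0 < phi by rewrite -(@atan0 R); apply: lt_atan; lra.
have c0 : 0 < cos phi by apply: cos_gt0_pihalf; lra.
have st : sin phi = 3 / 8 * cos phi.
  by have := atanK (3 / 8 : R); rewrite -/phi /tan => <-; rewrite divfK // gt_eqF.
have c2 : cos phi ^+ 2 = 64 / 73.
  by have := cos2Dsin2 phi; rewrite st exprMn => h; clear -h; lra.
exists phi => //.
rewrite leNgt; apply/negP => hlt.
have s3 : sin (phi + phi + phi - pi / 3) < 0.
  rewrite -oppr_gt0 -sinN; apply: sin_gt0_pi; clear -hlt h0 p0; lra.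
have W : omega R 3 = pi / 3 by [].
have a1 := @cos_pi3 R; have a2 := @sin_pi3_sqr R.
rewrite W in a1 a2.
have a3 : 0 < sin (pi / 3 : R) by apply: sin_gt0_pi; clear -p0; lra.
move: s3; rewrite sinB a1 !(sinD, cosD) st.
move: (sin (pi / 3)) a2 a3 => z a2 a3.
have z1 : z < 9 / 10 by nra.
have C : cos phi ^+ 3 = cos phi * (64 / 73) by rewrite -c2; ring.
rewrite ltNge => /negP; apply.
set X := (X in 0 <= X).
have -> : X = cos phi ^+ 3 * (549 / 512 / 2 - z * (37 / 64)) by rewrite /X; field.
by apply: mulr_ge0; [exact: exprn_ge0 (ltW c0)|clear -z1 a3; lra].
Qed.

Lemma ln_mulV (a b c x : R) : 0 < a -> 0 < b -> 0 < c -> x = a * b / c -> ln x = ln a + ln b - ln c.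
Proof. by move=> a0 b0 c0 ->; rewrite ln_div ?lnM ?posrE ?mulr_gt0. Qed.

Lemma far_gain3 al : 0 < al <= w / 2 -> far_gain 3 al.
Proof.
move=> hal k k0 k1.
have -> : k = 1%N by case: k k0 k1 => [|[|k]].
have hq : (2 <= 3)%N by []. have hq3 : (3 <= 3)%N by [].
have w0 := omega_gt0 R hq; have p0 := @pi_gt0 R.
have W : w = pi / 3 by [].
have [t t0 [st h']] := tan_exists hq hal.
have sas := sin_al_le hq hq3 hal.
have ca : 0 < cos al by apply: cos_gt0_pihalf; lra.
have sw : 0 < sin w by apply: sin_gt0_pi; lra.
have swa : 0 < sin (w - al) by apply: (sin_gt0_omega hq); lra.
have swa2 : 0 < sin (w + al) by apply: sin_gt0_pi; lra.
have cw := @cos_pi3 R; have sw2 := @sin_pi3_sqr R.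
(* As cos w = 1/2, the number 2 sin w is tan w, so v = tan al / tan w; the bound al <= w / 2 becomes
   v <= 1/3. *)
have [v v0 tv] : exists2 v : R, 0 < v & t = 2 * sin w * v.
  by exists (t / (2 * sin w)); [rewrite divr_gt0 // mulr_gt0|field; rewrite gt_eqF].
have t2 : t ^+ 2 = 3 * v ^+ 2 by rewrite tv !exprMn sw2; field.
have e3 : sin (w + al) = sin w * cos al * (1 + v) by rewrite sinD st cw tv; field.
have e4 : sin (w - al) = sin w * cos al * (1 - v) by rewrite sinB st cw tv; field.
have v13 : v <= 1 / 3.
  move: sas; rewrite e4 st tv => h.
  have K : 0 < sin w * cos al by exact: mulr_gt0.
  have : sin w * cos al * (2 * v) <= sin w * cos al * (1 - v).
    by apply: le_trans h; rewrite le_eqVlt; apply/orP; left; apply/eqP; ring.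
  by rewrite ler_pM2l // => h1; clear -h1; lra.
have d1 : 0 < 1 - v ^+ 2 by clear -v0 v13; nra.
have d2 : 0 < 1 + 3 * v ^+ 2 by clear -v0; nra.
have C2 : cos al ^+ 2 = (1 + 3 * v ^+ 2)^-1.
  by apply: (mulIf (lt0r_neq0 d2)); rewrite -{1}t2 h' mulVf ?gt_eqF.
have Ual : U 3 (- al) = 3 * (1 - v ^+ 2) / (1 + 3 * v ^+ 2).
  by rewrite UN U3E C2; field; rewrite gt_eqF.
have Val : V (- al) / (3%:R - 1) * (1%:R * w / 3%:R) <= 163 / 200 * v / (1 - v ^+ 2).
  have -> : V (- al) = 8 * t / (3 * (1 - v ^+ 2)).
    rewrite VN /dlogU dU3E -UN Ual st.
    have -> : 8 * (t * cos al) * cos al = 8 * t * (cos al ^+ 2) by ring.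
    by rewrite C2; field; rewrite !gt_eqF.
  have -> : 8 * t / (3 * (1 - v ^+ 2)) / (3%:R - 1) * (1%:R * w / 3%:R) =
     (8 * sin w * pi / 27) * (v / (1 - v ^+ 2)).
    by rewrite tv W; field; rewrite gt_eqF.
  have -> : 163 / 200 * v / (1 - v ^+ 2) = 163 / 200 * (v / (1 - v ^+ 2)) by rewrite mulrA.
  have vd : 0 <= v / (1 - v ^+ 2) by rewrite divr_ge0 // ltW.
  apply: ler_wpM2r => //.
  have s1 : sin w <= 13 / 15 by clear -sw2 sw; nra.
  have pl := @pi_lt R.
  have : sin w * pi <= 13 / 15 * (19 / 6) by apply: ler_pM => //; exact: ltW.
  by move=> h; clear -h; lra.
have L : ln (sin (w + al)) - ln (sin (w - al)) = ln ((1 + v) / (1 - v)).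
  rewrite -ln_div ?posrE // e3 e4 -mulf_div divff ?mul1r //.
  by rewrite mulf_neq0 ?gt_eqF.
have v1 : 0 < 1 - v by clear -v13; lra.
have p1 : 0 < 1 + v by clear -v0; lra.
have Up : 0 < U 3 (- al) by apply: (U_gt0 hq); lra.
rewrite L; case: (leP v (3 / 10)) => v3.
  have F := far3_ineq1 v0 v3.
  have m1 : LU (- al + 1%:R * w / 3%:R) <= ln 3 by apply: LU_step_le.
  have E : ln ((1 + v) ^+ 2 / (1 + 3 * v ^+ 2)) = ln ((1 + v) / (1 - v)) + LU (- al) - ln 3.
    rewrite /logU; apply: ln_mulV; [by rewrite divr_gt0|by []|lra|rewrite Ual].
    have -> : 1 - v ^+ 2 = (1 - v) * (1 + v) by ring.
    by field; rewrite !gt_eqF.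
  by clear -F m1 E Val; lra.
have [phi phi9 [phi2 [c0 sphi c2]]] := pi9_le_atan.
have al_phi : phi <= al.
  rewrite leNgt; apply/negP => hlt.
  have : 0 < sin (phi - al) by apply: sin_gt0_pi; clear -hlt phi2 hal W p0 phi9; lra.
  rewrite sinB st sphi tv.
  have -> : 3 / 8 * cos phi * cos al - cos phi * (2 * sin w * v * cos al) =
     (cos phi * cos al) * (3 / 8 - 2 * sin w * v) by ring.
  rewrite pmulr_rgt0 ?mulr_gt0 // => h1.
  have s1 : 8 / 10 < sin w by clear -sw2 sw; nra.
  have : 8 / 10 * (3 / 10) <= sin w * v by apply: ler_pM => //; clear -s1 v3; lra.
  by move=> h; clear -h1 h; lra.
(* [LU] increases to the left of 0, and phi <= al keeps the enlarged argument there. *)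
have m1 : LU (- al + 1%:R * w / 3%:R) <= LU (- al + phi).
  have e9 : 1%:R * w / 3%:R = pi / 9 by rewrite W; field.
  rewrite e9.
  have hh : V (- al + phi) * ((- al + phi) - (- al + pi / 9)) <= LU (- al + phi) - LU (- al + pi / 9).
    by have /andP[] : V (- al + phi) * ((- al + phi) - (- al + pi / 9)) <= LU (- al + phi) - LU (- al + pi / 9)
      <= V (- al + pi / 9) * ((- al + phi) - (- al + pi / 9))
      by apply: LU_bounds => //; clear -hal al_phi phi9 phi2 W w0 p0; lra.
  have : 0 <= V (- al + phi).
    have -> : - al + phi = - (al - phi) by ring.
    by apply: V_neg_ge0 => //; clear -hal al_phi phi9 phi2 W w0 p0; lra.
  move=> h; have : 0 <= V (- al + phi) * (- al + phi - (- al + pi / 9)).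
    by rewrite mulr_ge0 //; clear -phi9; lra.
  by clear -hh; lra.
pose D := 256 / 73 * (1 + 3 / 4 * sin w * v) ^+ 2 - 1 - 3 * v ^+ 2.
have Uphi : U 3 (- al + phi) = D / (1 + 3 * v ^+ 2).
  rewrite U3E.
  have -> : cos (- al + phi) = cos phi * cos al * (1 + 3 / 8 * t).
    by rewrite addrC cosB sphi st; ring.
  rewrite !exprMn c2 C2 tv /D; field; by rewrite gt_eqF.
have Up2 : 0 < U 3 (- al + phi) by apply: (U_gt0 hq); clear -hal al_phi phi9 phi2 W w0 p0; lra.
have D0 : 0 < D by move: Up2; rewrite Uphi pmulr_lgt0 // invr_gt0.
have D1 : D <= 251 / 100 + 457 / 100 * v - 3 / 2 * v ^+ 2.
  rewrite /D; have s1 : sin w <= 13 / 15 by clear -sw2 sw; nra.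
  have -> : 256 / 73 * (1 + 3 / 4 * sin w * v) ^+ 2 - 1 - 3 * v ^+ 2 =
     256 / 73 * (1 + 3 / 2 * sin w * v + 9 / 16 * sin w ^+ 2 * v ^+ 2) - 1 - 3 * v ^+ 2 by field.
  rewrite sw2; have : sin w * v <= 13 / 15 * v by rewrite ler_pM2r.
  by have := sqr_ge0 v; clear -v0; lra.
have F := far3_ineq2 (ltW v3) v13 D0 D1.
have E : ln (3 * (1 + v) ^+ 2 / D) = ln ((1 + v) / (1 - v)) + LU (- al) - LU (- al + phi).
  rewrite /logU; apply: ln_mulV; [by rewrite divr_gt0|by []|by []|rewrite Ual Uphi].
  have -> : 1 - v ^+ 2 = (1 - v) * (1 + v) by ring.
  by field; rewrite !gt_eqF.
by clear -F m1 E Val; lra.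
Qed.

End Far3.

(** * The case q = 2 *)

Section NearTwo.
Variable R : realType.
Implicit Types (al ka be : R) (P : R -> R).
Notation w := (omega R 2).
Notation LU := (@logU R 2).
Notation V := (@dlogU R 2).

Lemma cos_wB (x : R) : cos (w - x) = sin x.
Proof. by rewrite /omega -[2%:R]/(2 : R) cosB cos_pihalf sin_pihalf mul0r mul1r add0r. Qed.

Lemma sin_wB (x : R) : sin (w - x) = cos x.
Proof. by rewrite /omega -[2%:R]/(2 : R) sinB cos_pihalf sin_pihalf mul0r mul1r subr0. Qed.

Lemma setup2 al ka be P : sturmian_eq 2 al ka be P ->
  [/\ (2 <= 2)%N, 0 < al < w, w = pi / 2, 0 < pi :> R & sin (w / 2) = cos (w / 2)].
Proof.
move=> [h _ _ _]; split => //; first exact: pi_gt0.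
by rewrite -cos_wB; congr cos; field.
Qed.

Lemma U2E (x : R) : U 2 x = 2 * cos x.
Proof. by rewrite /= !mul0r add0r cos0 !mul1r mulr2n mulrDl mul1r. Qed.

Lemma V2E (x : R) : cos x != 0 -> V x = - (sin x / cos x).
Proof.
move=> c0; rewrite /dlogU U2E.
have -> : dU 2 x = - (2 * sin x) by rewrite /= !mul0r cos0 !mul1r; ring.
by field.
Qed.

(** An a priori bound on the asymmetry of the arc. By [P_ends] the increment of [P] across the arc
    is - ln (tan al); by [incr_le] it is bounded through an increment of [LU] over half the arc. For
    tan al < 5/9 these contradict each other. *)
Lemma tan_al_ge al ka be P : sturmian_eq 2 al ka be P -> al <= w / 2 ->
  exists2 s : R, 5 / 9 <= s <= 1 & sin al = s * cos al.
Proof.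
move=> H alw; have [hq hal W p0 s4] := setup2 H.
have ca : 0 < cos al by apply: cos_gt0_pihalf; clear -hal W p0; lra.
have sa : 0 < sin al := sin_al_gt0 hq H.
have c4 : 0 < cos (w / 2) by rewrite -s4; apply: (sin_gt0_omega hq); clear -hal; lra.
have [s s0 st] : exists2 s : R, 0 < s & sin al = s * cos al.
  by exists (sin al / cos al); [rewrite divr_gt0|rewrite divfK // gt_eqF].
exists s => //; apply/andP; split; last first.
  have : 0 <= sin (w / 2 - al) by apply: sin_ge0_pi; clear -alw hal W p0; lra.
  rewrite sinB s4 st.
  have -> : cos (w / 2) * cos al - cos (w / 2) * (s * cos al) = cos (w / 2) * cos al * (1 - s) by ring.
  by rewrite pmulr_rge0 ?mulr_gt0 // subr_ge0.
rewrite leNgt; apply/negP => s59.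
have I : P (- al + 2%:R * (w / 2)) - P (- al) <=
    LU (- al + w / 2) - LU (- al) + V (- al) / (2%:R - 1) * (w / 2).
  by apply: (incr_le hq H); clear -hal; lra.
have e : - al + 2%:R * (w / 2) = w - al by field.
have cwa : sin (w - al) = cos al by rewrite sin_wB.
rewrite e (P_ends hq H) cwa in I.
have Vn : V (- al) = s.
  by rewrite V2E cosN ?gt_eqF // sinN st; field; rewrite gt_eqF.
have L1 : LU (- al) = ln (2 * cos al) by rewrite /logU U2E cosN.
have L2 : LU (- al + w / 2) = ln (2 * (cos (w / 2) * cos al * (1 + s))).
  by rewrite /logU U2E cosD cosN sinN s4 st; congr (ln (2 * _)); ring.
have s1 : 0 < 1 + s by clear -s0; lra.
have c42 : cos (w / 2) ^+ 2 = 1 / 2.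
  by have := cos2Dsin2 (w / 2); rewrite s4 => h; clear -h; lra.
have K : ln (cos al) - ln (sin al) + LU (- al) - LU (- al + w / 2) = ln (1 / (s * (cos (w / 2) * (1 + s)))).
  rewrite L1 L2 st ln_div ?posrE ?mulr_gt0 // ln1 !lnM ?posrE ?mulr_gt0 //; ring.
(* Doubling squares cos (pi / 4), so that no square root is left. *)
have K2 : 2 * ln (1 / (s * (cos (w / 2) * (1 + s)))) = ln (2 / (s * (1 + s)) ^+ 2).
  rewrite mulr_natl -lnXn ?divr_gt0 ?mulr_gt0 //; congr ln.
  rewrite expr_div_n expr1n !exprMn c42; field; by rewrite !gt_eqF.
have m1 : s * (1 + s) <= 70 / 81 by clear -s0 s59; nra.
have m2 : 0 < s * (1 + s) by rewrite mulr_gt0.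
have m3 : (s * (1 + s)) ^+ 2 <= 3 / 4 by clear -m1 m2; nra.
have m4 : 8 / 3 <= 2 / (s * (1 + s)) ^+ 2.
  by rewrite ler_pdivlMr ?exprn_gt0 //; clear -m3; lra.
have m5 : 10 / 11 <= ln (2 / (s * (1 + s)) ^+ 2).
  have m6 : 1 <= 2 / (s * (1 + s)) ^+ 2 by clear -m4; lra.
  apply: le_trans (ln_ratio_ge m6).
  by rewrite ler_pdivlMr; clear -m4; lra.
have pl := @pi_lt R.
have m7 : s * pi <= 5 / 9 * (19 / 6) by apply: ler_pM; rewrite ?ltW.
move: I; rewrite Vn W => I.
have e2 : s / (2%:R - 1) * (pi / 2 / 2) = s * pi / 4 by field.
rewrite e2 in I; rewrite W in K K2 *.
by clear -I K K2 m5 m7; lra.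
Qed.

(** With v = tan c the difference is (1 + v^2) / (1 - v). From al + c <= pi / 4 and tan al >= 5/9
    follows v <= 2/7, where this expression equals 53/35. *)
Lemma half_gap c al ka be P : sturmian_eq 2 al ka be P -> al <= w / 2 ->
  - al <= c -> c + w / 2 <= w - al -> V c - V (c + w / 2) <= 53 / 35.
Proof.
move=> H alw; have [hq hal W p0 s4] := setup2 H.
move=> h1 h2; have [s hs st] := tan_al_ge H alw.
have ca : 0 < cos al by apply: cos_gt0_pihalf; clear -hal W p0; lra.
have cc : 0 < cos c by apply: cos_gt0_pihalf; clear -hal h1 h2 W p0; lra.
have cc2 : 0 < cos (c + w / 2) by apply: cos_gt0_pihalf; clear -hal h1 h2 W p0; lra.
have c4 : 0 < cos (w / 2) by rewrite -s4; apply: (sin_gt0_omega hq); clear -hal; lra.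
have [v vc] : exists v : R, sin c = v * cos c by exists (sin c / cos c); rewrite divfK // gt_eqF.
have v1 : -1 <= v.
  have : 0 <= sin (c + w / 2) by apply: sin_ge0_pi; clear -alw hal h1 h2 W p0; lra.
  rewrite sinD s4 vc.
  have -> : v * cos c * cos (w / 2) + cos c * cos (w / 2) = cos (w / 2) * cos c * (1 + v) by ring.
  by rewrite pmulr_rge0 ?mulr_gt0 //; clear; lra.
have v2 : v <= 2 / 7.
  have : 0 <= sin (w / 2 - (al + c)) by apply: sin_ge0_pi; clear -alw hal h1 h2 W p0; lra.
  rewrite sinB s4 sinD cosD st vc.
  have -> : cos (w / 2) * (cos al * cos c - s * cos al * (v * cos c)) -
    cos (w / 2) * (s * cos al * cos c + cos al * (v * cos c)) = (cos (w / 2) * (cos al * cos c)) * (1 - s * v - s - v) by ring.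
  by rewrite pmulr_rge0 ?mulr_gt0 // => h; clear -h hs; nra.
rewrite !V2E ?gt_eqF // vc sinD cosD s4 vc.
have d1 : 0 < 1 - v by clear -v2; lra.
have -> : - (v * cos c / cos c) - - ((v * cos c * cos (w / 2) + cos c * cos (w / 2)) /
   (cos c * cos (w / 2) - v * cos c * cos (w / 2))) = (1 + v ^+ 2) / (1 - v).
  have -> : cos c * cos (w / 2) - v * cos c * cos (w / 2) = cos c * cos (w / 2) * (1 - v) by ring.
  by field; rewrite !gt_eqF.
by rewrite ler_pdivrMr //; clear -v1 v2; nra.
Qed.

Lemma slopes_two al ka be P : sturmian_eq 2 al ka be P -> al <= w / 2 ->
  V (- al) / (2%:R - 1) - V (w - al) / (2%:R - 1) <= 106 / 45.
Proof.
move=> H alw; have [hq hal W p0 s4] := setup2 H.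
have [s hs st] := tan_al_ge H alw.
have ca : 0 < cos al by apply: cos_gt0_pihalf; clear -hal W p0; lra.
have s0 : 0 < s by clear -hs; lra.
have e1 : cos (w - al) = sin al by rewrite cos_wB.
have e2 : sin (w - al) = cos al by rewrite sin_wB.
rewrite !V2E ?e1 ?cosN ?gt_eqF ?(sin_al_gt0 hq H) // e2 sinN st.
have -> : - (- (s * cos al) / cos al) / (2%:R - 1) - - (cos al / (s * cos al)) / (2%:R - 1) = s + s^-1.
  by field; rewrite !gt_eqF.
have -> : s + s^-1 = (s ^+ 2 + 1) / s by field; rewrite gt_eqF.
by rewrite ler_pdivrMr //; clear -hs; nra.
Qed.

(** The kernel contributes at most 53/35 e and the slopes of [P] at most 106/45 e, together less
    than 39/10 e. When th' lies to the left of th, the contribution of the kernel is even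
    nonpositive by concavity. *)
Lemma half_incr th th' e al ka be P : sturmian_eq 2 al ka be P -> al <= w / 2 ->
  (th' = th + w / 2 \/ th' = th - w / 2) ->
  - al <= th -> - al <= th' -> 0 < e -> th + e <= w - al -> th' + e <= w - al ->
  P (2%:R * th - ka + 2%:R * e) - P (2%:R * th - ka) -
  (P (2%:R * th' - ka + 2%:R * e) - P (2%:R * th' - ka)) <= 39 / 10 * e.
Proof.
move=> H alw; have [hq hal W p0 s4] := setup2 H.
move=> hth h1 h2 e0 h3 h4.
rewrite !(piece_eq hq H) ?(ltW e0) //.
have [_ _ hsl _] := H.
have x1 : th + e - th = e by ring.
have x2 : th' + e - th' = e by ring.
have b1 : P (th + e) - P th <= V (- al) / (2%:R - 1) * e.
  by have := hsl th (th + e); rewrite x1 lerDl ltW // => /(_ isT) /andP[].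
have b2 : V (w - al) / (2%:R - 1) * e <= P (th' + e) - P th'.
  by have := hsl th' (th' + e); rewrite x2 lerDl ltW // => /(_ isT) /andP[].
have BA := slopes_two H alw.
have b3 : (V (- al) / (2%:R - 1) - V (w - al) / (2%:R - 1)) * e <= 106 / 45 * e by rewrite ler_pM2r.
have w0 := omega_gt0 R hq.
suff : LU (th + e) - LU th - (LU (th' + e) - LU th') <= 53 / 35 * e.
  by rewrite mulrBl in b3; clear -b1 b2 b3 e0; lra.
case: hth => eth.
  have lt : th < th + e by rewrite ltrDl.
  have [x hx|c [hc E]] := @mvt_cc R (fun x => LU x - LU (x + w / 2)) (fun x => V x - V (x + w / 2) * (1 + 0)) _ _ lt.
    apply: hderivB; first by apply: hderiv_LU => //; clear -hal hx h1 h2 h3 h4 eth w0; lra.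
    apply: (@hderiv_comp R LU); last by apply: hderivD; [exact: hderiv_id|exact: hderiv_cst].
    by apply: hderiv_LU => //; clear -hal hx h1 h2 h3 h4 eth w0; lra.
  have e1 : th + e + w / 2 = th' + e by rewrite eth; ring.
  rewrite /= e1 -eth addr0 mulr1 in E.
  have -> : LU (th + e) - LU th - (LU (th' + e) - LU th') = LU (th + e) - LU (th' + e) - (LU th - LU th') by ring.
  rewrite E.
  have -> : th + e - th = e by ring.
  rewrite ler_pM2r //; apply: (half_gap H alw); clear -hc h1 h4 eth; lra.
have C : LU (th + e) - LU th <= LU (th' + e) - LU th'.
  by apply: LU_concave => //; clear -hal h1 h2 h3 h4 eth w0 e0; lra.
by clear -C e0; lra.
Qed.

(** The slope range of [P] alone would give 212/45 e, while [near_right2] needs less than 4 e. As pi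
    = 2 w, the points y and y - w are images of two points of the arc at distance w / 2, and pulling
    both back once brings the bound down to 39/10 e. A segment that crosses the end of the arc is
    cut there and continued from - al. *)
Lemma incr_two y e al ka be P : sturmian_eq 2 al ka be P -> al <= w / 2 ->
  0 < e -> e < w / 2 ->
  P (y + 2%:R * e) - P y - (P (y - w + 2%:R * e) - P (y - w)) <= 39 / 10 * e.
Proof.
move=> H alw; have [hq hal W p0 s4] := setup2 H.
move=> e0 ew; have w0 := omega_gt0 R hq.
have [t [m [/andP[t1 t2] ->]]] := arc_repr hq H y.
have e1 : 2%:R * t - ka + m%:~R * pi + 2%:R * e = 2%:R * t - ka + 2%:R * e + m%:~R * pi by ring.
have pe : pi = 2 * w by rewrite W; field.
have per x : P (x + pi) = P x by case: H.
have [t' [ht' [t1' t2'] Et]] : exists t', [/\ (t' = t + w / 2 \/ t' = t - w / 2), - al <= t' /\ t' < w - al &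
   forall d, P (2%:R * t' - ka + d) = P (2%:R * t - ka - w + d)].
  case: (leP (w / 2 - al) t) => h.
    exists (t - w / 2); split; [by right|by clear -h t2 w0; lra|].
    by move=> d; congr (P _); field.
  exists (t + w / 2); split; [by left|by clear -h t1 w0; lra|].
  by move=> d; rewrite -[RHS]per; congr (P _); rewrite pe; field.
have Et0 : P (2%:R * t' - ka) = P (2%:R * t - ka - w) by have := Et 0; rewrite !addr0.
have -> : P (2%:R * t - ka + m%:~R * pi - w + 2%:R * e) = P (2%:R * t' - ka + 2%:R * e).
  by rewrite Et -[RHS](periodZ hq H m); congr P; ring.
have -> : P (2%:R * t - ka + m%:~R * pi - w) = P (2%:R * t' - ka).
  by rewrite Et0 -[RHS](periodZ hq H m); congr P; ring.
rewrite e1 !(periodZ hq H).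
case: (leP (t + e) (w - al)) => h1; case: (leP (t' + e) (w - al)) => h2.
- exact: (half_incr H alw).
- have [e' [e'0 E1 f0]] : exists e', [/\ 0 < e', t' + e' = w - al & 0 < e - e'].
    by exists (w - al - t'); split; [clear -t2'; lra|ring|clear -h2; lra].
  have I1 : P (2%:R * t - ka + 2%:R * e') - P (2%:R * t - ka) -
    (P (2%:R * t' - ka + 2%:R * e') - P (2%:R * t' - ka)) <= 39 / 10 * e'.
    by apply: (half_incr H alw) => //; [clear -h1 f0; lra|rewrite E1].
  have ht3 : t' = t + w / 2 by case: ht' => // E; clear -E h1 h2 w0; lra.
  have I2 : P (2%:R * (t + e') - ka + 2%:R * (e - e')) - P (2%:R * (t + e') - ka) -
    (P (2%:R * (- al) - ka + 2%:R * (e - e')) - P (2%:R * (- al) - ka)) <= 39 / 10 * (e - e').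
    apply: (half_incr H alw) => //; [right|..]; clear -E1 ht3 h1 t1 e'0 ew w0 hal f0; lra.
  have x1 : 2%:R * (t + e') - ka + 2%:R * (e - e') = 2%:R * t - ka + 2%:R * e by ring.
  have x2 : 2%:R * (t + e') - ka = 2%:R * t - ka + 2%:R * e' by ring.
  have x3 : P (2%:R * (- al) - ka + 2%:R * (e - e')) = P (2%:R * t' - ka + 2%:R * e).
    have -> : al = w - t' - e' by clear -E1; lra.
    by rewrite -per pe; congr P; ring.
  have x4 : P (2%:R * (- al) - ka) = P (2%:R * t' - ka + 2%:R * e').
    have -> : al = w - t' - e' by clear -E1; lra.
    by rewrite -per pe; congr P; ring.
  by rewrite x1 x2 x3 x4 in I2; clear -I1 I2; lra.
- have [e' [e'0 E1 f0]] : exists e', [/\ 0 < e', t + e' = w - al & 0 < e - e'].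
    by exists (w - al - t); split; [clear -t2; lra|ring|clear -h1; lra].
  have I1 : P (2%:R * t - ka + 2%:R * e') - P (2%:R * t - ka) -
    (P (2%:R * t' - ka + 2%:R * e') - P (2%:R * t' - ka)) <= 39 / 10 * e'.
    by apply: (half_incr H alw) => //; [rewrite E1|clear -h2 f0; lra].
  have ht3 : t' = t - w / 2 by case: ht' => // E; clear -E h1 h2 w0; lra.
  have I2 : P (2%:R * (- al) - ka + 2%:R * (e - e')) - P (2%:R * (- al) - ka) -
    (P (2%:R * (t' + e') - ka + 2%:R * (e - e')) - P (2%:R * (t' + e') - ka)) <= 39 / 10 * (e - e').
    apply: (half_incr H alw) => //; [left|..]; clear -E1 ht3 h2 t1' e'0 ew w0 hal f0; lra.
  have x1 : 2%:R * (t' + e') - ka + 2%:R * (e - e') = 2%:R * t' - ka + 2%:R * e by ring.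
  have x2 : 2%:R * (t' + e') - ka = 2%:R * t' - ka + 2%:R * e' by ring.
  have x3 : P (2%:R * (- al) - ka + 2%:R * (e - e')) = P (2%:R * t - ka + 2%:R * e).
    have -> : al = w - t - e' by clear -E1; lra.
    by rewrite -per pe; congr P; ring.
  have x4 : P (2%:R * (- al) - ka) = P (2%:R * t - ka + 2%:R * e').
    have -> : al = w - t - e' by clear -E1; lra.
    by rewrite -per pe; congr P; ring.
  by rewrite x1 x2 x3 x4 in I2; clear -I1 I2; lra.
- by exfalso; clear -ht' h1 h2 t1 t1' t2 t2' ew; case: ht' => E; lra.
Qed.

(** Here sin c * sin (w - c) = sin (2 c) / 2 <= 1/2, so the logarithmic sines separate at rate at
    least 2, against 39/20 for [P] by [incr_two]. *)
Lemma near_right2 t al ka be P : sturmian_eq 2 al ka be P -> al <= w / 2 ->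
  0 < t < w - al -> P (t - w) - P t < ln `|sin (t - w)| - ln `|sin t|.
Proof.
move=> H alw; have [hq hal W p0 s4] := setup2 H.
move=> ht; have w0 := omega_gt0 R hq.
have st : 0 < sin t by apply: (sin_gt0_omega hq); clear -ht hal; lra.
have swt : 0 < sin (w - t) by apply: (sin_gt0_omega hq); clear -ht hal; lra.
have -> : `|sin (t - w)| = sin (w - t) by rewrite -opprB sinN normrN gtr0_norm.
rewrite gtr0_norm //.
have [c [hc e]] : exists c, t < c < w - al /\ (ln (sin (w - t)) - ln (sin t)) -
   (ln (sin (w - (w - al))) - ln (sin (w - al))) = (w - al - t) * (sin w / (sin c * sin (w - c))).
  by apply: (ln_sin_ratio_mvt hq H); clear -ht hal; lra.
have ea : w - (w - al) = al by ring.
rewrite ea in e.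
have E := P_ends hq H.
have c1 : 0 < sin c by apply: (sin_gt0_omega hq); clear -hc ht hal; lra.
have c2 : 0 < sin (w - c) by apply: (sin_gt0_omega hq); clear -hc ht hal; lra.
have sw : sin w = 1 by rewrite W sin_pihalf.
have g2 : 2 <= sin w / (sin c * sin (w - c)).
  rewrite sw ler_pdivlMr ?mulr_gt0 //.
  have -> : sin (w - c) = cos c by rewrite sin_wB.
  by have := cos2Dsin2 c; have := sqr_ge0 (sin c - cos c); clear; nra.
have g3 : (w - al - t) * 2 <= (w - al - t) * (sin w / (sin c * sin (w - c))).
  by rewrite ler_pM2l //; clear -ht; lra.
have I : P (t + 2%:R * ((w - al - t) / 2)) - P t -
   (P (t - w + 2%:R * ((w - al - t) / 2)) - P (t - w)) <= 39 / 10 * ((w - al - t) / 2).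
  by apply: (@incr_two t ((w - al - t) / 2) al ka be P H alw); clear -ht hal; lra.
have x1 : t + 2%:R * ((w - al - t) / 2) = w - al by field.
have x2 : t - w + 2%:R * ((w - al - t) / 2) = - al by field.
by rewrite x1 x2 in I; clear -I E e g3 ht; lra.
Qed.
End NearTwo.

(** * Comparison of all preimages *)

Section Assembly.
Variables (R : realType) (q : nat) (hq : (2 <= q)%N).
Implicit Types (al ka be t x y d : R) (P : R -> R) (k : nat).
Notation w := (omega R q).
Notation LU := (@logU R q).
Notation V := (@dlogU R q).

Lemma far_gain_holds al : (3 <= q)%N -> 0 < al <= w / 2 -> far_gain q al.
Proof.
move=> q3 hal; have [q5|] := leqP 5 q; first exact: far_gain5.
rewrite ltnS leq_eqVlt => /predU1P[q4|]; first exact: far_gain4.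
move=> q4; have e3 : q = 3 by apply/eqP; rewrite eqn_leq q3 -ltnS q4.
by move: hal; rewrite e3; exact: far_gain3.
Qed.

Lemma ln_cross (a b c d : R) : 0 < a -> 0 < b -> 0 < c -> 0 < d ->
  a * b <= c * d -> ln a + ln b <= ln c + ln d.
Proof. by move=> a0 b0 c0 d0 h; rewrite -!lnM ?posrE // ler_ln ?posrE ?mulr_gt0. Qed.

(** Write a = sin al and b = sin (w - al). The slope bound and [P_ends] give ln (b / a) <= 1, hence
    b <= 3 a, which bounds (a + b)^2 by 16/3 a b. On the other side a + b >= sin w, and 4 cos^2 (w /
    2) >= 935/324 because w <= pi / 3. *)
Lemma ratio_bound al ka be P : sturmian_eq q al ka be P -> (3 <= q)%N -> al <= w / 2 ->
  sin (w / 2) ^+ 2 < (q%:R - 1) * (sin al * sin (w - al)).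
Proof.
move=> H q3 aw; have [hal _ hsl _] := H.
have w0 := omega_gt0 R hq; have p0 := @pi_gt0 R; have W3 := omega_le3 R hq q3.
have Q3 : 3 <= q%:R :> R by rewrite (ler_nat _ 3).
have a0 := sin_al_gt0 hq H; have b0 := sin_wal_gt0 hq H; have E := P_ends hq H.
have ab : sin al <= sin (w - al) by apply: sin_al_le => //; clear -hal aw; lra.
have S0 : 0 < sin (w / 2) by apply: (sin_gt0_omega hq); clear -w0; lra.
have Vw : V (- (w / 2)) = cos (w / 2) / sin (w / 2).
  rewrite VN V_cot //; [|clear -w0; lra|clear -w0; lra].
  have -> : q%:R * (w / 2) = pi / 2 by rewrite mulrA q_omega.
  by rewrite cos_pihalf mul0r mulr0 sub0r opprK.
have B1 : P (w - al) - P (- al) <= V (- al) / (q%:R - 1) * w.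
  have x1 : w - al - - al = w by ring.
  by have := hsl (- al) (w - al); rewrite x1 => /(_ _) /andP[]//; clear -w0; lra.
have B2 : V (- al) <= V (- (w / 2)) by apply: V_nincr => //; clear -hal aw w0; lra.
have B3 : V (- (w / 2)) * w <= 2.
  have := @xcos_le_sin R (w / 2); have h : 0 <= w / 2 <= pi by clear -w0 W3 p0; lra.
  by move=> /(_ h) h2; rewrite Vw mulrAC ler_pdivrMr //; clear -h2; lra.
have B4 : V (- al) / (q%:R - 1) * w <= 1.
  rewrite mulrAC ler_pdivrMr; last by clear -Q3; lra.
  rewrite mul1r; apply: (@le_trans _ _ 2); last by clear -Q3; lra.
  by apply: le_trans B3; rewrite ler_pM2r.
have C2 : 935 / 324 <= 4 * cos (w / 2) ^+ 2.
  have h : sin (w / 2) <= 19 / 36.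
    by apply: le_trans (sin_le _) _; have := @pi_lt R; clear -w0 W3; lra.
  have : 0 <= (19 / 36 - sin (w / 2)) * (19 / 36 + sin (w / 2)) by apply: mulr_ge0; clear -S0 h; lra.
  by rewrite cos2sin2; clear; lra.
have sw2 : sin w = 2 * sin (w / 2) * cos (w / 2).
  have -> : sin w = sin (w / 2 + w / 2) by congr sin; field.
  by rewrite sinD; ring.
have sw : sin w <= sin al + sin (w - al).
  have -> : sin w = sin al * cos (w - al) + cos al * sin (w - al) by rewrite -sinD; congr sin; ring.
  by apply: lerD; [rewrite ler_piMr|rewrite ler_piMl]; rewrite ?cos_le1 ?ltW.
have sw0 : 0 < sin w by apply: sin_gt0_pi; clear -w0 W3 p0; lra.
move: (sin al) (sin (w - al)) a0 b0 ab E sw => a b a0 b0 ab E sw.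
have r3 : b <= 3 * a.
  have r1 : 1 <= b / a by rewrite ler_pdivlMr // mul1r.
  have := ln_ratio_ge r1; rewrite ln_div ?posrE // -E => h.
  have h2 : 2 * (b / a - 1) / (b / a + 1) <= 1 by clear -h B1 B4; lra.
  move: h2; rewrite ler_pdivrMr; last by clear -r1; lra.
  move=> h2; have : b / a <= 3 by clear -h2; lra.
  by rewrite ler_pdivrMr.
have s1 : sin w ^+ 2 <= (a + b) ^+ 2 by rewrite ler_sqr // nnegrE; [exact: ltW|apply: addr_ge0; exact: ltW].
have s2 : sin (w / 2) ^+ 2 * (935 / 324) <= (a + b) ^+ 2.
  apply: le_trans s1; rewrite sw2.
  have -> : (2 * sin (w / 2) * cos (w / 2)) ^+ 2 = sin (w / 2) ^+ 2 * (4 * cos (w / 2) ^+ 2) by ring.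
  by rewrite ler_pM2l // exprn_gt0.
have ab0 : 0 < a * b by rewrite mulr_gt0.
have s3 : (a + b) ^+ 2 <= 6 * (a * b) - 2 * a ^+ 2.
  by rewrite -subr_ge0; have : 0 <= (b - a) * (3 * a - b) by [rewrite mulr_ge0 // subr_ge0|]; clear; lra.
have s4 : a * b <= 3 * a ^+ 2 by rewrite expr2 mulrCA ler_pM2l.
have s5 : 2 * (a * b) <= (q%:R - 1) * (a * b) by rewrite ler_pM2r //; clear -Q3; lra.
by apply: lt_le_trans s5; clear -s2 s3 s4 ab0; lra.
Qed.

(** The ratio sin (t + k w) / sin t decreases in t, so t = w - al is the worst case; there sin (w -
    al + k w) >= sin (w + al) reduces the claim to [far_gain]. *)
Lemma far_right al ka be P t k : sturmian_eq q al ka be P -> (3 <= q)%N -> al <= w / 2 ->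
  0 < t <= w - al -> (0 < k)%N -> (k.+1 < q)%N ->
  P (t + k%:R * w) - P t < ln (sin (t + k%:R * w)) - ln (sin t).
Proof.
move=> H q3 aw ht k0 kq; have [hal _ _ _] := H.
have w0 := omega_gt0 R hq; have p0 := @pi_gt0 R; have W3 := omega_le3 R hq q3.
have qw := q_omega R hq; have Q := q_gt0 R hq.
have K1 : 1 <= k%:R :> R by rewrite (ler_nat _ 1).
have K2 : k%:R + 2 <= q%:R :> R by rewrite -(natrD _ k 2) ler_nat addn2.
have kw1 : w <= k%:R * w by rewrite ler_peMl // ltW.
have kw2 : k%:R * w <= pi - 2 * w.
  have : (k%:R + 2) * w <= q%:R * w by rewrite ler_pM2r.
  by rewrite qw; clear; lra.
have G := far_gain_holds q3 (_ : 0 < al <= w / 2) k0 kq.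
have {}G := G ltac:(clear -hal aw; lra).
have I : P (t + q%:R * (k%:R * w / q%:R)) - P t <=
   LU (- al + k%:R * w / q%:R) - LU (- al) + V (- al) / (q%:R - 1) * (k%:R * w / q%:R).
  apply: (incr_le hq H); apply/andP; split; first by rewrite divr_ge0 ?ltW //; clear -kw1 w0; lra.
  by rewrite ler_pdivrMr // [w * _]mulrC qw; clear -kw2 w0; lra.
rewrite [q%:R * _]mulrC divfK ?gt_eqF // in I.
have s1 : 0 < sin t by apply: sin_gt0_pi; clear -ht hal W3 p0; lra.
have s2 : 0 < sin (w - al) := sin_wal_gt0 hq H.
have s3 : 0 < sin (w + al) by apply: sin_gt0_pi; clear -ht hal W3 p0 aw; lra.
have s4 : 0 < sin (t + k%:R * w) by apply: sin_gt0_pi; clear -ht kw1 kw2 w0 hal; lra.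
have M : sin (w + al) <= sin (w - al + k%:R * w).
  by apply: sin_ge_mid; clear -hal aw kw1 kw2 W3 w0 p0; lra.
have D : 0 <= sin (k%:R * w) * sin (w - al - t).
  by apply: mulr_ge0; apply: sin_ge0_pi; clear -ht hal kw1 kw2 w0 W3 p0; lra.
have E : sin (t + k%:R * w) * sin (w - al) - sin (w - al + k%:R * w) * sin t = sin (k%:R * w) * sin (w - al - t).
  by move: (w - al) (k%:R * w) => x y; rewrite !sinD sinN cosN; ring.
have F : ln (sin (w + al)) + ln (sin t) <= ln (sin (t + k%:R * w)) + ln (sin (w - al)).
  apply: ln_cross => //; have : sin (w + al) * sin t <= sin (w - al + k%:R * w) * sin t by rewrite ler_pM2r.
  by clear -D E; lra.
by clear -F G I; lra.
Qed.

(** At v = al this is [far_right] at the opposite end of the arc with q - j - 1 steps, transported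
    by periodicity and [P_ends]. Smaller v follow by comparing rates as in [near_left]. *)
Lemma far_left al ka be P v j : sturmian_eq q al ka be P -> (3 <= q)%N -> al <= w / 2 ->
  0 < v <= al -> (0 < j)%N -> (j.+1 < q)%N ->
  P (- v - j%:R * w) - P (- v) < ln (sin (v + j%:R * w)) - ln (sin v).
Proof.
move=> H q3 aw hv j0 jq; have [hal hper hsl _] := H.
have w0 := omega_gt0 R hq; have p0 := @pi_gt0 R; have W3 := omega_le3 R hq q3.
have qw := q_omega R hq; have Q := q_gt0 R hq.
have K1 : 1 <= j%:R :> R by rewrite (ler_nat _ 1).
have K2 : j%:R + 2 <= q%:R :> R by rewrite -(natrD _ j 2) ler_nat addn2.
have Q3 : 3 <= q%:R :> R by rewrite (ler_nat _ 3).
have kw1 : w <= j%:R * w by rewrite ler_peMl // ltW.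
have kw2 : j%:R * w <= pi - 2 * w.
  have : (j%:R + 2) * w <= q%:R * w by rewrite ler_pM2r.
  by rewrite qw; clear; lra.
have a0 := sin_al_gt0 hq H; have b0 := sin_wal_gt0 hq H; have E := P_ends hq H.
have base : P (- al - j%:R * w) - P (- al) < ln (sin (al + j%:R * w)) - ln (sin al).
  have jle : (j.+1 <= q)%N by exact: ltnW.
  have e1 : w - al + (q - j.+1)%:R * w = - al - j%:R * w + pi.
    by rewrite natrB // -natr1 -qw; ring.
  have := @far_right al ka be P (w - al) (q - j.+1) H q3 aw.
  rewrite e1 hper sinDpi -sinN opprD !opprK => /(_ _ _ _) h.
  have : P (- al - j%:R * w) - P (w - al) < ln (sin (al + j%:R * w)) - ln (sin (w - al)).
    apply: h; first by clear -hal; lra.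
      by rewrite subn_gt0.
    by rewrite subnS prednK ?subn_gt0 // ltn_subrL j0 (ltn_trans _ jq).
  by clear -E; lra.
case: (ltrgtP v al) => [va||->//]; last by clear -hv; lra.
have s1 x : 0 < x -> x <= al -> 0 < sin x by move=> x0 x1; apply: (sin_gt0_omega hq); clear -hal x0 x1; lra.
have s2 x : 0 < x -> x <= al -> 0 < sin (x + j%:R * w).
  by move=> x0 x1; apply: sin_gt0_pi; clear -hal x0 x1 kw1 kw2 w0; lra.
have [x hx|c [hc Ec]] := @mvt_cc R (fun x => ln (sin (x + j%:R * w)) - ln (sin x))
    (fun x => cos (x + j%:R * w) * (1 + 0) / sin (x + j%:R * w) - cos x / sin x) _ _ va.
  have /andP[x0 x1] : 0 < x <= al by clear -hx hv; lra.
  apply: hderivB; apply: hderiv_ln; [exact: s2| |exact: s1|exact: hderiv_sin].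
  by apply: hderiv_comp; [exact: hderiv_sin|apply: hderivD; [exact: hderiv_id|exact: hderiv_cst]].
have /andP[c0 c1] : 0 < c <= al by clear -hc hv; lra.
have sc := s1 _ c0 c1; have scj := s2 _ c0 c1.
have d1 : cos (c + j%:R * w) * (1 + 0) / sin (c + j%:R * w) - cos c / sin c =
   - (sin (j%:R * w) / (sin c * sin (c + j%:R * w))).
  have -> : sin (j%:R * w) = sin (c + j%:R * w) * cos c - cos (c + j%:R * w) * sin c.
    by rewrite -sinB; congr sin; ring.
  by field; rewrite !gt_eqF.
rewrite d1 in Ec.
have D := slopes_diff hq H.
have q1 : 0 < q%:R - 1 :> R by clear -Q3; lra.
have sw : 0 < sin w by apply: sin_gt0_pi; clear -w0 W3 p0; lra.
have sj : 0 < sin (j%:R * w) by apply: sin_gt0_pi; clear -w0 kw1 kw2; lra.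
have sab : 0 < sin al * sin (w - al) by rewrite mulr_gt0.
set BA := _ - _ in D.
have key : BA <= sin (j%:R * w) / (sin c * sin (c + j%:R * w)).
  have BAe : BA = sin w / ((q%:R - 1) * (sin al * sin (w - al))).
    by rewrite -[BA](mulfK (lt0r_neq0 q1)) D; field; rewrite !gt_eqF.
  rewrite BAe ler_pdivrMr ?mulr_gt0 // mulrAC ler_pdivlMr ?mulr_gt0 //.
  have m1 : sin w * sin (c + j%:R * w) <= sin (j%:R * w) * sin (c + w).
    rewrite -subr_ge0.
    have -> : sin (j%:R * w) * sin (c + w) - sin w * sin (c + j%:R * w) = sin c * sin (j%:R * w - w).
      by move: (j%:R * w) => y; rewrite !sinD sinN cosN; ring.
    by apply: mulr_ge0; [exact: ltW|apply: sin_ge0_pi; clear -kw1 kw2 w0; lra].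
  have m2 : sin c <= sin al by apply: sin_ge_mid; clear -c0 c1 hal aw W3 p0; lra.
  have m3 : sin (c + w) <= sin (al + w) by apply: sin_ge_mid; clear -c0 c1 hal aw W3 p0 w0; lra.
  have m4 : sin (al + w) <= (q%:R - 1) * sin (w - al).
    have -> : sin (al + w) = sin (w - al) + 2 * cos w * sin al by rewrite sinD sinB; ring.
    have ab : sin al <= sin (w - al) by apply: sin_al_le => //; clear -hal aw; lra.
    have [q4|] := leqP 4 q; last first.
      rewrite ltnS => q3'; have e3 : q = 3 by apply/eqP; rewrite eqn_leq q3 q3'.
      have cw : cos w = 2^-1 by rewrite e3 cos_pi3.
      have qe : q%:R = 3 :> R by rewrite e3.
      by rewrite cw qe; clear -ab; lra.
    have Q4 : 4 <= q%:R :> R by rewrite (ler_nat _ 4).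
    have n1 : cos w * sin al <= sin al by rewrite ler_piMl ?cos_le1 // ltW.
    have n2 : 3 * sin (w - al) <= (q%:R - 1) * sin (w - al) by rewrite ler_pM2r //; clear -Q4; lra.
    by clear -n1 n2 ab; lra.
  have cw0 : 0 < sin (c + w) by apply: sin_gt0_pi; clear -c0 c1 hal aw W3 p0 w0; lra.
  have m5 : sin w * (sin c * sin (c + j%:R * w)) <= sin c * (sin (j%:R * w) * sin (c + w)).
    by rewrite mulrCA ler_pM2l.
  apply: (le_trans m5).
  have -> : sin c * (sin (j%:R * w) * sin (c + w)) = sin (j%:R * w) * (sin c * sin (c + w)) by ring.
  rewrite ler_pM2l //.
  have -> : (q%:R - 1) * (sin al * sin (w - al)) = sin al * ((q%:R - 1) * sin (w - al)) by ring.
  by apply: ler_pM => //; [exact: ltW|exact: ltW|exact: le_trans m3 m4].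
have u1 := hsl (- al - j%:R * w) (- v - j%:R * w).
have u2 := hsl (- al) (- v).
have x1 : - v - j%:R * w - (- al - j%:R * w) = al - v by ring.
have x2 : - v - - al = al - v by ring.
rewrite x1 in u1; rewrite x2 in u2.
have {}u1 : P (- v - j%:R * w) - P (- al - j%:R * w) <= V (- al) / (q%:R - 1) * (al - v).
  by move: u1 => /(_ _) /andP[]//; clear -va; lra.
have {}u2 : V (w - al) / (q%:R - 1) * (al - v) <= P (- v) - P (- al).
  by move: u2 => /(_ _) /andP[]//; clear -va; lra.
have u3 : BA * (al - v) <= sin (j%:R * w) / (sin c * sin (c + j%:R * w)) * (al - v).
  by apply: ler_wpM2r key; clear -va; lra.
rewrite [BA * _]mulrBl in u3; rewrite mulNr in Ec.
by clear -u1 u2 u3 Ec base; lra.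
Qed.

(** The third alternative says that, among two preimages of the same point, the one in the arc has
    the larger value of ln |U| + P. The first two are the ties between the ends of the arc.
    Neighbours are k = 1 for t < 0 and k = q - 1 for t > 0; all other k are far. *)
Lemma core_half al ka be P t k : sturmian_eq q al ka be P -> al <= w / 2 ->
  - al <= t <= w - al -> (0 < k < q)%N -> sin (q%:R * t) != 0 ->
  [\/ t = - al /\ k = 1%N, t = w - al /\ k = q.-1 |
   P (t + k%:R * w) - P t < ln `|sin (t + k%:R * w)| - ln `|sin t|].
Proof.
move=> H aw ht /andP[k0 kq] snz; have [hal hper _ _] := H.
have w0 := omega_gt0 R hq; have p0 := @pi_gt0 R; have qw := q_omega R hq.
have K1 : 1 <= k%:R :> R by rewrite (ler_nat _ 1).
have t0 : t != 0 by apply: contra_neq snz => ->; rewrite mulr0 sin0.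
have qle : (1 <= q)%N by exact: ltnW.
have shift x : x + (q.-1)%:R * w = x - w + pi.
  have -> : pi = (q.-1%:R + 1) * w by rewrite natr1 prednK.
  by ring.
case: (ltgtP t 0) t0 => // tsgn _.
  have [->|k1] := eqVneq k 1%N.
    have [->|tal] := eqVneq t (- al); first by constructor 1.
    constructor 3; rewrite mul1r; apply: (near_left hq H) => //.
    by rewrite lt_neqAle eq_sym tal; clear -ht tsgn; lra.
  constructor 3; have k2 : (1 < k)%N by rewrite ltn_neqAle eq_sym k1.
  have q3 : (3 <= q)%N by exact: leq_ltn_trans k2 kq.
  have W3 := omega_le3 R hq q3.
  have j0 : (0 < q - k)%N by rewrite subn_gt0.
  have jq : ((q - k).+1 < q)%N.
    by rewrite -subSn ?(ltnW kq) // ltn_subLR ?(leq_trans (ltnW kq)) // addnC -addn1 ltn_add2l.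
  have e1 : t + k%:R * w = - - t - (q - k)%:R * w + pi.
    by rewrite natrB ?(ltnW kq) // -qw; ring.
  have F := @far_left al ka be P (- t) (q - k) H q3 aw ltac:(clear -ht tsgn; lra) j0 jq.
  have e2 : - - t - (q - k)%:R * w = - (- t + (q - k)%:R * w) by ring.
  have J1 : 0 < (q - k)%:R * w by rewrite mulr_gt0 ?ltr0n.
  have J2 : (q - k)%:R * w <= pi - 2 * w.
    have : ((q - k)%:R + 2) * w <= q%:R * w.
      by rewrite ler_pM2r // -(natrD _ _ 2) ler_nat addn2.
    by rewrite qw; clear; lra.
  have s1 : 0 < sin (- t + (q - k)%:R * w) by apply: sin_gt0_pi; clear -ht hal J1 J2 tsgn w0; lra.
  have s2 : 0 < sin (- t) by apply: (sin_gt0_omega hq); clear -ht hal tsgn; lra.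
  rewrite e1 hper sinDpi normrN e2 sinN normrN gtr0_norm // -e2 opprK.
  have -> : `|sin t| = sin (- t) by rewrite -normrN -sinN gtr0_norm.
  by move: F; rewrite opprK.
have [kq1|k1] := eqVneq k q.-1.
  have [->|tal] := eqVneq t (w - al); first by constructor 2.
  constructor 3; rewrite kq1 shift hper sinDpi normrN.
  have ht2 : 0 < t < w - al by rewrite tsgn lt_neqAle tal; case/andP: ht.
  have [q3|] := leqP 3 q.
    by apply: (near_right hq H) => //; apply: ratio_bound H q3 aw.
  rewrite ltnS => q2; have e2 : q = 2 by apply/eqP; rewrite eqn_leq q2 hq.
  by move: H aw ht2; rewrite e2 => H aw; apply: (near_right2 H aw).
have kq2 : (k.+1 < q)%N.
  by rewrite -[X in (_ < X)%N](prednK qle) ltnS ltn_neqAle k1 -ltnS (prednK qle).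
have q3 : (3 <= q)%N by exact: leq_ltn_trans kq2.
have W3 := omega_le3 R hq q3.
constructor 3.
have F := @far_right al ka be P t k H q3 aw ltac:(clear -ht tsgn; lra) k0 kq2.
have K2 : k%:R * w <= pi - 2 * w.
  have : (k%:R + 2) * w <= q%:R * w.
    by rewrite ler_pM2r // -(natrD _ _ 2) ler_nat addn2.
  by rewrite qw; clear; lra.
have kw : 0 < k%:R * w by rewrite mulr_gt0 ?ltr0n.
rewrite !gtr0_norm //; apply: sin_gt0_pi; clear -ht hal tsgn w0 K2 kw W3 p0; lra.
Qed.

Lemma core al ka be P t k : sturmian_eq q al ka be P ->
  - al <= t <= w - al -> (0 < k < q)%N -> sin (q%:R * t) != 0 ->
  [\/ t = - al /\ k = 1%N, t = w - al /\ k = q.-1 |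
   P (t + k%:R * w) - P t < ln `|sin (t + k%:R * w)| - ln `|sin t|].
Proof.
move=> H ht hk snz; case: (leP al (w / 2)) => aw; first exact: core_half H aw ht hk snz.
have H' := sturmian_eqN H; have [hal hper _ _] := H; case/andP: (hk) => k0 kq.
have qw := q_omega R hq.
have snz' : sin (q%:R * - t) != 0 by rewrite mulrN sinN oppr_eq0.
have aw' : w - al <= w / 2 by clear -aw; lra.
have ht' : - (w - al) <= - t <= w - (w - al) by clear -ht; lra.
have hk' : (0 < q - k < q)%N by rewrite subn_gt0 kq ltn_subrL k0 (ltn_trans k0 kq).
case: (core_half H' aw' ht' hk' snz').
- move=> [e1 e2]; constructor 2; split; first by clear -e1; lra.
  by rewrite -(subKn (ltnW kq)) e2 subn1.
- move=> [e1 e2]; constructor 1; split; first by clear -e1; lra.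
  by rewrite -(subKn (ltnW kq)) e2 -subn1 subKn // ltnW.
- have -> : - (- t + (q - k)%:R * w) = t + k%:R * w - pi by rewrite natrB ?(ltnW kq) // -qw; ring.
  have -> : sin (- t + (q - k)%:R * w) = sin (t + k%:R * w).
    have -> : - t + (q - k)%:R * w = - (t + k%:R * w) + pi by rewrite natrB ?(ltnW kq) // -qw; ring.
    by rewrite sinDpi sinN opprK.
  by rewrite opprK sinN normrN -(hper (_ - pi)) subrK => h; constructor 3.
Qed.

End Assembly.

(** * The cohomological equation along an arc *)

Section Frac.
Variable R : realType.
Implicit Types (x y : R) (m : int).

Lemma frac_itv x : 0 <= frac x < 1.
Proof.
have /andP[h1 h2] := floor_itv x; rewrite /frac intrD in h2 *.
by rewrite subr_ge0 h1 ltrBlDr addrC.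
Qed.

Lemma floorD_frac x : x = (Num.floor x)%:~R + frac x.
Proof. by rewrite /frac addrC subrK. Qed.

Lemma frac_eq x m u : 0 <= u < 1 -> x = m%:~R + u -> Num.floor x = m /\ frac x = u.
Proof.
move=> /andP[u0 u1] ->.
have fl : Num.floor (m%:~R + u) = m by apply: floor_def; rewrite intrD lerDl u0 ltrD2l.
by split => //; rewrite /frac fl addrAC subrr add0r.
Qed.

Lemma frac_id x : 0 <= x < 1 -> frac x = x.
Proof. by move=> h; apply: (@frac_eq x 0 x h _).2; rewrite add0r. Qed.

Lemma fracDz x m : frac (x + m%:~R) = frac x.
Proof.
apply: (@frac_eq _ (Num.floor x + m) _ (frac_itv x) _).2.
by rewrite {1}[x]floorD_frac intrD; ring.
Qed.

Lemma fracD1 x : frac (x + 1) = frac x.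
Proof. exact: (fracDz x 1). Qed.

End Frac.

Section Geometric.
Variable R : realType.

Lemma le_half_pow0 (x C : R) : (forall n, x <= C / 2 ^+ n) -> x <= 0.
Proof.
move=> h; rewrite leNgt; apply/negP => x0.
have C0 : 0 < C by have := h 0; rewrite expr0 divr1; exact: lt_le_trans.
have [n hn] : exists n, C / x < n%:R.
  by exists (Num.truncn (C / x)).+1; apply: truncnS_gt.
have n2 : n%:R < 2 ^+ n :> R by rewrite -natrX ltr_nat ltn_expl.
have : C < x * 2 ^+ n by rewrite mulrC -ltr_pdivrMr //; exact: lt_trans n2.
by rewrite ltNge -ler_pdivlMr ?exprn_gt0 // h.
Qed.

Lemma geometric_limit (u : nat -> R) C : (forall n, `|u n.+1 - u n| <= C / 2 ^+ n) ->
  exists l, forall n, `|l - u n| <= 2 * C / 2 ^+ n.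
Proof.
move=> hu.
pose a n := u n - 2 * C / 2 ^+ n; pose b n := u n + 2 * C / 2 ^+ n.
have p n : 2 * C / 2 ^+ n = 2 * C / 2 ^+ n.+1 + C / 2 ^+ n.
  by rewrite exprS; field; rewrite expf_neq0.
have ha n : a n <= a n.+1.
  by have := hu n; have := p n; rewrite /a ler_norml; lra.
have hb n : b n.+1 <= b n.
  by have := hu n; have := p n; rewrite /b ler_norml; lra.
have C0 : 0 <= C by have := hu 0; rewrite expr0 divr1; exact: le_trans.
have ab n : a n <= b n.
  have : 0 <= 2 * C / 2 ^+ n by rewrite divr_ge0 ?mulr_ge0 ?exprn_ge0.
  by rewrite /a /b; lra.
have ha' n k : a n <= a (n + k)%N.
  by elim: k => [|k IH]; rewrite ?addn0 // addnS (le_trans IH).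
have hb' n k : b (n + k)%N <= b n.
  by elim: k => [|k IH]; rewrite ?addn0 // addnS (le_trans (hb _)).
have abmn m n : a m <= b n.
  apply: (le_trans (ha' m n)); apply: (le_trans (ab _)).
  by rewrite addnC; exact: hb'.
exists (sup (range a)) => n.
have ne : range a !=set0 by exists (a 0), 0.
have ub m : ubound (range a) (b m) by move=> _ [k _ <-]; exact: abmn.
have h1 : a n <= sup (range a) by apply: ub_le_sup; [exists (b 0); exact: ub|exists n].
have h2 : sup (range a) <= b n by apply: ge_sup.
by rewrite ler_norml; move: h1 h2; rewrite /a /b; lra.
Qed.

End Geometric.

Section QuasiPeriodic.
Variable R : realType.
Implicit Types (D : R -> R) (x y : R).

Definition quasiper D := forall v, D (v + 1) = D v + D 1.

Lemma quasiper0 D : quasiper D -> D 0 = 0.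
Proof. by move=> /(_ 0); rewrite add0r; lra. Qed.

Lemma quasiperZ D (m : int) v : quasiper D -> D (v + m%:~R) = D v + m%:~R * D 1.
Proof.
move=> h.
have pos (n : nat) x : D (x + n%:R) = D x + n%:R * D 1.
  elim: n => [|n IH]; first by rewrite addr0 mul0r addr0.
  by rewrite -natr1 addrA h IH; ring.
case: m => n; first exact: pos.
have := pos n.+1 (v - n.+1%:R); rewrite subrK => e.
by rewrite e NegzE mulrNz -[(Posz n.+1)%:~R]/(n.+1%:R : R) mulNr addrK.
Qed.

(** Such an interval has at most one integer in its interior, so the local bound is used at most
    twice: the constant doubles and the slope term does not. *)
Lemma quasiper_split D (a s : R) : quasiper D ->
  (forall u v, 0 <= u -> u <= v -> v <= 1 -> D v - D u <= a + s * (v - u)) ->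
  forall x y, x <= y -> y <= x + 1 -> 0 <= a -> D y - D x <= 2 * a + s * (y - x).
Proof.
move=> hD loc x y xy yx a0; have D0 := quasiper0 hD.
have /andP[u0 u1] := frac_itv x; have /andP[v0 v1] := frac_itv y.
rewrite [x]floorD_frac [y]floorD_frac in xy yx *.
rewrite ![_%:~R + _]addrC !(quasiperZ _ _ hD).
move: (Num.floor x) (Num.floor y) (frac x) (frac y) u0 u1 v0 v1 xy yx => i j u v u0 u1 v0 v1 xy yx.
have ij : i <= j.
  rewrite leNgt; apply/negP; rewrite -lezD1 => h.
  have : (j + 1)%:~R <= i%:~R :> R by rewrite ler_int.
  by rewrite intrD; lra.
have [e|ne] := eqVneq i j.
  rewrite e in xy yx *; have := loc u v u0 ltac:(lra) (ltW v1); lra.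
have ji : j = i + 1.
  have a1 : j <= i + 1 by rewrite -ltzD1 -(ltr_int R) !intrD; lra.
  have a2 : i + 1 <= j by rewrite lezD1 lt_neqAle ne.
  by apply/eqP; rewrite eq_le a1 a2.
have l1 := loc u 1 u0 (ltW u1) (lexx 1).
have l2 := loc 0 v (lexx 0) v0 (ltW v1).
rewrite ji intrD in yx *; rewrite D0 in l2; lra.
Qed.

Lemma quasiper_slope D (s : R) : quasiper D ->
  (forall u v, 0 <= u -> u <= v -> v <= 1 -> D v - D u <= s * (v - u)) ->
  forall x y, x <= y -> D y - D x <= s * (y - x).
Proof.
move=> hD loc x y xy.
have sp x' y' : x' <= y' -> y' <= x' + 1 -> D y' - D x' <= s * (y' - x').
  move=> h1 h2; have := @quasiper_split D 0 s hD _ x' y' h1 h2 (lexx 0).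
  by rewrite mulr0 add0r; apply => u v *; rewrite add0r; exact: loc.
have [n hn] : exists n, y - x < n%:R by exists (Num.truncn (y - x)).+1; apply: truncnS_gt.
elim: n x xy hn => [|n IH] x xy hn; first by move: hn xy; lra.
case: (leP y (x + 1)) => h; first exact: sp.
have h1 := sp x (x + 1); have h2 := IH (x + 1).
move: h1 h2; rewrite -natr1 in hn; rewrite lerDl lexx ler01 => /(_ isT isT) h1 /(_ (ltW h)) h2.
have : y - (x + 1) < n%:R by lra.
by move=> /h2; lra.
Qed.

End QuasiPeriodic.

(** * Solution of the cohomological equation by contraction *)

Section Cohomology.
Variables (R : realType) (q : nat) (hq : (2 <= q)%N).
Implicit Types (d K : R) (e Ph : R -> R).

(* The equation satisfied, in the coordinate of the whole circle, by a solution of the cohomological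
   equation along the inverse branch v |-> d + v / q of the map. *)
Definition coh d e K Ph := [/\ quasiper Ph,
  forall v, 0 <= v <= 1 -> Ph v = e v + Ph (d + v / q%:R) - Ph d &
  forall x y, x <= y -> `|Ph y - Ph x| <= K * (y - x)].

Let Q2 := q_ge2 R hq.
Let Q0 := q_gt0 R hq.

Definition ext (h : R -> R) (v : R) : R := h (frac v) + (Num.floor v)%:~R * h 1.

Lemma ext_eq h v : h 0 = 0 -> 0 <= v <= 1 -> ext h v = h v.
Proof.
move=> h0 /andP[v0]; rewrite le_eqVlt => /predU1P[->|v1].
  have [fl fr] := @frac_eq R 1 1 0 ltac:(by rewrite lexx ltr01) ltac:(by rewrite addr0).
  by rewrite /ext fl fr h0 add0r mul1r.
have [fl fr] := @frac_eq R v 0 v ltac:(by rewrite v0 v1) ltac:(by rewrite add0r).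
by rewrite /ext fl fr mul0r addr0.
Qed.

Lemma ext_quasiper h : h 0 = 0 -> quasiper (ext h).
Proof.
move=> h0 v; rewrite (@ext_eq h 1) ?ler01 ?lexx //.
have [fl fr] := @frac_eq R (v + 1) (Num.floor v + 1) (frac v) (frac_itv v)
  ltac:(rewrite {1}[v]floorD_frac intrD; ring).
by rewrite /ext fl fr intrD; ring.
Qed.

Fixpoint coh_iter d e n : R -> R :=
  if n is m.+1 then ext (fun t => e t + coh_iter d e m (d + t / q%:R) - coh_iter d e m d)
  else fun=> 0.

Lemma coh_iter_quasiper d e n : e 0 = 0 -> quasiper (coh_iter d e n).
Proof.
move=> e0; case: n => [|n] /=; first by move=> v; rewrite addr0.
by apply: ext_quasiper; rewrite e0 mul0r addr0 add0r subrr.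
Qed.

Lemma coh_iterS d e n v : e 0 = 0 -> 0 <= v <= 1 ->
  coh_iter d e n.+1 v = e v + coh_iter d e n (d + v / q%:R) - coh_iter d e n d.
Proof.
by move=> e0 hv /=; rewrite ext_eq // e0 mul0r addr0 add0r subrr.
Qed.

Lemma norm_slope D (s : R) : quasiper D ->
  (forall u v, 0 <= u -> u <= v -> v <= 1 -> `|D v - D u| <= s * (v - u)) ->
  forall x y, x <= y -> `|D y - D x| <= s * (y - x).
Proof.
move=> hD loc x y xy; rewrite ler_norml; apply/andP; split; last first.
  by apply: (quasiper_slope hD) xy => u v u0 uv v1; have := loc u v u0 uv v1; rewrite ler_norml => /andP[].
have hN : quasiper (fun x => - D x) by move=> v; rewrite hD opprD.
suff : (fun x => - D x) y - (fun x => - D x) x <= s * (y - x) by rewrite /=; lra.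
apply: (quasiper_slope hN) xy => u v u0 uv v1 /=.
by have := loc u v u0 uv v1; rewrite ler_norml => /andP[]; lra.
Qed.

Lemma shrink d (u v : R) : u <= v -> d + u / q%:R <= d + v / q%:R.
Proof. by move=> uv; rewrite lerD2l ler_pM2r ?invr_gt0. Qed.

(** Picard iteration from 0. Differences of successive iterates are measured by their slope, which
    the inverse branch contracts by 1 / q <= 1/2; quasi-periodicity carries slope bounds from [0, 1]
    to the line. *)
Lemma coh_exists d e K : e 0 = 0 ->
  (forall u v, 0 <= u -> u <= v -> v <= 1 -> `|e v - e u| <= K * (v - u)) ->
  exists Ph, coh d e (2 * K) Ph.
Proof.
move=> e0 he.
have K0 : 0 <= K.
  have := he 0 1 (lexx 0) ler01 (lexx 1); rewrite subr0 mulr1; exact: le_trans.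
have Qi : q%:R^-1 <= 2^-1 :> R by rewrite lef_pV2 ?posrE.
have step n u v : 0 <= u -> u <= v -> v <= 1 ->
    `|(coh_iter d e n.+1 v - coh_iter d e n v) - (coh_iter d e n.+1 u - coh_iter d e n u)| <= K / 2 ^+ n * (v - u).
  elim: n u v => [|n IH] u v u0 uv v1.
    rewrite !coh_iterS //; [|lra|lra]; rewrite /= !subr0 expr0 divr1 !addr0; exact: he.
  have qp m : quasiper (fun x => coh_iter d e m.+1 x - coh_iter d e m x).
    by move=> x; rewrite !(coh_iter_quasiper d _ e0 x); ring.
  have G := @norm_slope _ (K / 2 ^+ n) (qp n) IH _ _ (shrink d uv).
  have j1 : 0 <= v <= 1 by lra.
  have j2 : 0 <= u <= 1 by lra.
  rewrite (coh_iterS d n.+1 e0 j1) (coh_iterS d n.+1 e0 j2) (coh_iterS d n e0 j1) (coh_iterS d n e0 j2).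
  have dq : d + v / q%:R - (d + u / q%:R) = (v - u) / q%:R by field; rewrite gt_eqF.
  rewrite dq in G.
  set X := (X in `|X| <= _); set Y := (Y in `|Y| <= _) in G.
  have -> : X = Y by rewrite /X /Y; ring.
  apply: (le_trans G).
  have -> : K / 2 ^+ n.+1 * (v - u) = K / 2 ^+ n * ((v - u) * 2^-1).
    by rewrite exprS; field; rewrite expf_neq0.
  apply: ler_wpM2l; first by rewrite divr_ge0 // exprn_ge0.
  by apply: ler_wpM2l => //; lra.
have stepR n x y : x <= y -> `|(coh_iter d e n.+1 y - coh_iter d e n y) - (coh_iter d e n.+1 x - coh_iter d e n x)|
    <= K / 2 ^+ n * (y - x).
  apply: (@norm_slope (fun x => coh_iter d e n.+1 x - coh_iter d e n x)).
    by move=> z; rewrite !(coh_iter_quasiper d _ e0 z); ring.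
  exact: step.
have dist v n : `|coh_iter d e n.+1 v - coh_iter d e n v| <= (K * `|v|) / 2 ^+ n.
  have z m : coh_iter d e m 0 = 0 by apply: quasiper0; exact: coh_iter_quasiper.
  rewrite mulrAC; case: (leP 0 v) => v0.
    by have := stepR n 0 v v0; rewrite !z !subr0 (ger0_norm v0).
  by have := stepR n v 0 (ltW v0); rewrite !z !subr0 !sub0r normrN (ltr0_norm v0).
have lip n x y : x <= y -> `|coh_iter d e n y - coh_iter d e n x| <= 2 * K * (y - x).
  elim: n x y => [|n IH] x y xy; first by rewrite subrr normr0 !mulr_ge0 // subr_ge0.
  apply: norm_slope xy; first exact: coh_iter_quasiper.
  move=> u v u0 uv v1; rewrite !coh_iterS //; [|lra|lra].
  have G := IH _ _ (shrink d uv).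
  have dq : d + v / q%:R - (d + u / q%:R) = (v - u) / q%:R by field; rewrite gt_eqF.
  rewrite dq in G; have H := he u v u0 uv v1.
  have G2 : 2 * K * ((v - u) / q%:R) <= K * (v - u).
    have -> : K * (v - u) = 2 * K * ((v - u) * 2^-1) by field.
    by apply: ler_wpM2l; [rewrite mulr_ge0|apply: ler_wpM2l => //; lra].
  rewrite !ler_norml in G H *; lra.
have /choice[Ph hPh] : forall v, exists l, forall n, `|l - coh_iter d e n v| <= 2 * (K * `|v|) / 2 ^+ n.
  by move=> v; apply: geometric_limit; exact: dist.
have close v n : `|Ph v - coh_iter d e n v| <= 2 * K * `|v| / 2 ^+ n by have := hPh v n; rewrite mulrA.
exists Ph; split.
- move=> v; apply/eqP; rewrite -subr_eq0 -normr_le0.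
  apply: (@le_half_pow0 _ _ (2 * K * `|v + 1| + 2 * K * `|v| + 2 * K * `|1|)) => n.
  have h1 := close (v + 1) n; have h2 := close v n; have h3 := close 1 n.
  rewrite (coh_iter_quasiper d n e0) in h1.
  rewrite !mulrDl; move: h1 h2 h3; rewrite !ler_norml; lra.
- move=> v hv; apply/eqP; rewrite -subr_eq0 -normr_le0.
  apply: (@le_half_pow0 _ _ (2 * K * `|v| + 2 * K * `|d + v / q%:R| + 2 * K * `|d|)) => n.
  have h1 := close v n.+1; have h2 := close (d + v / q%:R) n; have h3 := close d n.
  rewrite coh_iterS // in h1.
  have h1' : 2 * K * `|v| / 2 ^+ n.+1 <= 2 * K * `|v| / 2 ^+ n.
    apply: ler_wpM2l; first by rewrite !mulr_ge0.
    by rewrite lef_pV2 ?posrE ?exprn_gt0 // ler_eXn2l // ltr1n.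
  have {}h1 := le_trans h1 h1'.
  rewrite !mulrDl; move: h1 h2 h3; rewrite !ler_norml; lra.
- move=> x y xy; rewrite -subr_le0.
  apply: (@le_half_pow0 _ _ (2 * K * `|x| + 2 * K * `|y|)) => n.
  have h1 := close x n; have h2 := close y n; have h3 := lip n x y xy.
  rewrite (mulrDl (2 * K * `|x|)) lerBlDr.
  have -> : Ph y - Ph x = (Ph y - coh_iter d e n y) - (Ph x - coh_iter d e n x) + (coh_iter d e n y - coh_iter d e n x) by ring.
  apply: (le_trans (ler_normD _ _)); apply: lerD => //.
  by apply: (le_trans (ler_normB _ _)); rewrite [X in _ <= X]addrC; exact: lerD.
Qed.

(** One use of the equation turns a slope bound s into B + s / q. The claimed slope is the fixed
    point, and the excess of the initial bound over it is halved at each step. *)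
Lemma coh_slope d e K Ph B : coh d e K Ph ->
  (forall u v, 0 <= u -> u <= v -> v <= 1 -> e v - e u <= B * (v - u)) ->
  forall x y, x <= y -> Ph y - Ph x <= B * q%:R / (q%:R - 1) * (y - x).
Proof.
move=> [qp eqn lip] he x y xy.
have Q2' := Q2; have Q0' := Q0.
have [S SE SB] : exists2 S, S = B * q%:R / (q%:R - 1) & B = S - S / q%:R.
  by exists (B * q%:R / (q%:R - 1)) => //; field; apply/andP; split; apply: lt0r_neq0; lra.
have Qi : q%:R^-1 <= 2^-1 :> R by rewrite lef_pV2 ?posrE.
have K0 : 0 <= K by have := lip 0 1 ler01; rewrite subr0 mulr1; exact: le_trans.
have M0 : 0 <= K + `|S| by rewrite addr_ge0.
rewrite -SE -subr_le0.
apply: (@le_half_pow0 _ _ ((K + `|S|) * (y - x))) => n; rewrite lerBlDr.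
have -> : (K + `|S|) * (y - x) / 2 ^+ n + S * (y - x) = ((K + `|S|) / 2 ^+ n + S) * (y - x).
  by field; rewrite expf_neq0.
elim: n x y xy => [|n IH] x y xy.
  have := lip x y xy; rewrite ler_norml => /andP[_ h]; apply: (le_trans h).
  rewrite expr0 divr1; apply: ler_wpM2r; first by lra.
  by have := ler_norm (- S); rewrite normrN; lra.
apply: (quasiper_slope qp) xy => u v u0 uv v1.
have j1 : 0 <= v <= 1 by lra.
have j2 : 0 <= u <= 1 by lra.
rewrite (eqn v j1) (eqn u j2).
have G := IH _ _ (shrink d uv); have H := he u v u0 uv v1.
have dq : d + v / q%:R - (d + u / q%:R) = (v - u) / q%:R by field; rewrite gt_eqF.
rewrite dq in G.
have E : ((K + `|S|) / 2 ^+ n + S) * ((v - u) / q%:R) + B * (v - u) =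
   ((K + `|S|) / 2 ^+ n * q%:R^-1 + S) * (v - u) by rewrite SB; ring.
have F : (K + `|S|) / 2 ^+ n * q%:R^-1 <= (K + `|S|) / 2 ^+ n.+1.
  have -> : (K + `|S|) / 2 ^+ n.+1 = (K + `|S|) / 2 ^+ n * 2^-1.
    by rewrite exprS; field; rewrite expf_neq0.
  by apply: ler_wpM2l => //; rewrite divr_ge0 // exprn_ge0.
have F2 : ((K + `|S|) / 2 ^+ n * q%:R^-1 + S) * (v - u) <= ((K + `|S|) / 2 ^+ n.+1 + S) * (v - u).
  by apply: ler_wpM2r; lra.
lra.
Qed.

Lemma cohN d e K Ph : coh d e K Ph -> coh d (fun v => - e v) K (fun v => - Ph v).
Proof.
move=> [qp eqn lip]; split.
- by move=> v; rewrite qp opprD.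
- by move=> v hv; rewrite eqn //; ring.
- by move=> x y xy; rewrite -opprD normrN; exact: lip.
Qed.

Lemma coh_slope_ge d e K Ph A : coh d e K Ph ->
  (forall u v, 0 <= u -> u <= v -> v <= 1 -> A * (v - u) <= e v - e u) ->
  forall x y, x <= y -> A * q%:R / (q%:R - 1) * (y - x) <= Ph y - Ph x.
Proof.
move=> /cohN h he x y xy.
have := @coh_slope d _ K _ (- A) h _ x y xy; rewrite !mulNr => h2.
rewrite -lerN2 opprB addrC; move: h2; rewrite opprK addrC; apply.
by move=> u v u0 uv v1; have := he u v u0 uv v1; rewrite mulNr; lra.
Qed.

(** Apply the equation repeatedly: the additive error doubles because of [quasiper_split], while the
    slope remainder halves. Since n stays free, the first term can be made small after the second;
    for equal data, Ph 1 and Ph' 1 coincide. *)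
Lemma coh_dep d d' e e' K Ph Ph' ep : coh d e K Ph -> coh d' e' K Ph' ->
  (forall u v, 0 <= u -> u <= v -> v <= 1 -> `|(e v - e' v) - (e u - e' u)| <= ep) ->
  forall n, `|Ph 1 - Ph' 1| <= 2 ^+ n.+1 * (ep + 2 * K * `|d - d'|) + 2 * K / 2 ^+ n.
Proof.
move=> [qp eqn lip] [qp' eqn' lip'] he n.
set E := ep + _.
have Qi : q%:R^-1 <= 2^-1 :> R by rewrite lef_pV2 ?posrE.
have K0 : 0 <= K by have := lip 0 1 ler01; rewrite subr0 mulr1; exact: le_trans.
have ep0 : 0 <= ep by apply: le_trans (he 0 1 (lexx _) ler01 (lexx _)).
have E0 : 0 <= E by rewrite addr_ge0 // !mulr_ge0.
pose D v := Ph v - Ph' v.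
have qD : quasiper D by move=> v; rewrite /D qp qp'; ring.
have lip2 x y : `|Ph' y - Ph' x| <= K * `|y - x|.
  case: (leP x y) => xy; first by rewrite (ger0_norm (_ : 0 <= y - x)) ?subr_ge0 //; exact: lip'.
  have x0 : 0 <= x - y by rewrite subr_ge0 ltW.
  by rewrite distrC [`|y - x|]distrC (ger0_norm x0); exact: lip' (ltW xy).
have claim m x y : x <= y -> y <= x + 1 ->
    `|D y - D x| <= (2 ^+ m.+1 - 2) * E + 2 * K / 2 ^+ m * (y - x).
  elim: m x y => [|m IH] x y xy yx.
    rewrite expr1 subrr mul0r add0r expr0 divr1.
    by have h1 := lip x y xy; have h2 := lip' x y xy; rewrite /D !ler_norml in h1 h2 *; lra.
  have loc u v : 0 <= u -> u <= v -> v <= 1 ->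
      `|D v - D u| <= (2 ^+ m.+1 - 1) * E + 2 * K / 2 ^+ m.+1 * (v - u).
    move=> u0 uv v1.
    have dq : d + v / q%:R - (d + u / q%:R) = (v - u) / q%:R by field; rewrite gt_eqF.
    have i1 : (v - u) / q%:R <= (v - u) * 2^-1 by apply: ler_wpM2l => //; lra.
    have G := IH _ _ (shrink d uv); rewrite dq in G.
    have {}G := G ltac:(lra).
    have H := he u v u0 uv v1.
    have L1 := lip2 (d + v / q%:R) (d' + v / q%:R); have L2 := lip2 (d + u / q%:R) (d' + u / q%:R).
    have ds z : `|d' + z - (d + z)| = `|d - d'| by rewrite distrC; congr `|_|; ring.
    rewrite !ds in L1 L2.
    have i2 : 2 * K / 2 ^+ m * ((v - u) / q%:R) <= 2 * K / 2 ^+ m.+1 * (v - u).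
      have -> : 2 * K / 2 ^+ m.+1 * (v - u) = 2 * K / 2 ^+ m * ((v - u) * 2^-1).
        by rewrite exprS; field; rewrite expf_neq0.
      by apply: ler_wpM2l => //; rewrite divr_ge0 ?mulr_ge0 // exprn_ge0.
    have j1 : 0 <= v <= 1 by lra.
    have j2 : 0 <= u <= 1 by lra.
    have i3 : (2 ^+ m.+1 - 1) * E = (2 ^+ m.+1 - 2) * E + ep + 2 * K * `|d - d'| by rewrite /E; ring.
    rewrite i3 /D (eqn v j1) (eqn u j2) (eqn' v j1) (eqn' u j2).
    clear -G H L1 L2 i2; rewrite /D !ler_norml in G H L1 L2 *; lra.
  have a0 : 0 <= (2 ^+ m.+1 - 1) * E.
    by rewrite mulr_ge0 // subr_ge0 exprn_ege1 // ler1n.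
  have i4 : (2 ^+ m.+2 - 2) * E = 2 * ((2 ^+ m.+1 - 1) * E) by rewrite [in LHS]exprS; ring.
  rewrite i4 ler_norml; apply/andP; split; last first.
    apply: (quasiper_split qD) => // u v u0 uv v1.
    by have := loc u v u0 uv v1; rewrite ler_norml => /andP[].
  have qN : quasiper (fun x => - D x) by move=> v; rewrite qD opprD.
  suff : (fun x => - D x) y - (fun x => - D x) x <= 2 * ((2 ^+ m.+1 - 1) * E) + 2 * K / 2 ^+ m.+1 * (y - x).
    by rewrite /=; lra.
  apply: (quasiper_split qN) => // u v u0 uv v1 /=.
  by have := loc u v u0 uv v1; rewrite ler_norml => /andP[]; lra.
have := claim n 0 1 ler01; rewrite add0r => /(_ (lexx _)).
have D0 : D 0 = 0 := quasiper0 qD.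
rewrite D0 !subr0 mulr1 => h; apply: (le_trans h).
by rewrite lerD2r; apply: ler_wpM2r => //; lra.
Qed.

End Cohomology.

(** * Selection of the arc and the inequality on the whole circle *)

Section Arcs.
Variables (R : realType) (q : nat) (hq : (2 <= q)%N).
Implicit Types (al ka be t x y d : R) (P : R -> R).
Notation w := (omega R q).
Notation LU := (@logU R q).
Notation V := (@dlogU R q).

(* The parameter al of the maximizing arc stays in [arc_eta, omega - arc_eta]. *)
Definition arc_eta : R := expR (- 2) * sin (w / 2) / 2.
Definition arc_lip : R := w * V (- (w - arc_eta)).
(** The coordinate is v = (x + ka + q al) / pi. A point with v in [0, 1] has the preimage t = - al +
    w v in the arc, and the left end - al itself has coordinate [arc_shift]. *)
Definition arc_incr al v := LU (- al + w * v) - LU (- al).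
Definition arc_shift al ka := ((q%:R - 1) * al + ka) / pi.

Let w0 : 0 < w. Proof. exact: omega_gt0. Qed.
Let Q2 : 2 <= q%:R :> R. Proof. exact: q_ge2. Qed.
Let qw : q%:R * w = pi. Proof. exact: q_omega. Qed.
Let p0 : 0 < pi :> R. Proof. exact: pi_gt0. Qed.
Let wp : w <= pi / 2. Proof. exact: omega_le. Qed.
Ltac facts := pose proof w0; pose proof Q2; pose proof qw; pose proof p0; pose proof wp.

Lemma sin_half_gt0 : 0 < sin (w / 2).
Proof. by facts; apply: (sin_gt0_omega hq); lra. Qed.

Lemma eta_itv : 0 < arc_eta /\ arc_eta <= w / 4.
Proof.
facts; have s0 := sin_half_gt0; rewrite /arc_eta.
have e0 : 0 < expR (- 2) :> R := expR_gt0 _.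
have e1 : expR (- 2) <= 1 :> R by have := ler_expR (- 2) (0 : R); rewrite expR0 => ->; lra.
have s1 : sin (w / 2) <= w / 2 by apply: sin_le; lra.
split; first by rewrite divr_gt0 // mulr_gt0.
have : expR (- 2) * sin (w / 2) <= 1 * (w / 2) by apply: ler_pM => //; exact: ltW.
lra.
Qed.

Lemma arc_incr0 al : arc_incr al 0 = 0.
Proof. by rewrite /arc_incr mulr0 addr0 subrr. Qed.

Lemma arc_lip_ge0 : 0 <= arc_lip.
Proof.
facts; have [e0 e1] := eta_itv; apply: mulr_ge0; first exact: ltW.
by have := @V_decr R q hq (- (w - arc_eta)) 0; rewrite /dlogU dU0 mul0r; lra.
Qed.

Lemma V_abs_le t : - (w - arc_eta) <= t <= w - arc_eta -> `|V t| <= V (- (w - arc_eta)).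
Proof.
facts; have [e0 e1] := eta_itv => ht.
have h1 : V t <= V (- (w - arc_eta)) by apply: V_nincr => //; lra.
have h2 : V (w - arc_eta) <= V t by apply: V_nincr => //; lra.
by rewrite VN in h1 *; rewrite ler_norml; lra.
Qed.

Lemma LU_lip x y : - (w - arc_eta) <= x -> x <= y -> y <= w - arc_eta -> `|LU y - LU x| <= V (- (w - arc_eta)) * (y - x).
Proof.
facts; have [e0 e1] := eta_itv => h1 h2 h3.
have /andP[k1 k2] : V y * (y - x) <= LU y - LU x <= V x * (y - x) by apply: LU_bounds => //; lra.
have v1 : `|V x| <= V (- (w - arc_eta)) by apply: V_abs_le; lra.
have v2 : `|V y| <= V (- (w - arc_eta)) by apply: V_abs_le; lra.
rewrite !ler_norml in v1 v2 *.
have m1 : V x * (y - x) <= V (- (w - arc_eta)) * (y - x) by apply: ler_wpM2r; lra.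
have m2 : - V (- (w - arc_eta)) * (y - x) <= V y * (y - x) by apply: ler_wpM2r; lra.
by rewrite mulNr in m2; lra.
Qed.

Lemma arc_incr_bounds al u v : 0 < al < w -> 0 <= u -> u <= v -> v <= 1 ->
  w * V (w - al) * (v - u) <= arc_incr al v - arc_incr al u <= w * V (- al) * (v - u).
Proof.
facts=> hal u0 uv v1.
have i1 : w * u <= w * v by rewrite ler_pM2l.
have i2 : w * v <= w by rewrite ler_piMr // ltW.
have i3 : 0 <= w * u by rewrite mulr_ge0 // ltW.
have /andP[k1 k2] : V (- al + w * v) * ((- al + w * v) - (- al + w * u)) <= LU (- al + w * v) - LU (- al + w * u)
   <= V (- al + w * u) * ((- al + w * v) - (- al + w * u)) by apply: LU_bounds => //; lra.
have e : arc_incr al v - arc_incr al u = LU (- al + w * v) - LU (- al + w * u) by rewrite /arc_incr; ring.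
have d0 : 0 <= w * (v - u) by apply: mulr_ge0; [exact: ltW|rewrite subr_ge0].
have ed : (- al + w * v) - (- al + w * u) = w * (v - u) by ring.
have m1 : V (- al + w * u) * (w * (v - u)) <= V (- al) * (w * (v - u)).
  by apply: ler_wpM2r => //; apply: V_nincr => //; lra.
have m2 : V (w - al) * (w * (v - u)) <= V (- al + w * v) * (w * (v - u)).
  by apply: ler_wpM2r => //; apply: V_nincr => //; lra.
have e1 : w * V (w - al) * (v - u) = V (w - al) * (w * (v - u)) by ring.
have e2 : w * V (- al) * (v - u) = V (- al) * (w * (v - u)) by ring.
by rewrite ed in k1 k2; rewrite e e1 e2; lra.
Qed.

Lemma arc_incr_lip al u v : arc_eta <= al <= w - arc_eta -> 0 <= u -> u <= v -> v <= 1 ->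
  `|arc_incr al v - arc_incr al u| <= arc_lip * (v - u).
Proof.
facts=> hal u0 uv v1; have [e0 e1] := eta_itv.
have /andP[k1 k2] := @arc_incr_bounds al u v ltac:(lra) u0 uv v1.
have a1 : `|V (- al)| <= V (- (w - arc_eta)) by apply: V_abs_le; lra.
have a2 : `|V (w - al)| <= V (- (w - arc_eta)) by apply: V_abs_le; lra.
have d0 : 0 <= w * (v - u) by apply: mulr_ge0; [exact: ltW|rewrite subr_ge0].
rewrite !ler_norml in a1 a2 *.
have m1 : V (- al) * (w * (v - u)) <= V (- (w - arc_eta)) * (w * (v - u)) by apply: ler_wpM2r; lra.
have m2 : - V (- (w - arc_eta)) * (w * (v - u)) <= V (w - al) * (w * (v - u)) by apply: ler_wpM2r; lra.
have e3 : w * V (w - al) * (v - u) = V (w - al) * (w * (v - u)) by ring.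
have e4 : w * V (- al) * (v - u) = V (- al) * (w * (v - u)) by ring.
have e5 : arc_lip * (v - u) = V (- (w - arc_eta)) * (w * (v - u)) by rewrite /arc_lip; ring.
by rewrite e3 e4 in k1 k2; rewrite e5; lra.
Qed.

Lemma LU_ends al : 0 < al < w -> LU (w - al) - LU (- al) = ln (sin al) - ln (sin (w - al)).
Proof.
facts=> hal.
have s1 := sinq_gt0 hq hal; have s2 := sin_gt0_omega hq hal.
have s3 : 0 < sin (w - al) by apply: (sin_gt0_omega hq); lra.
have e : sin (q%:R * (w - al)) = sin (q%:R * al).
  by rewrite mulrBr qw sinB sinpi cospi mul0r mulN1r sub0r opprK.
rewrite LUN !LU_abs //; [|lra|lra].
by rewrite !lnU_abs ?e ?gt_eqF // !gtr0_norm //; ring.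
Qed.

Lemma w_V_half : w * V (- (w / 2)) <= 2.
Proof.
facts; have s0 := sin_half_gt0.
have -> : V (- (w / 2)) = cos (w / 2) / sin (w / 2).
  rewrite VN V_cot //; [|lra|by apply: lt0r_neq0; lra].
  have -> : q%:R * (w / 2) = pi / 2 by rewrite mulrA q_omega.
  by rewrite cos_pihalf mul0r mulr0 sub0r opprK.
have := @xcos_le_sin R (w / 2) ltac:(lra) => h.
by rewrite mulrA ler_pdivrMr //; lra.
Qed.

(** At v = 1 the equation splits Ph 1 into the difference of [LU] at the ends of the arc and an
    increment of [Ph] over a length 1 / q, which the slope bounds control. *)
Lemma coh_arc_end al ka K Ph : 0 < al < w -> coh q (arc_shift al ka) (arc_incr al) K Ph ->
  ln (sin al) - ln (sin (w - al)) + w * V (w - al) / (q%:R - 1) <= Ph 1 <=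
  ln (sin al) - ln (sin (w - al)) + w * V (- al) / (q%:R - 1).
Proof.
facts=> hal C; have [qp eqn _] := C.
have q1 : q%:R - 1 != 0 :> R by apply: lt0r_neq0; lra.
have Q0 : q%:R != 0 :> R by apply: lt0r_neq0; lra.
have sl := @coh_slope R q hq _ _ _ _ (w * V (- al)) C.
have sg := @coh_slope_ge R q hq _ _ _ _ (w * V (w - al)) C.
have {}sl := sl (fun u v u0 uv v1 => proj2 (andP (arc_incr_bounds hal u0 uv v1))).
have {}sg := sg (fun u v u0 uv v1 => proj1 (andP (arc_incr_bounds hal u0 uv v1))).
set d := arc_shift al ka in eqn sl sg.
have dd : d <= d + 1 / q%:R by rewrite lerDl divr_ge0 //; lra.
have h1 := sl _ _ dd; have h2 := sg _ _ dd.
have e1 : d + 1 / q%:R - d = 1 / q%:R by ring.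
have e2 z : z * q%:R / (q%:R - 1) * (1 / q%:R) = z / (q%:R - 1) :> R by field; rewrite q1 Q0.
rewrite e1 !e2 in h1 h2.
have := eqn 1; rewrite ler01 lexx => /(_ isT) ->.
have -> : arc_incr al 1 = ln (sin al) - ln (sin (w - al)).
  by rewrite /arc_incr mulr1 [- al + w]addrC LU_ends.
lra.
Qed.

(** The purpose of [arc_eta]: near an end of (0, w) the logarithms in [coh_arc_end] dominate the
    slope term, which is at most 2 by [w_V_half]. *)
Lemma sin_eta_bounds : ln (sin arc_eta) + 2 < ln (sin (w - arc_eta)).
Proof.
facts; have [e0 e1] := eta_itv; have s0 := sin_half_gt0.
have se : 0 < sin arc_eta by apply: (sin_gt0_omega hq); lra.
have swe : sin (w / 2) <= sin (w - arc_eta) by apply: sin_ge_mid; lra.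
have l1 : ln (sin (w / 2)) <= ln (sin (w - arc_eta)) by rewrite ler_ln ?posrE //; lra.
have l2 : ln (sin arc_eta) <= ln arc_eta by rewrite ler_ln ?posrE //; apply: sin_le; lra.
have e2 : 0 < expR (- 2) :> R := expR_gt0 _.
have l3 : ln arc_eta = - 2 + ln (sin (w / 2)) - ln 2.
  by rewrite /arc_eta ln_div ?posrE ?mulr_gt0 // lnM ?posrE // expRK.
have l4 : 0 < ln 2 :> R by apply: ln_gt0; lra.
lra.
Qed.

Lemma coh_end_sign_left ka K Ph : coh q (arc_shift arc_eta ka) (arc_incr arc_eta) K Ph -> Ph 1 < 0.
Proof.
facts; have [e0 e1] := eta_itv => C.
have hh : 0 < arc_eta < w by lra.
have /andP[_ h] := coh_arc_end hh C.
have b := sin_eta_bounds.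
have v1 : V (- arc_eta) <= V (- (w / 2)) by apply: V_nincr => //; lra.
have v2 : w * V (- arc_eta) <= 2 by apply: le_trans w_V_half; rewrite ler_pM2l.
have v3 : w * V (- arc_eta) / (q%:R - 1) <= 2 by rewrite ler_pdivrMr; lra.
lra.
Qed.

Lemma coh_end_sign_right ka K Ph : coh q (arc_shift (w - arc_eta) ka) (arc_incr (w - arc_eta)) K Ph -> 0 < Ph 1.
Proof.
facts; have [e0 e1] := eta_itv => C.
have hh : 0 < w - arc_eta < w by lra.
have /andP[h _] := coh_arc_end hh C.
have b := sin_eta_bounds.
have ee : w - (w - arc_eta) = arc_eta by ring.
rewrite ee in h.
have v1 : V (- arc_eta) <= V (- (w / 2)) by apply: V_nincr => //; lra.
have v2 : w * V (- arc_eta) <= 2 by apply: le_trans w_V_half; rewrite ler_pM2l.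
have v3 : w * V (- arc_eta) / (q%:R - 1) <= 2 by rewrite ler_pdivrMr; lra.
rewrite VN in v3.
have v4 : w * V arc_eta / (q%:R - 1) = - (w * - V arc_eta / (q%:R - 1)) by rewrite mulrN mulNr opprK.
lra.
Qed.

Lemma coh_arc_exists al ka : arc_eta <= al <= w - arc_eta ->
  exists Ph, coh q (arc_shift al ka) (arc_incr al) (2 * arc_lip) Ph.
Proof.
move=> hal; apply: coh_exists => //; first exact: arc_incr0.
by move=> u v; exact: arc_incr_lip.
Qed.

Lemma arc_incr_dep al al' u v : arc_eta <= al <= w - arc_eta -> arc_eta <= al' <= w - arc_eta ->
  0 <= u -> u <= v -> v <= 1 ->
  `|(arc_incr al v - arc_incr al' v) - (arc_incr al u - arc_incr al' u)| <= 2 * V (- (w - arc_eta)) * `|al - al'|.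
Proof.
facts=> h h' u0 uv v1; have [e0 e1] := eta_itv.
wlog hle : al al' h h' / al' <= al.
  move=> W; case: (leP al' al) => hl; first exact: W.
  have -> : arc_incr al v - arc_incr al' v - (arc_incr al u - arc_incr al' u) =
    - ((arc_incr al' v - arc_incr al v) - (arc_incr al' u - arc_incr al u)) by ring.
  by rewrite normrN distrC [`|al - al'|]distrC -normrN opprB; exact: W (ltW hl).
have i1 : w * u <= w * v by rewrite ler_pM2l.
have i2 : w * v <= w by rewrite ler_piMr // ltW.
have i3 : 0 <= w * u by rewrite mulr_ge0 // ltW.
have b z : 0 <= w * z -> w * z <= w -> `|LU (- al' + w * z) - LU (- al + w * z)| <= V (- (w - arc_eta)) * (al - al').
  move=> z0 z1; have -> : al - al' = (- al' + w * z) - (- al + w * z) by ring.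
  by apply: LU_lip; lra.
have b1 := b u i3 ltac:(lra); have b2 := b v ltac:(lra) i2.
have -> : (arc_incr al v - arc_incr al' v) - (arc_incr al u - arc_incr al' u) =
   (LU (- al' + w * u) - LU (- al + w * u)) - (LU (- al' + w * v) - LU (- al + w * v)) by rewrite /arc_incr; ring.
rewrite (ger0_norm (_ : 0 <= al - al')) ?subr_ge0 //.
have -> : 2 * V (- (w - arc_eta)) * (al - al') = V (- (w - arc_eta)) * (al - al') + V (- (w - arc_eta)) * (al - al') by ring.
by apply: (le_trans (ler_normB _ _)); exact: lerD.
Qed.

Definition dep_const : R :=
  2 * V (- (w - arc_eta)) + 4 * arc_lip * (q%:R - 1) / pi + 4 * arc_lip.

Lemma V_eta_ge0 : 0 <= V (- (w - arc_eta)).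
Proof. by have := arc_lip_ge0; rewrite /arc_lip pmulr_rge0. Qed.

Lemma dep_const_ge0 : 0 <= dep_const.
Proof.
facts; have h := arc_lip_ge0; have h2 := V_eta_ge0.
have q1 : 0 <= q%:R - 1 :> R by lra.
have t1 : 0 <= 4 * arc_lip * (q%:R - 1) / pi.
  by apply: divr_ge0; [apply: mulr_ge0 => //; exact: mulr_ge0|exact: ltW].
by rewrite /dep_const; apply: addr_ge0; [apply: addr_ge0 => //|]; exact: mulr_ge0.
Qed.

Lemma coh_arc_dep al al' ka Ph Ph' n : arc_eta <= al <= w - arc_eta -> arc_eta <= al' <= w - arc_eta ->
  coh q (arc_shift al ka) (arc_incr al) (2 * arc_lip) Ph ->
  coh q (arc_shift al' ka) (arc_incr al') (2 * arc_lip) Ph' ->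
  `|Ph 1 - Ph' 1| <= dep_const * (2 ^+ n.+1 * `|al - al'| + 1 / 2 ^+ n).
Proof.
facts=> h h' C C'.
have := @coh_dep R q hq _ _ _ _ _ _ _ _ C C' (fun u v => arc_incr_dep h h') n.
move/le_trans; apply.
have A0 := arc_lip_ge0; have V0 := V_eta_ge0; have D0 := dep_const_ge0.
have -> : `|arc_shift al ka - arc_shift al' ka| = (q%:R - 1) / pi * `|al - al'|.
  have -> : arc_shift al ka - arc_shift al' ka = (q%:R - 1) / pi * (al - al') by rewrite /arc_shift; ring.
  by rewrite normrM ger0_norm // divr_ge0 //; lra.
have -> : 2 ^+ n.+1 * (2 * V (- (w - arc_eta)) * `|al - al'| + 2 * (2 * arc_lip) * ((q%:R - 1) / pi * `|al - al'|)) =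
  (2 * V (- (w - arc_eta)) + 4 * arc_lip * (q%:R - 1) / pi) * (2 ^+ n.+1 * `|al - al'|) by ring.
have -> : 2 * (2 * arc_lip) / 2 ^+ n = 4 * arc_lip * (1 / 2 ^+ n) by ring.
have a1 : 0 <= 2 ^+ n.+1 * `|al - al'| by rewrite mulr_ge0 // exprn_ge0.
have a2 : 0 <= 1 / 2 ^+ n :> R by rewrite divr_ge0 // exprn_ge0.
have t1 : 0 <= 4 * arc_lip * (q%:R - 1) / pi 
  by apply: divr_ge0; [apply: mulr_ge0; [exact: mulr_ge0|lra]|exact: ltW].
by rewrite [dep_const * _]mulrDr; apply: lerD; apply: ler_wpM2r => //; rewrite /dep_const; lra.
Qed.

(** Ph 1 measures the failure of [Ph] to be periodic. It is continuous in al and changes sign on the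
    admissible interval; clamping the parameter gives a function on the whole line, as continuity
    and the intermediate value theorem want it. *)
Lemma sturmian_param ka : exists al Ph, [/\ arc_eta <= al <= w - arc_eta,
  coh q (arc_shift al ka) (arc_incr al) (2 * arc_lip) Ph & Ph 1 = 0].
Proof.
facts; have [e0 e1] := eta_itv.
pose clamp x : R := Num.max arc_eta (Num.min x (w - arc_eta)).
have cl x : arc_eta <= clamp x <= w - arc_eta.
  rewrite /clamp le_max lexx /= ge_max ge_min lexx orbT andbT; lra.
have /choice[F hF] : forall x, exists Ph, coh q (arc_shift (clamp x) ka) (arc_incr (clamp x)) (2 * arc_lip) Ph.
  by move=> x; exact: coh_arc_exists.
have cE z : z <= arc_eta /\ clamp z = arc_eta \/ (arc_eta <= z <= w - arc_eta /\ clamp z = z \/ w - arc_eta <= z /\ clamp z = w - arc_eta).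
    rewrite /clamp; case: (leP z (w - arc_eta)) => a; [case: (leP arc_eta z) => b|case: (leP arc_eta (w - arc_eta)) => b];
      by first [left; split; lra|right; left; split; lra|right; right; split; lra].
have cl1 x y : `|clamp x - clamp y| <= `|x - y|.
  rewrite ler_norml.
  have h1 := ler_norm (x - y); have h2 := ler_norm (y - x); rewrite distrC in h2.
  have h3 := normr_ge0 (x - y).
  by case: (cE x) => [[? ->]|[[? ->]|[? ->]]]; case: (cE y) => [[? ->]|[[? ->]|[? ->]]]; lra.
have dep x y n : `|F x 1 - F y 1| <= dep_const * (2 ^+ n.+1 * `|x - y| + 1 / 2 ^+ n).
  apply: (le_trans (coh_arc_dep n (cl x) (cl y) (hF x) (hF y))).
  apply: ler_wpM2l; first exact: dep_const_ge0.
  by rewrite lerD2r; apply: ler_wpM2l => //; rewrite exprn_ge0.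
have cont : continuous (fun x => F x 1).
  move=> x; apply/cvgrPdist_le => ep ep0.
  have D0 := dep_const_ge0.
  (* First n makes the tail small, then y is taken so close to x that the factor 2^(n+1) is
     absorbed. *)
  have [n hn] : exists n, dep_const * (2 / 2 ^+ n) <= ep.
    apply/not_existsP => hN.
    have : ep <= 0 by apply: (@le_half_pow0 _ _ (dep_const * 2)) => n; rewrite -mulrA ltW // ltNge; apply/negP.
    lra.
  near=> y.
  apply: (le_trans (dep x y n)); apply: le_trans hn; apply: ler_wpM2l => //.
  have hy : `|x - y| <= (1 / 2 ^+ n) / 2 ^+ n.+1.
    by near: y; apply: cvgr_dist_le; [exact: cvg_id|rewrite !divr_gt0 // exprn_gt0].
  rewrite ler_pdivlMr ?exprn_gt0 // in hy.
  have -> : 2 / 2 ^+ n = 1 / 2 ^+ n + 1 / 2 ^+ n :> R by rewrite -mulrDl.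
  by rewrite lerD2r mulrC.
have ce : clamp arc_eta = arc_eta by case: (cE arc_eta) => [[? ->]|[[? ->]|[? ->]]]; lra.
have cw : clamp (w - arc_eta) = w - arc_eta by case: (cE (w - arc_eta)) => [[? ->]|[[? ->]|[? ->]]]; lra.
have s1 : F arc_eta 1 < 0 by have := hF arc_eta; rewrite ce; exact: coh_end_sign_left.
have s2 : 0 < F (w - arc_eta) 1 by have := hF (w - arc_eta); rewrite cw; exact: coh_end_sign_right.
have [|||c hc e] := @IVT R (fun x => F x 1) arc_eta (w - arc_eta) 0.
- lra.
- exact: continuous_subspaceT.
- by rewrite ge_min le_max (ltW s1) (ltW s2) orbT.
by exists (clamp c), (F c).
Unshelve. all: by end_near.
Qed.

Lemma sturmian_of_coh al ka K Ph : 0 < al < w ->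
  coh q (arc_shift al ka) (arc_incr al) K Ph -> Ph 1 = 0 ->
  sturmian_eq q al ka (LU (- al) + Ph (arc_shift al ka)) (fun x => Ph ((x + ka + q%:R * al) / pi)).
Proof.
facts=> hal C W; have [qp eqn _] := C.
have q1 : q%:R - 1 != 0 :> R by apply: lt0r_neq0; lra.
have Q0 : q%:R != 0 :> R by apply: lt0r_neq0; lra.
have pn : pi != 0 :> R by apply: lt0r_neq0.
have we : w = pi / q%:R by [].
split => //.
- move=> x; have -> : x + pi + ka + q%:R * al = (x + ka + q%:R * al) + pi by ring.
  by rewrite mulrDl divff // qp W addr0.
- move=> x y xy.
  have sl := @coh_slope R q hq _ _ _ _ (w * V (- al)) C (fun u v u0 uv v1 => proj2 (andP (arc_incr_bounds hal u0 uv v1))).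
  have sg := @coh_slope_ge R q hq _ _ _ _ (w * V (w - al)) C (fun u v u0 uv v1 => proj1 (andP (arc_incr_bounds hal u0 uv v1))).
  have dd : (x + ka + q%:R * al) / pi <= (y + ka + q%:R * al) / pi.
    by rewrite ler_pM2r ?invr_gt0 //; lra.
  have h1 := sl _ _ dd; have h2 := sg _ _ dd.
  have e z : w * z * q%:R / (q%:R - 1) * ((y + ka + q%:R * al) / pi - (x + ka + q%:R * al) / pi) = z / (q%:R - 1) * (y - x).
    have -> : w * z * q%:R / (q%:R - 1) * ((y + ka + q%:R * al) / pi - (x + ka + q%:R * al) / pi) =
      z / (q%:R - 1) * (y - x) * (q%:R * w / pi) by ring.
    by rewrite qw divff // mulr1.
  by rewrite !e in h1 h2; rewrite h1 h2.
- move=> t ht.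
  have E := eqn ((t + al) / w).
  have v0 : 0 <= (t + al) / w <= 1.
    by apply/andP; split; [apply: divr_ge0; lra|rewrite ler_pdivrMr //; lra].
  have {}E := E v0.
  have wn : w != 0 by apply: lt0r_neq0.
  have -> : (q%:R * t - ka + ka + q%:R * al) / pi = (t + al) / w.
    have -> : q%:R * t - ka + ka + q%:R * al = q%:R * (t + al) by ring.
    by rewrite -qw -mulf_div divff // mul1r.
  rewrite E /arc_incr.
  have -> : - al + w * ((t + al) / w) = t.
    by rewrite mulrCA divff // mulr1; ring.
  have -> : arc_shift al ka + (t + al) / w / q%:R = (t + ka + q%:R * al) / pi.
    have -> : (t + al) / w / q%:R = (t + al) / pi by rewrite -mulrA -invfM [w * _]mulrC qw.
    by rewrite /arc_shift -mulrDl; congr (_ / pi); ring.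
  ring.
Qed.


Lemma U_addpi n t : U n (t + pi) = - (-1) ^+ n * U n t.
Proof.
have snz k x : sin (x + k%:R * pi) = (-1) ^+ k * sin x /\ cos (x + k%:R * pi) = (-1) ^+ k * cos x.
  elim: k => [|k [IH1 IH2]]; first by rewrite mul0r addr0 expr0 !mul1r.
  by rewrite -natr1 mulrDl mul1r addrA sinDpi cosDpi IH1 IH2 exprS !mulN1r !mulNr.
elim: n => [|n IH] /=; first by rewrite mulr0.
rewrite IH cosDpi mulrDr (snz n _).2 exprS; ring.
Qed.

Lemma U_abs_period n t (m : int) : `|U n (t + m%:~R * pi)| = `|U n t|.
Proof.
have pos k x : `|U n (x + k%:R * pi)| = `|U n x|.
  elim: k => [|k IH]; first by rewrite mul0r addr0.
  by rewrite -natr1 mulrDl mul1r addrA U_addpi normrM normrN normrX normrN1 expr1n mul1r IH.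
case: m => k; first exact: pos.
by rewrite NegzE mulrNz mulNr -[LHS](pos k.+1) subrK.
Qed.

Lemma sin_abs_period t (m : int) : `|sin (t + m%:~R * pi)| = `|sin t|.
Proof.
have pos k x : `|sin (x + k%:R * pi)| = `|sin x|.
  elim: k => [|k IH]; first by rewrite mul0r addr0.
  by rewrite -natr1 mulrDl mul1r addrA sinDpi normrN IH.
case: m => k; first exact: pos.
by rewrite NegzE mulrNz mulNr -[LHS](pos k.+1) subrK.
Qed.

(** Modulo pi every t is t0 + k w with t0 in the half-open arc and k < q, and [core] compares t with
    t0. If k > 0 and sin (q t0) = 0, the kernel vanishes at t. Of the two ties only t0 = - al, k = 1
    survives, and then t is the right end of the arc. *)
Lemma sub_action al ka be P t : sturmian_eq q al ka be P ->
  (exists t0 (m : int), [/\ - al <= t0 <= w - al, t = t0 + m%:~R * pi, U q t != 0 &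
     ln `|U q t| + P t - P (q%:R * t - ka) = be]) \/
  (U q t != 0 -> ln `|U q t| + P t - P (q%:R * t - ka) < be).
Proof.
move=> H; facts; have [hal hper _ heq] := H.
have [t0 [k [m [ht0 kq et]]]] : exists t0 (k : nat) (m : int),
    [/\ - al <= t0 < w - al, (k < q)%N & t = t0 + k%:R * w + m%:~R * pi].
  have [t0 [m [h0 e0]]] := arc_repr hq H (q%:R * t - ka).
  have qz : (q : int) != 0 by rewrite eqz_nat -lt0n (ltn_trans _ hq).
  have qp : 0 < (q : int) by rewrite ltz_nat (ltn_trans _ hq).
  exists t0, `|(m %% q)%Z|%N, (m %/ q)%Z; split => //.
    by rewrite -ltz_nat gez0_abs ?modz_ge0 // ltz_pmod.
  have em : (m%:~R : R) = (m %/ q)%Z%:~R * q%:R + `|(m %% q)%Z|%:R.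
    rewrite {1}(divz_eq m q) intrD intrM; congr (_ + _).
    by rewrite [RHS]pmulrn gez0_abs // modz_ge0.
  have Q0 : q%:R != 0 :> R by apply: lt0r_neq0; lra.
  have e1 : q%:R * t = q%:R * t0 + m%:~R * pi by lra.
  apply: (mulfI Q0); rewrite /= e1 em -qw; ring.
have in_arc s (j : int) : - al <= s <= w - al -> t = s + j%:~R * pi ->
    exists t0 (m : int), [/\ - al <= t0 <= w - al, t = t0 + m%:~R * pi, U q t != 0 &
     ln `|U q t| + P t - P (q%:R * t - ka) = be].
  move=> hs es; have hsw : - w < s < w by lra.
  have us : 0 < U q s := U_gt0 hq hsw.
  exists s, j; split => //.
    by rewrite -normr_eq0 es U_abs_period normr_eq0 gt_eqF.
  have -> : q%:R * t - ka = q%:R * s - ka + (q%:Z * j)%:~R * pi by rewrite es intrM; ring.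
  rewrite (periodZ hq H) heq // es U_abs_period (periodZ hq H) -(LU_abs hq hsw).
  ring.
have [k0|k0] := posnP k.
  by left; apply: (in_arc t0 m); [lra|rewrite et k0; ring].
have [sz|snz] := eqVneq (sin (q%:R * t0)) 0.
  right => /negP; case.
  have : `|U q t * sin t| = 0.
    rewrite U_sin et; have -> : q%:R * (t0 + k%:R * w + m%:~R * pi) = q%:R * t0 + (k%:Z + q%:Z * m)%:~R * pi.
      by rewrite intrD intrM -qw; ring.
    by rewrite sin_abs_period sz normr0.
  move/eqP; rewrite normr_eq0 mulf_eq0 => /orP[//|]; rewrite -normr_eq0 et sin_abs_period normr_eq0.
  have kw : w <= k%:R * w by apply: ler_peMl; [exact: ltW|rewrite ler1n].
  have kw2 : k%:R * w <= pi - w.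
    have : (k%:R + 1) * w <= q%:R * w by rewrite ler_pM2r // natr1 ler_nat.
    by rewrite qw; lra.
  by rewrite gt_eqF // sin_gt0_pi //; lra.
have ht0' : - al <= t0 <= w - al by lra.
have hk : (0 < k < q)%N by rewrite k0 kq.
have [[e1 e2]|[e1 e2]|lt] := core hq H ht0' hk snz.
- left; apply: (in_arc (w - al) m); first lra.
  by rewrite et e1 e2 mul1r; ring.
- by move: ht0; rewrite e1; lra.
right => u0.
have eq : q%:R * t - ka = q%:R * t0 - ka + (k%:Z + q%:Z * m)%:~R * pi by rewrite et intrD intrM -qw; ring.
rewrite eq (periodZ hq H) heq; last lra.
have sqt : `|sin (q%:R * t)| = `|sin (q%:R * t0)|.
  have -> : q%:R * t = q%:R * t0 + (k%:Z + q%:Z * m)%:~R * pi by rewrite et intrD intrM -qw; ring.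
  exact: sin_abs_period.
have snt : sin (q%:R * t) != 0 by rewrite -normr_eq0 sqt normr_eq0.
rewrite lnU_abs // sqt (LU_abs hq); last lra.
rewrite lnU_abs // et (periodZ hq H) sin_abs_period.
by lra.
Qed.

End Arcs.

(** * The sub-action in the coordinate x on R / Z *)

Section SubAction.
Variables (R : realType) (q : nat) (hq : (2 <= q)%N).
Implicit Types (c ga be x y : R) (psi : R -> R).
Notation w := (omega R q).
Notation LU := (@logU R q).
Notation V := (@dlogU R q).

Lemma dirichlet_absE y : dirichlet_abs q y = `|U q (pi * y)|.
Proof.
rewrite /dirichlet_abs; case: eqVneq => [s0|s0]; last first.
  by rewrite -[q%:R * pi * y]mulrA -U_sin mulfK.
have e : pi * y = pi * frac y + (Num.floor y)%:~R * pi.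
  by rewrite {1}[y]floorD_frac; ring.
have /andP[f0 f1] := frac_itv y.
have fz : frac y = 0.
  apply/eqP; move: f0; rewrite le_eqVlt eq_sym => /predU1P[-> //|fp].
  have p0 := @pi_gt0 R.
  have : 0 < sin (pi * frac y).
    by apply: sin_gt0_pi; rewrite mulr_gt0 //= -[X in _ < X]mulr1 ltr_pM2l.
  have : `|sin (pi * frac y)| = 0 by rewrite -(sin_abs_period _ (Num.floor y)) -e s0 normr0.
  by move/eqP; rewrite normr_eq0 => /eqP ->; rewrite ltxx.
by rewrite e U_abs_period fz mulr0 U0 ger0_norm.
Qed.

Lemma dirichlet_abs_le y : dirichlet_abs q y <= q%:R.
Proof. by rewrite dirichlet_absE; apply: U_abs_le; apply: ltn_trans hq. Qed.

Lemma dirichlet_abs_ge0 y : 0 <= dirichlet_abs q y.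
Proof. by rewrite dirichlet_absE. Qed.

Definition subaction c ga be psi : Prop :=
  [/\ (forall x, psi (x + 1) = psi x),
      (exists L, 0 <= L /\ forall x y, `|psi x - psi y| <= L * `|x - y|),
      (forall x, frac (x - ga) <= q%:R^-1 -> dirichlet_abs q (x + c) != 0 /\
        ln (dirichlet_abs q (x + c)) + psi x - psi (q%:R * x) = be) &
      (forall x, q%:R^-1 < frac (x - ga) -> dirichlet_abs q (x + c) != 0 ->
        ln (dirichlet_abs q (x + c)) + psi x - psi (q%:R * x) < be)].

(** The left end t = - al in the coordinate x given by t = pi (x + c). *)
Definition arc_start c (al : R) : R := - al / pi - c.

(** The value of ka comes from pi (q x + c) = q (pi (x + c)) - pi (q - 1) c. *)
Lemma subaction_of_sturmian c al be P :
  sturmian_eq q al (pi * (q%:R - 1) * c) be P ->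
  subaction c (arc_start c al) be (fun x => P (pi * (x + c))).
Proof.
move=> H; have [hal hper hsl _] := H.
have p0 := @pi_gt0 R; have w0 := omega_gt0 R hq; have Q := q_gt0 R hq.
have qw := q_omega R hq.
have qx x : pi * (q%:R * x + c) = q%:R * (pi * (x + c)) - pi * (q%:R - 1) * c by ring.
have inarc x : frac (x - arc_start c al) <= q%:R^-1 <->
    exists t0 (m : int), - al <= t0 <= w - al /\ pi * (x + c) = t0 + m%:~R * pi.
  have pd : pi * (al / pi) = al by rewrite mulrC divfK // gt_eqF.
  have e : pi * (x + c) = pi * (x - arc_start c al) - al.
    rewrite /arc_start; have -> : pi * (x - (- al / pi - c)) = pi * (x + c) + pi * (al / pi) by ring.
    by rewrite pd addrK.
  split=> [h|[t0 [m [h1 h2]]]].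
    exists (pi * frac (x - arc_start c al) - al), (Num.floor (x - arc_start c al)); split.
      have /andP[f0 _] := frac_itv (x - arc_start c al).
      have a1 : 0 <= pi * frac (x - arc_start c al) by rewrite mulr_ge0 // ltW.
      have a2 : pi * frac (x - arc_start c al) <= w by rewrite -/(pi / q%:R) ler_pM2l.
      lra.
    by rewrite e {1}[x - _]floorD_frac; ring.
  have E : x - arc_start c al = m%:~R + (t0 + al) / pi.
    have pn := lt0r_neq0 p0.
    have h : pi * (x - arc_start c al) = pi * (m%:~R + (t0 + al) / pi).
      by rewrite [RHS]mulrDr [pi * ((t0 + al) / pi)]mulrC divfK //; lra.
    exact: (mulfI pn h).
  have q2 : q%:R^-1 < 1 :> R by rewrite invf_lt1 // ltr1n.
  have hv : 0 <= (t0 + al) / pi <= q%:R^-1.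
    apply/andP; split; first by apply: divr_ge0; lra.
    rewrite ler_pdivrMr // mulrC; have -> : pi / q%:R = w by []. lra.
  rewrite E addrC fracDz frac_id; lra.
split.
- move=> x; have -> : pi * (x + 1 + c) = pi * (x + c) + pi by ring.
  exact: hper.
- pose A := V (w - al) / (q%:R - 1); pose B := V (- al) / (q%:R - 1).
  have M0 : 0 <= `|A| + `|B| by rewrite addr_ge0.
  exists ((`|A| + `|B|) * pi); split; first by rewrite mulr_ge0 // ltW.
  have hl x y : x <= y -> `|P y - P x| <= (`|A| + `|B|) * (y - x).
    move=> xy; have /andP[h1 h2] := hsl x y xy; rewrite -/A -/B in h1 h2.
    have y0 : 0 <= y - x by rewrite subr_ge0.
    have k1 : - `|A| * (y - x) <= A * (y - x) by apply: ler_wpM2r => //; have := ler_norm (- A); rewrite normrN; lra.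
    have k2 : B * (y - x) <= `|B| * (y - x) by apply: ler_wpM2r => //; exact: ler_norm.
    have k3 : 0 <= `|A| * (y - x) by rewrite mulr_ge0.
    have k4 : 0 <= `|B| * (y - x) by rewrite mulr_ge0.
    by rewrite ler_norml; rewrite mulNr in k1; lra.
  move=> x y; wlog xy : x y / y <= x.
    by move=> W; case: (leP y x) => [|/ltW] h; [exact: W|rewrite distrC [`|x - y|]distrC; exact: W].
  have d : pi * (y + c) <= pi * (x + c) by rewrite ler_pM2l // lerD2r.
  have := hl _ _ d; have -> : pi * (x + c) - pi * (y + c) = pi * (x - y) by ring.
  by rewrite (ger0_norm (_ : 0 <= x - y)) ?subr_ge0 // mulrA.
- move=> x /inarc [t0 [m [h1 h2]]]; rewrite dirichlet_absE qx.
  have [[s [j [k1 k2 k3 k4]]]|k] := sub_action hq (pi * (x + c)) H.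
    by rewrite normr_eq0.
  have hsw : - w < t0 < w by lra.
  have us : 0 < U q t0 := U_gt0 hq hsw.
  have un : U q (pi * (x + c)) != 0 by rewrite -normr_eq0 h2 U_abs_period normr_eq0 gt_eqF.
  move: (k un).
  have [_ _ _ heq] := H.
  have E : q%:R * (pi * (x + c)) - pi * (q%:R - 1) * c = q%:R * t0 - pi * (q%:R - 1) * c + (q%:Z * m)%:~R * pi.
    by rewrite h2 intrM; ring.
  rewrite E (periodZ hq H) (heq _ h1) h2 U_abs_period (periodZ hq H) -(LU_abs hq hsw); lra.
- move=> x hx; rewrite dirichlet_absE qx normr_eq0 => un.
  have [[s [j [k1 k2 k3 k4]]]|k] := sub_action hq (pi * (x + c)) H; last exact: k.
  have : frac (x - arc_start c al) <= q%:R^-1 by apply/inarc; exists s, j.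
  by rewrite leNgt hx.
Qed.

Lemma subaction_bounded c ga be psi : subaction c ga be psi ->
  exists M, 0 <= M /\ forall x, `|psi x| <= M.
Proof.
move=> [per [L [L0 lip]] _ _].
have perZ (m : int) x : psi (x + m%:~R) = psi x.
  have pos (n : nat) y : psi (y + n%:R) = psi y.
    by elim: n => [|n IH]; rewrite ?addr0 // -natr1 addrA per.
  case: m => n; first exact: pos.
  by rewrite NegzE mulrNz -[LHS](pos n.+1) subrK.
exists (L + `|psi 0|); split; first by rewrite addr_ge0.
move=> x; rewrite [x]floorD_frac addrC perZ.
have /andP[f0 f1] := frac_itv x.
have -> : psi (frac x) = (psi (frac x) - psi 0) + psi 0 by ring.
apply: (le_trans (ler_normD _ _)); rewrite lerD2r; apply: (le_trans (lip _ _)).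
by rewrite subr0 (ger0_norm f0) ler_piMr // ltW.
Qed.

Lemma subaction_perZ c ga be psi : subaction c ga be psi -> forall x (m : int), psi (x + m%:~R) = psi x.
Proof.
move=> [per _ _ _] x m.
have pos (n : nat) y : psi (y + n%:R) = psi y.
  by elim: n => [|n IH]; rewrite ?addr0 // -natr1 addrA per.
case: m => n; first exact: pos.
by rewrite NegzE mulrNz -[LHS](pos n.+1) subrK.
Qed.

(* Every point has a preimage at which the kernel is at least 1 / sin (w / 2) > 1; evaluate the
   sub-action inequality there and take the infimum of psi. *)
Lemma subaction_value_gt0 c ga be psi : subaction c ga be psi -> 0 < be.
Proof.
move=> H; have [per _ H1 H2] := H; have [M [M0 hM]] := subaction_bounded H.
have p0 := @pi_gt0 R; have w0 := omega_gt0 R hq; have Q := q_gt0 R hq.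
have wp := omega_le R hq; have pl := @pi_lt R.
pose lam : R := LU (w / 2).
have hw2 : - w < w / 2 < w by lra.
have s0 : 0 < sin (w / 2) by apply: (sin_gt0_omega hq); lra.
have lam0 : 0 < lam.
  have e : U q (w / 2) * sin (w / 2) = 1.
    rewrite U_sin; have -> : q%:R * (w / 2) = pi / 2 by rewrite mulrA q_omega.
    by rewrite sin_pihalf.
  apply: ln_gt0; have := U_gt0 hq hw2; have s1 : sin (w / 2) <= w / 2 by apply: sin_le; lra.
  by move=> u0; rewrite -(ltr_pM2r s0) mul1r e; lra.
have key y : exists x, psi x <= psi y + be - lam.
  pose j : int := Num.floor (y + q%:R * c + 1 / 2).
  have /andP[j1 j2] := floor_itv (y + q%:R * c + 1 / 2); rewrite -/j intrD in j1 j2.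
  pose x := (y - j%:~R) / q%:R.
  have qx : q%:R * x = y + (- j)%:~R by rewrite /x mulrC divfK ?gt_eqF // mulrNz.
  have te : pi * (x + c) = w * (y + q%:R * c - j%:~R).
    by rewrite -(q_omega R hq) /x; field; rewrite gt_eqF.
  set z := y + q%:R * c - j%:~R in te.
  have hz : - (1 / 2) <= z <= 1 / 2 by rewrite /z; lra.
  have ht : - (w / 2) <= w * z <= w / 2.
    have a1 : w * z <= w * (1 / 2) by rewrite ler_pM2l //; lra.
    have a2 : w * - (1 / 2) <= w * z by rewrite ler_pM2l //; lra.
    by clear -a1 a2; lra.
  have htw : - w < w * z < w by clear -ht w0; lra.
  have lU : lam <= LU (w * z).
    have aux t : 0 <= t <= w / 2 -> lam <= LU t.
      move=> h.
      have /andP[h1 h2] : V (w / 2) * (w / 2 - t) <= LU (w / 2) - LU t <= V t * (w / 2 - t).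
        by apply: LU_bounds => //; clear -h w0; lra.
      have v0 : V t <= 0.
        have e0 : V 0 = 0 by rewrite /dlogU dU0 mul0r.
        by rewrite -e0; apply: V_nincr => //; clear -h w0; lra.
      have : V t * (w / 2 - t) <= 0 by apply: mulr_le0_ge0 => //; clear -h; lra.
      by rewrite /lam; lra.
    case: (leP 0 (w * z)) => hs; first by apply: aux; clear -hs ht; lra.
    by rewrite -LUN; apply: aux; clear -hs ht; lra.
  exists x.
  have un : dirichlet_abs q (x + c) != 0 by rewrite dirichlet_absE te normr_eq0 gt_eqF // U_gt0.
  have I : ln (dirichlet_abs q (x + c)) + psi x - psi (q%:R * x) <= be.
    by case: (leP (frac (x - ga)) q%:R^-1) => hx; [have [_ ->] := H1 x hx|apply/ltW/H2].
  rewrite qx (subaction_perZ H) dirichlet_absE te -LU_abs // in I.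
  by lra.
have ne : range psi !=set0 by exists (psi 0), 0.
have lb : has_lbound (range psi) by exists (- M) => _ [x _ <-]; have := hM x; rewrite ler_norml => /andP[].
have h : inf (range psi) - be + lam <= inf (range psi).
  apply: lb_le_inf ne _ => _ [y _ <-]; have [x hx] := key y.
  have : inf (range psi) <= psi x by apply: ge_inf => //; exists x.
  by clear -hx; lra.
by clear -h lam0; lra.
Qed.

End SubAction.

(** * The collapsed circle map and its semiconjugacy with a rotation *)

Section CircleMap.
Variables (R : realType) (q : nat) (hq : (2 <= q)%N) (ga : R).
Implicit Types (x y u th : R).

(* The degree-one circle map that is x |-> q x on the arc [ga, ga + 1/q] and constant on the complementary gap. *)
Definition cmap x : R := q%:R * ga + (Num.floor (x - ga))%:~R + Num.min (q%:R * frac (x - ga)) 1.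

Let Q := q_gt0 R hq.
Let Q2 := q_ge2 R hq.

Lemma cmap_def x (j : int) u : 0 <= u <= 1 -> x = ga + j%:~R + u ->
  cmap x = q%:R * ga + j%:~R + Num.min (q%:R * u) 1.
Proof.
have Q' := Q; have Q2' := Q2.
move=> /andP[u0]; rewrite le_eqVlt => /predU1P[-> | u1] e.
  have [fl fr] := @frac_eq R (x - ga) (j + 1) 0 ltac:(by rewrite lexx ltr01) ltac:(by rewrite e intrD; ring).
  rewrite /cmap fl fr mulr0 mulr1 minEle ler01 minEle leNgt (_ : 1 < q%:R) ?ltr1n //= intrD; ring.
have [fl fr] := @frac_eq R (x - ga) j u ltac:(by rewrite u0 u1) ltac:(by rewrite e; ring).
by rewrite /cmap fl fr.
Qed.

Lemma cmapD1 x : cmap (x + 1) = cmap x + 1.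
Proof.
have e : x + 1 - ga = x - ga + 1%:~R by ring.
by rewrite /cmap e fracDz floorDrz ?num_real // floor1 intrD; ring.
Qed.

Lemma cmap_arc x : frac (x - ga) <= q%:R^-1 -> cmap x = q%:R * x - (q%:R - 1) * (Num.floor (x - ga))%:~R.
Proof.
have Q' := Q.
move=> h; have h1 : q%:R * frac (x - ga) <= 1 by rewrite -ler_pdivlMl // mulr1.
rewrite /cmap minEle h1.
have Z := floorD_frac (x - ga).
have -> : q%:R * x = q%:R * (ga + ((Num.floor (x - ga))%:~R + frac (x - ga))) by rewrite -Z; ring.
ring.
Qed.

Lemma cmap_gap x (j : int) : ga + j%:~R + q%:R^-1 <= x <= ga + j%:~R + 1 ->
  cmap x = q%:R * ga + j%:~R + 1.
Proof.
have Q' := Q.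
move=> hx; have qi : 0 < q%:R^-1 :> R by rewrite invr_gt0.
rewrite (@cmap_def x j (x - ga - j%:~R)); [|lra|ring].
congr (_ + _); apply/min_idPr; rewrite -ler_pdivrMl // mulr1; lra.
Qed.

Lemma cmap_lip x y : x <= y -> 0 <= cmap y - cmap x <= q%:R * (y - x).
Proof.
have Q' := Q; have Q2' := Q2.
have qp : quasiper (fun v => cmap (ga + v) - cmap ga).
  by move=> v; rewrite addrA !cmapD1; ring.
move=> xy.
have loc u v : 0 <= u -> u <= v -> v <= 1 -> 0 <= cmap (ga + v) - cmap (ga + u) <= q%:R * (v - u).
  move=> u0 uv v1.
  rewrite (@cmap_def (ga + u) 0 u) ?(@cmap_def (ga + v) 0 v); [|lra|by rewrite addr0|lra|by rewrite addr0].
  have i1 : q%:R * u <= q%:R * v by rewrite ler_pM2l.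
  have E : q%:R * (v - u) = q%:R * v - q%:R * u by ring.
  by rewrite E; case: (leP (q%:R * u) 1) => h1; case: (leP (q%:R * v) 1) => h2; lra.
have xy' : x - ga <= y - ga by rewrite lerD2r.
have up := @quasiper_slope R _ q%:R qp; have qn : quasiper (fun v => - (cmap (ga + v) - cmap ga)).
  by move=> v; rewrite addrA !cmapD1; ring.
have dn := @quasiper_slope R _ 0 qn.
have {}up := up ltac:(move=> u v u0 uv v1; have := loc u v u0 uv v1; lra) _ _ xy'.
have {}dn := dn ltac:(move=> u v u0 uv v1; have := loc u v u0 uv v1; lra) _ _ xy'.
have e1 : ga + (x - ga) = x by ring.
have e2 : ga + (y - ga) = y by ring.
have e3 : y - ga - (x - ga) = y - x by ring.
rewrite e1 e2 e3 mul0r in up dn.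
apply/andP; split.
  lra.
lra.
Qed.

Lemma cmap_mono x y : x <= y -> cmap x <= cmap y.
Proof. by move=> /cmap_lip /andP[h _]; rewrite -subr_ge0. Qed.

Lemma cmap_surj y : exists x, cmap x = y.
Proof.
have Q' := Q; have Q2' := Q2.
have /andP[f0 f1] := frac_itv (y - q%:R * ga).
set s := frac _ in f0 f1; set j := Num.floor (y - q%:R * ga).
exists (ga + j%:~R + s / q%:R).
have s1 : s / q%:R <= s by rewrite ler_piMr // invf_le1 //; lra.
have s0 : 0 <= s / q%:R by rewrite divr_ge0 // ltW.
rewrite (@cmap_def _ j (s / q%:R)) //; last by rewrite s0; lra.
have -> : q%:R * (s / q%:R) = s by rewrite mulrC divfK ?gt_eqF.
have -> : Num.min s 1 = s by apply/min_idPl; exact: ltW.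
by have := floorD_frac (y - q%:R * ga); rewrite -/s -/j; lra.
Qed.

Lemma cmap_iterD1 n x : iter n cmap (x + 1) = iter n cmap x + 1.
Proof. by elim: n => [//|n IH]; rewrite !iterS IH cmapD1. Qed.

Lemma cmap_iterDz n x (m : int) : iter n cmap (x + m%:~R) = iter n cmap x + m%:~R.
Proof.
have pos (k : nat) y : iter n cmap (y + k%:R) = iter n cmap y + k%:R.
  by elim: k => [|k IH]; rewrite ?addr0 // -natr1 !addrA cmap_iterD1 IH.
case: m => k; first exact: pos.
by rewrite NegzE mulrNz; have := pos k.+1 (x - k.+1%:R); rewrite subrK => ->; rewrite addrK.
Qed.

Lemma cmap_iter_mono n x y : x <= y -> iter n cmap x <= iter n cmap y.
Proof. by move=> xy; elim: n => [//|n IH]; rewrite !iterS cmap_mono. Qed.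

Lemma cmap_disp n x y : `|(iter n cmap x - x) - (iter n cmap y - y)| <= 1.
Proof.
have e : x = (y + frac (x - y)) + (Num.floor (x - y))%:~R by have := floorD_frac (x - y); lra.
have /andP[f0 f1] := frac_itv (x - y).
rewrite {1 2}e cmap_iterDz.
have h1 := cmap_iter_mono n (_ : y <= y + frac (x - y)).
have h2 := cmap_iter_mono n (_ : y + frac (x - y) <= y + 1).
rewrite cmap_iterD1 in h2.
have {}h1 := h1 ltac:(lra); have {}h2 := h2 ltac:(lra).
by rewrite ler_norml; lra.
Qed.

(** Estimating a (m n) in two ways shows that every (a n - 1) / n is at most every (a m + 1) / m;
    rho is a number separating the two families. *)
Lemma quasi_additive (a : nat -> R) : (forall m n, `|a (m + n)%N - a m - a n| <= 1) ->
  exists rho, forall n, `|a n - n%:R * rho| <= 1.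
Proof.
move=> ha.
have mul m n : (0 < m)%N -> m%:R * a n - (m%:R - 1) <= a (m * n)%N <= m%:R * a n + (m%:R - 1).
  elim: m => // -[|m] IH _; first by rewrite mul1n mul1r subrr addr0 subr0 lexx.
  have {IH} := IH isT; rewrite mulSn; have := ha n (m.+1 * n)%N.
  by rewrite -[m.+2%:R]natr1 mulrDl mul1r ler_norml; lra.
have cross m n : (0 < m)%N -> (0 < n)%N -> (a n - 1) / n%:R <= (a m + 1) / m%:R.
  move=> m0 n0; rewrite ler_pdivrMr ?ltr0n // mulrAC ler_pdivlMr ?ltr0n //.
  have h1 := mul m n m0; have h2 := mul n m n0; rewrite mulnC in h2; lra.
pose E := [set (a n.+1 - 1) / n.+1%:R | n in [set: nat]].
have ne : E !=set0 by exists ((a 1 - 1) / 1%:R), 0.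
exists (sup E) => -[|n].
  by have := ha 0 0; rewrite addn0 subrr sub0r normrN mul0r subr0.
have h1 : (a n.+1 - 1) / n.+1%:R <= sup E.
  apply: ub_le_sup; last by exists n.
  by exists ((a 1 + 1) / 1%:R) => _ [k _ <-]; exact: cross.
have h2 : sup E <= (a n.+1 + 1) / n.+1%:R.
  by apply: ge_sup => // _ [k _ <-]; exact: cross.
have n0 : 0 < n.+1%:R :> R by rewrite ltr0n.
rewrite ler_pdivrMr // in h1; rewrite ler_pdivlMr // in h2.
by rewrite ler_norml [n.+1%:R * _]mulrC; lra.
Qed.

Lemma cmap_rotation : exists rho, forall n x, `|iter n cmap x - x - n%:R * rho| <= 2.
Proof.
have [|rho hr] := @quasi_additive (fun n => iter n cmap 0).
  move=> m n; rewrite iterD; have := cmap_disp m (iter n cmap 0) 0; rewrite subr0.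
  by congr (`|_| <= 1); ring.
exists rho => n x; have := hr n; have := cmap_disp n x 0.
by rewrite subr0 !ler_norml; lra.
Qed.

Section Semiconjugacy.
Variables (rho : R) (Hrot : forall n x, `|iter n cmap x - x - n%:R * rho| <= 2).

(* The points whose orbit stays asymptotically to the left of th + n rho; membership depends only on the tail of the
   orbit, so the supremum cannot lie in the interior of a gap. *)
Definition conj_set th : set R :=
  [set x | forall e, 0 < e -> exists N, forall n, (N <= n)%N -> iter n cmap x <= th + n%:R * rho + e].
Definition conj_map th := sup (conj_set th).

Lemma conj_set_down th x y : x <= y -> conj_set th y -> conj_set th x.
Proof.
move=> xy hy e e0; have [N hN] := hy e e0; exists N => n Nn.
exact: le_trans (cmap_iter_mono n xy) (hN n Nn).
Qed.

Lemma conj_set_low th : conj_set th (th - 2).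
Proof.
by move=> e e0; exists 0%N => n _; have := Hrot n (th - 2); rewrite ler_norml; lra.
Qed.

Lemma conj_set_ub th : ubound (conj_set th) (th + 3).
Proof.
move=> x hx; have [N hN] := hx 1 ltr01; have := hN N (leqnn N).
by have := Hrot N x; rewrite ler_norml; lra.
Qed.

Lemma conj_has_sup th : has_sup (conj_set th).
Proof. by split; [exists (th - 2); exact: conj_set_low|exists (th + 3); exact: conj_set_ub]. Qed.

Lemma conj_set_le th x : conj_set th x -> x <= conj_map th.
Proof. by move=> hx; apply: ub_le_sup => //; case: (conj_has_sup th). Qed.

Lemma conj_set_lt th x : x < conj_map th -> conj_set th x.
Proof.
move=> hx; have [|y hy hxy] := @sup_adherent R (conj_set th) (conj_map th - x) _ (conj_has_sup th).
  by rewrite subr_gt0.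
by apply: conj_set_down hy; rewrite ltW //; move: hxy; rewrite /conj_map; lra.
Qed.

Lemma conj_map_mono th th' : th <= th' -> conj_map th <= conj_map th'.
Proof.
move=> h; apply: ge_sup; first by case: (conj_has_sup th).
move=> x hx; apply: conj_set_le => e e0; have [N hN] := hx e e0; exists N => n Nn.
by apply: (le_trans (hN n Nn)); rewrite !lerD2r.
Qed.

Lemma conj_mapD1 th : conj_map (th + 1) = conj_map th + 1.
Proof.
have shift t x : conj_set t x -> conj_set (t + 1) (x + 1).
  move=> hx e e0; have [N hN] := hx e e0; exists N => n Nn.
  by rewrite cmap_iterD1; have := hN n Nn; lra.
have shift' t x : conj_set (t + 1) x -> conj_set t (x - 1).
  move=> hx e e0; have [N hN] := hx e e0; exists N => n Nn.
  by have := cmap_iterD1 n (x - 1); rewrite subrK => h; have := hN n Nn; rewrite h; lra.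
apply/eqP; rewrite eq_le; apply/andP; split.
  apply: ge_sup; first by case: (conj_has_sup (th + 1)).
  by move=> x /shift' /conj_set_le; lra.
rewrite -lerBrDr; apply: ge_sup; first by case: (conj_has_sup th).
by move=> x /shift /conj_set_le; lra.
Qed.

Lemma conj_set_cmap th x : conj_set th x <-> conj_set (th + rho) (cmap x).
Proof.
split=> hx e e0; have [N hN] := hx e e0.
  exists N => n Nn; rewrite -iterSr; have := hN n.+1 (leqW Nn); rewrite -natr1; lra.
exists N.+1 => -[//|n] Nn; rewrite iterSr; have := hN n Nn; rewrite -natr1; lra.
Qed.

(** The supremum need not belong to [conj_set]. One inequality therefore uses points just to its
    left and the Lipschitz bound; the other lifts points through the surjectivity of [cmap]. *)
Lemma cmap_conj th : cmap (conj_map th) = conj_map (th + rho).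
Proof.
have Q' := Q.
apply/eqP; rewrite eq_le; apply/andP; split; last first.
  apply: ge_sup; first by case: (conj_has_sup (th + rho)).
  move=> y; have [x <-] := cmap_surj y => /(proj2 (conj_set_cmap th x)) /conj_set_le; exact: cmap_mono.
apply/ler_addgt0Pr => e e0.
have hx : conj_map th - e / q%:R < conj_map th by rewrite ltrBlDr ltrDl divr_gt0.
have := conj_set_le (proj1 (conj_set_cmap _ _) (conj_set_lt hx)).
have /andP[_] := cmap_lip (ltW hx).
have -> : q%:R * (conj_map th - (conj_map th - e / q%:R)) = e by field; rewrite gt_eqF.
lra.
Qed.

Lemma conj_map_arc th : frac (conj_map th - ga) <= q%:R^-1.
Proof.
have Q' := Q; rewrite leNgt; apply/negP => hu.
have /andP[u0 u1] := frac_itv (conj_map th - ga).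
have E := floorD_frac (conj_map th - ga).
set u := frac _ in hu u0 u1 E; set j := Num.floor _ in E.
have y1 : conj_set th (ga + j%:~R + (u + q%:R^-1) / 2) by apply: conj_set_lt; lra.
have y2 : conj_set th (ga + j%:~R + (u + 1) / 2).
  move=> e e0; have [N hN] := y1 e e0; exists N.+1 => -[//|n] Nn.
  have := hN n.+1 (leqW Nn); rewrite !iterSr.
  rewrite (@cmap_gap (ga + j%:~R + (u + q%:R^-1) / 2) j); last lra.
  by rewrite (@cmap_gap (ga + j%:~R + (u + 1) / 2) j) //; lra.
by have := conj_set_le y2; lra.
Qed.

End Semiconjugacy.

End CircleMap.

(** * Maximizing measures *)

Section Expectation.
Variables (R : realType) (nu : {measure set R -> \bar R}).
Hypothesis nu1 : nu setT = 1%E.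
Implicit Types (f g : R -> R).

Definition bmf f : Prop := measurable_fun setT f /\ exists M, forall x, `|f x| <= M.
Definition Ex f : R := \int[nu]_(x in setT) f x.

Lemma bmf_integrable f : bmf f -> nu.-integrable setT (EFin \o f).
Proof.
move=> [mf [M hM]]; apply: measurable_bounded_integrable => //.
  by rewrite nu1 ltry.
exists M; split; first exact: num_real.
by move=> y My x _; apply: (le_trans (hM x)); exact: ltW.
Qed.

Lemma bmf_cst (k : R) : bmf (fun=> k).
Proof. by split; [exact: measurable_cst|exists `|k|]. Qed.

Lemma bmfD f g : bmf f -> bmf g -> bmf (fun x => f x + g x).
Proof.
move=> [mf [M hM]] [mg [N hN]]; split; first exact: measurable_funD.
by exists (M + N) => x; apply: (le_trans (ler_normD _ _)); exact: lerD.
Qed.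

Lemma bmfN f : bmf f -> bmf (fun x => - f x).
Proof.
move=> [mf [M hM]]; split; first exact: measurableT_comp.
by exists M => x; rewrite normrN.
Qed.

Lemma bmfB f g : bmf f -> bmf g -> bmf (fun x => f x - g x).
Proof. by move=> hf hg; apply: bmfD => //; exact: bmfN. Qed.

Lemma bmfZ (k : R) f : bmf f -> bmf (fun x => k * f x).
Proof.
move=> [mf [M hM]]; split; first exact: measurable_funM.
by exists (`|k| * M) => x; rewrite normrM ler_wpM2l.
Qed.

Lemma bmf_comp f (t : R -> R) : measurable_fun setT t -> bmf f -> bmf (fun x => f (t x)).
Proof.
move=> mt [mf [M hM]]; split; last by exists M.
exact: (measurableT_comp mf mt).
Qed.

Lemma Ex_cst (k : R) : Ex (fun=> k) = k.
Proof. by rewrite /Ex Rintegral_cst // nu1 mulr1. Qed.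

Lemma ExD f g : bmf f -> bmf g -> Ex (fun x => f x + g x) = Ex f + Ex g.
Proof. by move=> hf hg; rewrite /Ex RintegralD //; exact: bmf_integrable. Qed.

Lemma ExB f g : bmf f -> bmf g -> Ex (fun x => f x - g x) = Ex f - Ex g.
Proof. by move=> hf hg; rewrite /Ex RintegralB //; exact: bmf_integrable. Qed.

Lemma ExZ (k : R) f : bmf f -> Ex (fun x => k * f x) = k * Ex f.
Proof. by move=> hf; rewrite /Ex RintegralZl //; exact: bmf_integrable. Qed.

Lemma Ex_le f g : bmf f -> bmf g -> (forall x, f x <= g x) -> Ex f <= Ex g.
Proof. by move=> hf hg h; apply: le_Rintegral => //; exact: bmf_integrable. Qed.

Lemma Ex_EFin f : bmf f -> (\int[nu]_x (f x)%:E)%E = (Ex f)%:E.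
Proof.
move=> hf; rewrite /Ex /Rintegral fineK //; apply: integrable_fin_num => //.
exact: bmf_integrable.
Qed.

Lemma Ex_bound f M : bmf f -> (forall x, `|f x| <= M) -> `|Ex f| <= M.
Proof.
move=> hf h; rewrite ler_norml -{1}(Ex_cst (- M)) -{2}(Ex_cst M).
by apply/andP; split; apply: Ex_le => //; try exact: bmf_cst; move=> x; have := h x; rewrite ler_norml => /andP[].
Qed.

Lemma Ex_ae f g (N : set R) : bmf f -> bmf g -> measurable N -> nu N = 0%E ->
  (forall x, ~ N x -> f x = g x) -> Ex f = Ex g.
Proof.
move=> [mf hf] [mg hg] mN N0 h; rewrite /Ex /Rintegral; congr fine.
apply: ae_eq_integral => //; try exact/measurable_EFinP.
exists N; split => // x /= hx; apply: contrapT => nx; apply: hx => _.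
by rewrite /= h.
Qed.

End Expectation.

Section Invariance.
Variables (R : realType) (q : nat) (hq : (2 <= q)%N).
Implicit Types (nu mu : {measure set R -> \bar R}) (f : R -> R) (A : set R).
Notation torus := (@torus R).

Lemma measurable_floorR : measurable_fun setT (fun x : R => (Num.floor x)%:~R : R).
Proof.
by apply: nondecreasing_measurable => // x y xy; rewrite ler_int le_floor.
Qed.

Lemma measurable_frac : measurable_fun setT (@Defs.frac R).
Proof. apply: measurable_funB => //; exact: measurable_floorR. Qed.

Lemma measurable_Tmap : measurable_fun setT (Tmap q : R -> R).
Proof.
apply: (measurableT_comp measurable_frac); apply: measurable_funM => //.
Qed.

Lemma torus_itv : torus = `[0, 1[%classic.
Proof. by apply/seteqP; split => x /=; rewrite in_itv. Qed.

Lemma measurable_torus : measurable torus.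
Proof. by rewrite torus_itv. Qed.

Lemma torus_frac (x : R) : torus (frac x). Proof. exact: frac_itv. Qed.

Lemma measure_torusI nu A : nu (~` torus) = 0%E -> measurable A -> nu (torus `&` A) = nu A.
Proof.
move=> n0 mA; have mT := measurable_torus.
apply/eqP; rewrite eq_le; apply/andP; split.
  by apply: le_measure; rewrite ?inE //; try exact: measurableI; exact: subIsetr.
have eA : (torus `&` A) `|` (~` torus `&` A) = A by rewrite -setIUl setUv setTI.
have mI : measurable (torus `&` A) by exact: measurableI.
have mI2 : measurable (~` torus `&` A) by apply: measurableI => //; exact: measurableC.
have := measureU2 nu mI mI2; rewrite eA => /le_trans; apply.
have : (nu (~` torus `&` A) <= nu (~` torus))%E.
  by apply: le_measure; rewrite ?inE //; try exact: measurableC; exact: subIsetl.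
rewrite n0 => h.
by apply: (@le_trans _ _ (nu (torus `&` A) + 0)%E); [exact: leeD2l|rewrite adde0].
Qed.

Lemma inv_probT nu : inv_prob q nu -> nu setT = 1%E.
Proof. by move=> [n1 [n0 _]]; rewrite -(measure_torusI n0) // setIT. Qed.

Lemma inv_prob_preimage nu A : inv_prob q nu -> measurable A -> nu (Tmap q @^-1` A) = nu A.
Proof.
move=> [n1 [n0 inv]] mA; have mT := measurable_torus.
have mTA (B : set R) : measurable B -> measurable (Tmap q @^-1` B).
  by move=> mB; rewrite -[X in measurable X]setTI; exact: (measurable_Tmap measurableT mB).
rewrite -(measure_torusI n0); last exact: mTA.
have -> : torus `&` Tmap q @^-1` A = torus `&` Tmap q @^-1` (torus `&` A).
  by rewrite preimage_setI; apply/seteqP; split => x /= [h1]; [move=> h2; split => //; split => //; exact: torus_frac|move=> []].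
rewrite inv; [|exact: measurableI|exact: subIsetl].
exact: measure_torusI.
Qed.

Lemma Ex_Tmap nu f : inv_prob q nu -> bmf f -> Ex nu (fun x => f (Tmap q x)) = Ex nu f.
Proof.
move=> H [mf hf]; rewrite /Ex /Rintegral; congr fine.
have E := @integral_pushforward _ _ _ _ R _ measurable_Tmap nu setT (EFin \o f).
rewrite preimage_setT in E.
rewrite -[LHS](E _ _ measurableT); last 2 first.
- exact/measurable_EFinP.
- apply: bmf_integrable; first exact: inv_probT H.
  by apply: bmf_comp; [exact: measurable_Tmap|split].
apply: eq_measure_integral; first exact: measurable_Tmap.
move=> mf' A mA _.
exact: (inv_prob_preimage H mA).
Qed.

End Invariance.

(** * The integral of the potential against an invariant measure *)

Section Value.
Variables (R : realType) (q : nat) (hq : (2 <= q)%N).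
Implicit Types (nu mu : {measure set R -> \bar R}) (f psi : R -> R) (A : set R) (c ga be : R).
Notation torus := (@torus R).

Lemma continuous_lip f L : 0 <= L -> (forall x y, `|f x - f y| <= L * `|x - y|) -> continuous f.
Proof.
move=> L0 lip x; apply/cvgrPdist_le => e e0; near=> y.
apply: (le_trans (lip x y)).
have h : `|x - y| <= e / (L + 1).
  by near: y; apply: cvgr_dist_le; [exact: cvg_id|rewrite divr_gt0 //; lra].
have h2 : L * `|x - y| <= L * (e / (L + 1)) by rewrite ler_wpM2l.
apply: (le_trans h2); rewrite mulrA ler_pdivrMr; last by lra.
by rewrite mulrC ler_pM2l //; lra.
Unshelve. all: by end_near.
Qed.

Lemma measurable_dirichlet c : measurable_fun setT (fun x : R => dirichlet_abs q (x + c)).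
Proof.
rewrite (_ : (fun x : R => _) = fun x => `|U q (pi * (x + c))|); last first.
  by apply/funext => x; rewrite dirichlet_absE.
apply: measurableT_comp => //; apply: continuous_measurable_fun => x.
apply: (@hderiv_continuous R _ (dU q (pi * (x + c)) * (0 * (x + c) + pi * (1 + 0)))).
apply: (@hderiv_comp R (U q) (fun x => pi * (x + c))); first exact: hderiv_U.
apply: hderivM; first exact: hderiv_cst.
by apply: hderivD; [exact: hderiv_id|exact: hderiv_cst].
Qed.

Definition kpos c (x : R) : R := Num.max 0 (ln (dirichlet_abs q (x + c))).
(** The positive part of the potential is bounded by ln q and stays real; the negative part is +oo
    at the zeros of the kernel and must stay extended. *)
Definition kneg c (x : R) : \bar R :=
  if dirichlet_abs q (x + c) == 0 then +oo%E else (Num.max 0 (- ln (dirichlet_abs q (x + c))))%:E.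

Lemma measurable_eq0 f : measurable_fun setT f -> measurable_fun setT (fun x => f x == 0).
Proof. by move=> mf; apply: measurable_fun_eqr => //; exact: measurable_cst. Qed.

Lemma measurable_lndir c : measurable_fun setT (fun x : R => ln (dirichlet_abs q (x + c))).
Proof. by apply: measurableT_comp; [exact: measurable_ln|exact: measurable_dirichlet]. Qed.

Lemma bmf_kpos c : bmf (kpos c).
Proof.
split; first by apply: measurable_maxr => //; exact: measurable_lndir.
exists (ln q%:R) => x; rewrite /kpos.
have q1 : 1 <= q%:R :> R by rewrite ler1n (ltn_trans _ hq).
have l0 : 0 <= ln q%:R :> R by rewrite ln_ge0.
rewrite ger0_norm ?le_max ?lexx // ge_max l0 /=.
have [->|d0] := eqVneq (dirichlet_abs q (x + c)) 0; first by rewrite ln0.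
have dp : 0 < dirichlet_abs q (x + c) by rewrite lt_neqAle eq_sym d0 dirichlet_abs_ge0.
by rewrite ler_ln ?posrE ?dirichlet_abs_le // (lt_le_trans ltr01).
Qed.

Lemma measurable_kneg c : measurable_fun setT (kneg c).
Proof.
apply: measurable_fun_ifT => //; first by apply: measurable_eq0; exact: measurable_dirichlet.
apply/measurable_EFinP; apply: measurable_maxr => //; apply: measurableT_comp => //.
exact: measurable_lndir.
Qed.

Lemma kneg_ge0 c x : (0 <= kneg c x)%E.
Proof. by rewrite /kneg; case: ifP => // _; rewrite lee_fin le_max lexx. Qed.

Lemma integral_torus nu (f : R -> \bar R) : nu (~` torus) = 0%E -> measurable_fun setT f ->
  (forall x, (0 <= f x)%E) -> (\int[nu]_(x in torus) f x = \int[nu]_x f x)%E.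
Proof.
move=> n0 mf f0; have mT := @measurable_torus R.
rewrite [RHS](@ge0_negligible_integral _ _ _ nu setT (~` torus)) //; last exact: measurableC.
by rewrite setDE setCK setTI.
Qed.

Lemma integral_fcE nu c : nu (~` torus) = 0%E ->
  integral_fc q c nu = (\int[nu]_x (kpos c x)%:E - \int[nu]_x kneg c x)%E.
Proof.
move=> n0; rewrite /integral_fc integralE.
have kp0 x : 0 <= kpos c x by rewrite /kpos le_max lexx.
rewrite -(integral_torus n0 (proj2 (measurable_EFinP _ _) (bmf_kpos c).1)); last by move=> x; rewrite lee_fin.
rewrite -(integral_torus n0 (measurable_kneg c) (kneg_ge0 c)).
congr (_ - _)%E; apply: eq_integral => x _.
  rewrite funeposE /fc /kpos /=; case: (eqVneq (dirichlet_abs q (x + c)) 0) => [->|_]; first by rewrite ln0 // maxxx maxNye.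
  by rewrite -EFin_max maxC.
rewrite funenegE /fc /kneg /=; case: (eqVneq (dirichlet_abs q (x + c)) 0) => [_|_]; first by rewrite /= maxye.
by rewrite -EFinN -EFin_max maxC.
Qed.

Section Bound.
Variables (c ga be : R) (psi : R -> R).
Hypothesis S : subaction q c ga be psi.

(** The gap in the sub-action inequality, be - f_c - psi + psi o T, with value +oo at the zeros of
    the kernel. It is zero on the arc and positive off it. *)
Definition defect (x : R) : \bar R :=
  if dirichlet_abs q (x + c) == 0 then +oo%E
  else (be - psi x + psi (Tmap q x) - ln (dirichlet_abs q (x + c)))%:E.
Definition off_arc : set R := [set x | q%:R^-1 < frac (x - ga)].

Lemma psi_Tmap x : psi (Tmap q x) = psi (q%:R * x).
Proof.
by rewrite -(subaction_perZ S (Tmap q x) (Num.floor (q%:R * x))) addrC /Tmap -floorD_frac.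
Qed.

Lemma bmf_psi : bmf psi.
Proof.
have [_ [L [L0 lip]] _ _] := S; have [M [M0 hM]] := subaction_bounded S.
split; last by exists M.
by apply: continuous_measurable_fun; exact: continuous_lip L0 lip.
Qed.

Lemma defect_arc x : ~ off_arc x -> defect x = 0%E.
Proof.
rewrite /off_arc /= => /negP; rewrite -leNgt => h.
have [_ _ H1 _] := S; have [d0 e] := H1 x h.
by rewrite /defect (negbTE d0) psi_Tmap; congr (_%:E); lra.
Qed.

Lemma defect_off x : off_arc x -> (0 < defect x)%E.
Proof.
move=> h; rewrite /defect; case: eqP => [_|/eqP d0]; first exact: ltry.
have [_ _ _ H2] := S; have := H2 x h d0; rewrite psi_Tmap lte_fin; lra.
Qed.

Lemma defect_ge0 x : (0 <= defect x)%E.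
Proof.
case: (pselect (off_arc x)) => h; first exact: ltW (defect_off h).
by rewrite defect_arc.
Qed.

Lemma measurable_defect : measurable_fun setT defect.
Proof.
apply: measurable_fun_ifT => //; first by apply: measurable_eq0; exact: measurable_dirichlet.
apply/measurable_EFinP; apply: measurable_funB; last exact: measurable_lndir.
by apply: measurable_funD; [apply: measurable_funB => //; exact: bmf_psi.1|
  apply: measurableT_comp; [exact: bmf_psi.1|exact: measurable_Tmap]].
Qed.

Lemma measurable_off_arc : measurable off_arc.
Proof.
have mf : measurable_fun setT (fun x : R => frac (x - ga)).
  by apply: (measurableT_comp (@measurable_frac R)); exact: measurable_funB.
have -> : off_arc = setT `&` (fun x : R => frac (x - ga)) @^-1` `]q%:R^-1, +oo[%classic.
  by rewrite setTI; apply/seteqP; split => x; rewrite /off_arc /preimage /= in_itv /= andbT.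
exact: mf.
Qed.

(** The integral of the potential may be -oo, so nothing can be subtracted before integrating. The
    pointwise identity [pt] is arranged as an equality of sums of nonnegative functions, with the
    constant N making g >= 0; invariance then cancels psi against psi o T. *)
Lemma integral_fc_defect nu : inv_prob q nu ->
  (integral_fc q c nu = be%:E - \int[nu]_x defect x)%E.
Proof.
move=> H; have nu1 := inv_probT H; have [_ [n0 _]] := H.
have [M [M0 hM]] := subaction_bounded S.
have bp := bmf_psi; have bT : bmf (fun x => psi (Tmap q x)) by apply: bmf_comp => //; exact: measurable_Tmap.
pose N := `|be| + 2 * M.
pose g x := N + be - psi x + psi (Tmap q x).
have bg : bmf g by apply: bmfD => //; apply: bmfB => //; exact: bmf_cst.
have Eg : Ex nu g = N + be.
  rewrite /g (ExD nu1) //; last by apply: bmfB => //; exact: bmf_cst.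
  have e1 := Ex_Tmap H bp; have e2 := ExB nu1 (bmf_cst (N + be)) bp.
  by rewrite e1 e2 (Ex_cst nu1) subrK.
have g0 x : 0 <= g x.
  have h1 := hM x; have h2 := hM (Tmap q x); have h3 := ler_norm (- be).
  by rewrite /g /N; rewrite normrN in h3; rewrite !ler_norml in h1 h2; lra.
have bk := bmf_kpos c.
have bNk : bmf (fun x => N + kpos c x) by apply: bmfD => //; exact: bmf_cst.
have kp0 x : 0 <= kpos c x by rewrite /kpos le_max lexx.
have N0 : 0 <= N by rewrite addr_ge0 // mulr_ge0.
have pt x : ((g x)%:E + kneg c x = (N + kpos c x)%:E + defect x)%E.
  rewrite /kneg /defect /kpos; case: eqP => [_|_]; first by rewrite !addey.
  rewrite -!EFinD; congr (_%:E); rewrite /g; set l := ln _.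
  by case: (leP 0 l) => h; case: (leP 0 (- l)) => h2; lra.
have E : ((N + be)%:E + \int[nu]_x kneg c x = (N + Ex nu (kpos c))%:E + \int[nu]_x defect x)%E.
  have e3 : N + Ex nu (kpos c) = Ex nu (fun x => N + kpos c x).
    by rewrite (ExD nu1 (bmf_cst N) bk) (Ex_cst nu1).
  rewrite e3 -Eg -(Ex_EFin nu1 bg) -(Ex_EFin nu1 bNk) -!ge0_integralD //;
    try first [exact: measurable_defect|exact: measurable_kneg|by apply/measurable_EFinP; exact: bNk.1|
      by apply/measurable_EFinP; exact: bg.1|by move=> x _; exact: defect_ge0|by move=> x _; exact: kneg_ge0|
      by move=> x _; rewrite lee_fin|by move=> x _; rewrite lee_fin; apply: addr_ge0].
  by apply: eq_integral => x _; exact: pt.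
rewrite (integral_fcE _ n0) (Ex_EFin nu1 bk).
move: E; case: (\int[nu]_x kneg c x)%E (integral_ge0 nu (fun x (_ : setT x) => kneg_ge0 c x)) => [r| |] //.
- case: (\int[nu]_x defect x)%E => [s| |] // _; rewrite -!EFinD => -[e].
  by rewrite -?EFinB; congr (_%:E); lra.
- by case: (\int[nu]_x defect x)%E => [s| |].
Qed.

Lemma integral_fc_le nu : inv_prob q nu -> (integral_fc q c nu <= be%:E)%E.
Proof.
move=> H; rewrite (integral_fc_defect H).
have := integral_ge0 nu (fun x (_ : setT x) => defect_ge0 x).
case: (\int[nu]_x defect x)%E => [s| |] // s0.
  by rewrite -EFinB lee_fin; move: s0; rewrite lee_fin; lra.
by rewrite /= leNye.
Qed.

Lemma integral_fc_eq nu : inv_prob q nu -> (integral_fc q c nu = be%:E <-> nu off_arc = 0%E).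
Proof.
move=> H; rewrite (integral_fc_defect H).
have d0 := integral_ge0 nu (fun x (_ : setT x) => defect_ge0 x).
have mo := measurable_off_arc.
split=> h.
  have {h} : (\int[nu]_x `|defect x| = 0)%E.
    under eq_integral do rewrite gee0_abs ?defect_ge0 //.
    move: h d0; case: (\int[nu]_x defect x)%E => [s| |] //.
    by rewrite -EFinB => -[e] _; congr (_%:E); lra.
  move/(ae_eq_integral_abs nu measurableT measurable_defect) => [N [mN N0 hN]].
  apply/eqP; rewrite eq_le measure_ge0 andbT -N0.
  apply: le_measure; rewrite ?inE // => x ox; apply: hN => /= /(_ I) e.
  by have := defect_off ox; rewrite e ltxx.
rewrite (@ge0_negligible_integral _ _ _ nu setT off_arc) //;
  [|exact: measurable_defect|by move=> x _; exact: defect_ge0].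
rewrite (eq_integral (cst 0%E)) ?integral0 ?sube0 // => x.
by rewrite inE => -[_ hx]; rewrite defect_arc.
Qed.

End Bound.

End Value.

(** * Lebesgue measure on the circle and existence of a measure on the arc *)

Section Translation.
Variable R : realType.
Notation torus := (@torus R).
Notation leb := (@lebesgue_measure R).

Lemma measurable_shift (r : R) (A : set R) : measurable A -> measurable [set x : R | A (x + r)].
Proof.
move=> mA; have mf : measurable_fun setT (fun x : R => x + r) by exact: measurable_funD.
by have := mf measurableT _ mA; rewrite setTI.
Qed.

Lemma lebesgue_translate (r : R) (A : set R) : measurable A -> leb [set x | A (x + r)] = leb A.
Proof.
move=> mA.
have mf : measurable_fun setT (fun x : measurableTypeR R => x + r : measurableTypeR R) by exact: measurable_funD.
pose m := (pushforward leb (fun x : measurableTypeR R => x + r : measurableTypeR R) : {measure set (measurableTypeR R) -> \bar R}) .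
symmetry; apply: (@lebesgue_measure_unique R (m mf)) => // X [[a b] _ <-].
rewrite /m /= /pushforward.
have -> : (fun x : R => x + r) @^-1` [set` `]a, b]] = [set` `]a - r, b - r]].
  by apply/seteqP; split => x /=; rewrite !in_itv /= ltrBlDr lerBrDr.
rewrite !lebesgue_measure_itv /= !lte_fin ltrD2r; case: ifP => // _.
by rewrite -!EFinB; congr (_%:E); ring.
Qed.

(** Only s = frac r matters; the circle is cut at s, and the two pieces are translated by s and s -
    1. *)
Lemma periodic_shift_measure (P : set R) (r : R) : measurable P -> (forall x, P (x + 1) <-> P x) ->
  leb (torus `&` [set x | P (x + r)]) = leb (torus `&` P).
Proof.
move=> mP per.
have perZ (m : int) x : P (x + m%:~R) <-> P x.
  have pos (n : nat) y : P (y + n%:R) <-> P y.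
    by elim: n => [|n IH]; rewrite ?addr0 // -natr1 addrA; split => [/per/IH|/IH/per].
  case: m => n; first exact: pos.
  by rewrite NegzE mulrNz; have := pos n.+1 (x - n.+1%:R); rewrite subrK => ->.
have /andP[s0 s1] := frac_itv r; set s := frac r in s0 s1.
have -> : [set x | P (x + r)] = [set x | P (x + s)].
  have e x : x + r = x + s + (Num.floor r)%:~R by have := floorD_frac r; rewrite -/s; lra.
  by apply/seteqP; split => x /=; rewrite e; [move/perZ|move=> h; apply/perZ].
pose I1 := `[s, 1[%classic : set R; pose I2 := `[0, s[%classic : set R.
have -> : torus `&` P = (I1 `&` P) `|` (I2 `&` P).
  rewrite -setIUl; congr (_ `&` P); apply/seteqP; split => x; rewrite /I1 /I2 /= !in_itv /=.
    by move=> /andP[h1 h2]; case: (leP s x) => h; [left|right]; lra.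
  by case=> /andP[h1 h2]; apply/andP; split; lra.
have -> : torus `&` [set x | P (x + s)] = [set x | (I1 `&` P) (x + s)] `|` [set x | (I2 `&` P) (x + (s - 1))].
  have e x : x + s = x + (s - 1) + 1 by ring.
  apply/seteqP; split => x; rewrite /I1 /I2 /= !in_itv /=.
    move=> [/andP[h1 h2] h]; case: (ltP (x + s) 1) => hx.
      by left; split => //; lra.
    by right; split; [lra|apply/per; rewrite -e].
  case=> -[/andP[h1 h2] h]; first by split => //; apply/andP; split; lra.
  by split; [apply/andP; split; lra|rewrite e; apply/per].
have m1 : measurable (I1 `&` P) by apply: measurableI => //; exact: measurable_itv.
have m2 : measurable (I2 `&` P) by apply: measurableI => //; exact: measurable_itv.
have d2 : (I1 `&` P) `&` (I2 `&` P) = set0.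
  by apply/seteqP; split => // x [[+ _] [+ _]]; rewrite /I1 /I2 /= !in_itv /= => /andP[h1 h2] /andP[h3 h4]; lra.
have d1 : [set x | (I1 `&` P) (x + s)] `&` [set x | (I2 `&` P) (x + (s - 1))] = set0.
  by apply/seteqP; split => // x [[+ _] [+ _]]; rewrite /I1 /I2 /= !in_itv /= => /andP[h1 h2] /andP[h3 h4]; lra.
transitivity (leb [set x : R | (I1 `&` P) (x + s)%R] + leb [set x : R | (I2 `&` P) (x + (s - 1))%R])%E.
  exact: (measureU leb (measurable_shift s m1) (measurable_shift (s - 1) m2) d1).
transitivity (leb (I1 `&` P) + leb (I2 `&` P))%E.
  by congr (_ + _)%E; exact: lebesgue_translate.
by symmetry; exact: (measureU leb m1 m2 d2).
Qed.

End Translation.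

Section Existence.
Variables (R : realType) (q : nat) (hq : (2 <= q)%N) (ga rho : R).
Notation torus := (@torus R).
Notation leb := (@lebesgue_measure R).
Hypothesis Hrot : forall n x, `|iter n (cmap q ga) x - x - n%:R * rho| <= 2.

Definition conj_proj (th : R) : R := frac (conj_map q ga rho th).

Lemma measurable_conj_proj : measurable_fun setT conj_proj.
Proof.
apply: (measurableT_comp (@measurable_frac R)).
by apply: nondecreasing_measurable => // x y; exact: (conj_map_mono Hrot).
Qed.

Lemma conj_projD1 th : conj_proj (th + 1) = conj_proj th.
Proof. by rewrite /conj_proj (conj_mapD1 Hrot) fracD1. Qed.

Lemma conj_proj_arc th : frac (conj_proj th - ga) <= q%:R^-1.
Proof.
have -> : conj_proj th - ga = conj_map q ga rho th - ga + (- Num.floor (conj_map q ga rho th))%:~R.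
  by rewrite /conj_proj /Defs.frac mulrNz; ring.
by rewrite fracDz; exact: (conj_map_arc hq Hrot).
Qed.

Lemma cmap_frac x : frac (x - ga) <= q%:R^-1 -> frac (cmap q ga x) = Tmap q (frac x).
Proof.
move=> h; rewrite (cmap_arc hq h) /Tmap.
set m := Num.floor (x - ga).
have -> : q%:R * x - (q%:R - 1) * m%:~R = q%:R * frac x + (q%:Z * Num.floor x - (q%:Z - 1) * m)%:~R.
  by rewrite intrB !intrM intrB {1}[x]floorD_frac; ring.
by rewrite fracDz.
Qed.

Lemma conj_proj_Tmap th : Tmap q (conj_proj th) = conj_proj (th + rho).
Proof. by rewrite /conj_proj -(cmap_conj hq Hrot) cmap_frac //; exact: (conj_map_arc hq Hrot). Qed.

(** The image of Lebesgue measure under [conj_proj], which intertwines the rotation by rho with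
    [Tmap] and takes its values in the arc. *)
Lemma exists_invariant : exists mu : {measure set R -> \bar R},
  inv_prob q mu /\ mu (off_arc q ga) = 0%E.
Proof.
have mT := @measurable_torus R.
have mf : measurable_fun setT (conj_proj : measurableTypeR R -> R) by exact: measurable_conj_proj.
pose m0 : {measure set (measurableTypeR R) -> \bar R} := mrestr leb mT.
pose mm := (pushforward m0 (conj_proj : measurableTypeR R -> R) : {measure set R -> \bar R}).
pose m := mm mf.
have mE A : m A = leb (torus `&` conj_proj @^-1` A) by rewrite /m /mm /m0 /= /pushforward /mrestr setIC.
exists m; split; [split; [|split]|].
- rewrite mE (_ : torus `&` _ = `[0, 1[%classic).
    by rewrite lebesgue_measure_itv /= lte_fin ltr01 sube0.
  by rewrite -torus_itv; apply/setIidPl => x _; exact: torus_frac.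
- rewrite mE (_ : torus `&` _ = set0) ?measure0 //.
  by apply/seteqP; split => // x [_]; apply; exact: torus_frac.
- move=> A mA sA; rewrite !mE.
  have mp : measurable (conj_proj @^-1` A) by have := measurable_conj_proj measurableT mA; rewrite setTI.
  have := @periodic_shift_measure R (conj_proj @^-1` A) rho mp.
  move=> <-; last by move=> x; rewrite /preimage /= conj_projD1.
  congr (leb (torus `&` _)); apply/seteqP; split => x /=; rewrite conj_proj_Tmap.
    by case.
  by split => //; exact: torus_frac.
- rewrite mE (_ : torus `&` _ = set0) ?measure0 //.
  by apply/seteqP; split => // x [_]; rewrite /preimage /off_arc /= ltNge conj_proj_arc.
Qed.

End Existence.

(** * Integrals of Lipschitz functions against measures on the arc *)

Section Uniqueness.
Variables (R : realType) (q : nat) (hq : (2 <= q)%N) (ga rho : R).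
Implicit Types (nu mu : {measure set R -> \bar R}) (f phi : R -> R) (L : R).
Notation torus := (@torus R).
Hypothesis Hrot : forall n x, `|iter n (cmap q ga) x - x - n%:R * rho| <= 2.

Definition lip_per L f := [/\ 0 <= L, (forall x, f (x + 1) = f x) & forall x y, `|f x - f y| <= L * `|x - y|].

Lemma perZ f : (forall x, f (x + 1) = f x) -> forall (m : int) x, f (x + m%:~R) = f x.
Proof.
move=> per m x.
have pos (n : nat) y : f (y + n%:R) = f y.
  by elim: n => [|n IH]; rewrite ?addr0 // -natr1 addrA per.
case: m => n; first exact: pos.
by rewrite NegzE mulrNz -[LHS](pos n.+1) subrK.
Qed.

Lemma lip_per_bmf L f : lip_per L f -> bmf f.
Proof.
move=> [L0 per lip]; split; first by apply: continuous_measurable_fun; exact: continuous_lip L0 lip.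
exists (L + `|f 0|) => x; rewrite [x]floorD_frac addrC (perZ per).
have /andP[f0 f1] := frac_itv x.
have -> : f (frac x) = (f (frac x) - f 0) + f 0 by ring.
apply: (le_trans (ler_normD _ _)); rewrite lerD2r; apply: (le_trans (lip _ _)).
by rewrite subr0 (ger0_norm f0) ler_piMr // ltW.
Qed.

Lemma frac_Tmap f x : (forall x, f (x + 1) = f x) -> ~ off_arc q ga x -> f (cmap q ga x) = f (Tmap q x).
Proof.
move=> per /negP; rewrite -leNgt => h.
have e y : f y = f (frac y) by rewrite {1}[y]floorD_frac addrC (perZ per).
rewrite e (cmap_frac hq h) /Tmap; congr (f _).
have -> : q%:R * x = q%:R * frac x + (q%:Z * Num.floor x)%:~R.
  by rewrite intrM {1}[x]floorD_frac; ring.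
by rewrite fracDz.
Qed.

Lemma displacement_per n x : iter n (cmap q ga) (x + 1) - (x + 1) = iter n (cmap q ga) x - x.
Proof. by rewrite cmap_iterD1; ring. Qed.

Lemma displacement_bmf n : bmf (fun x => iter n (cmap q ga) x - x).
Proof.
split.
  apply: measurable_funB => //; apply: nondecreasing_measurable => // x y xy.
  exact: (cmap_iter_mono hq).
exists (2 + `|n%:R * rho|) => x.
have -> : iter n (cmap q ga) x - x = (iter n (cmap q ga) x - x - n%:R * rho) + n%:R * rho by ring.
by apply: (le_trans (ler_normD _ _)); rewrite lerD2r.
Qed.

(** On the arc [cmap] agrees with [Tmap] modulo 1, so by invariance the mean displacement of the
    n-th iterate is n times that of the first. It is also within 2 of n rho; take n = 2^k and
    divide. *)
Lemma Ex_displacement nu : inv_prob q nu -> nu (off_arc q ga) = 0%E ->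
  Ex nu (fun x => cmap q ga x - x) = rho.
Proof.
move=> H n0; have nu1 := inv_probT H.
have mo := @measurable_off_arc R q ga.
have D1 : bmf (fun x => cmap q ga x - x) := displacement_bmf 1.
have step n : Ex nu (fun x => iter n (cmap q ga) x - x) = n%:R * Ex nu (fun x => cmap q ga x - x).
  elim: n => [|n IH].
    by rewrite mul0r; under eq_fun do rewrite /= subrr; rewrite (Ex_cst nu1).
  have bn := displacement_bmf n.
  have bT : bmf (fun x => iter n (cmap q ga) (Tmap q x) - Tmap q x).
    by apply: (@bmf_comp _ (fun x => iter n (cmap q ga) x - x)) => //; exact: measurable_Tmap.
  rewrite (@Ex_ae _ _ _ (fun x => (iter n (cmap q ga) (Tmap q x) - Tmap q x) + (cmap q ga x - x)) (off_arc q ga)) //.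
  - by rewrite (ExD nu1) // (Ex_Tmap H bn) IH -natr1; ring.
  - exact: displacement_bmf.
  - exact: bmfD.
  - move=> x hx; rewrite iterSr -(frac_Tmap (f := fun x => iter n (cmap q ga) x - x)) //; first by ring.
    exact: displacement_per.
apply/eqP; rewrite -subr_eq0 -normr_le0.
apply: (@le_half_pow0 _ _ 2) => n; rewrite ler_pdivlMr ?exprn_gt0 //.
have -> : `|Ex nu (fun x => cmap q ga x - x) - rho| * 2 ^+ n =
   `|(2 ^ n)%N%:R * Ex nu (fun x => cmap q ga x - x) - (2 ^ n)%N%:R * rho|.
  by rewrite -mulrBr normrM natrX mulrC ger0_norm // exprn_ge0.
rewrite -step.
have -> : Ex nu (fun x => iter (2 ^ n) (cmap q ga) x - x) - (2 ^ n)%N%:R * rho =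
  Ex nu (fun x => iter (2 ^ n) (cmap q ga) x - x - (2 ^ n)%N%:R * rho).
  by rewrite (ExB nu1 (displacement_bmf _) (bmf_cst _)) (Ex_cst nu1).
apply: (Ex_bound nu1); first by apply: bmfB; [exact: displacement_bmf|exact: bmf_cst].
by move=> x; exact: Hrot.
Qed.

(* Solving the cohomological equation for phi on the arc expresses phi as a coboundary plus W times the
   displacement of the circle map plus a constant. *)
Lemma Ex_lip_per L phi : lip_per L phi -> exists k : R, forall nu, inv_prob q nu ->
  nu (off_arc q ga) = 0%E -> Ex nu phi = k.
Proof.
move=> hphi; have [L0 per lip] := hphi; have Q := q_gt0 R hq; have Q2 := q_ge2 R hq.
pose e v := phi (ga + v / q%:R) - phi ga; pose d := ga - q%:R * ga.
have [Ph [qp eqn lp]] : exists Ph, coh q d e (2 * L) Ph.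
  apply: (coh_exists hq) => [|u v u0 uv v1]; first by rewrite /e mul0r addr0 subrr.
  have -> : e v - e u = phi (ga + v / q%:R) - phi (ga + u / q%:R) by rewrite /e; ring.
  apply: (le_trans (lip _ _)); apply: ler_wpM2l => //.
  have -> : ga + v / q%:R - (ga + u / q%:R) = (v - u) / q%:R by field; rewrite gt_eqF.
  rewrite ger0_norm ?divr_ge0 ?subr_ge0 ?(ltW Q) // ler_piMr ?subr_ge0 // invf_le1 //; lra.
pose W := Ph 1; pose C0 := phi ga + Ph d.
pose g x := Ph (x - q%:R * ga) - W * x.
have gl : lip_per (2 * L + `|W|) g.
  split; [by rewrite addr_ge0 // mulr_ge0| |].
    move=> x; rewrite /g; have -> : x + 1 - q%:R * ga = x - q%:R * ga + 1 by ring.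
    by rewrite qp /W; ring.
  move=> x y; have lp2 : `|Ph (x - q%:R * ga) - Ph (y - q%:R * ga)| <= 2 * L * `|x - y|.
    case: (leP y x) => xy.
      rewrite (ger0_norm (_ : 0 <= x - y)) ?subr_ge0 //.
      have h : y - q%:R * ga <= x - q%:R * ga by rewrite lerD2r.
      by have := lp _ _ h; have -> : x - q%:R * ga - (y - q%:R * ga) = x - y by ring.
    have h : x - q%:R * ga <= y - q%:R * ga by rewrite lerD2r ltW.
    have yx : 0 <= y - x by rewrite subr_ge0 ltW.
    rewrite distrC [`|x - y|]distrC (ger0_norm yx).
    by have := lp _ _ h; have -> : y - q%:R * ga - (x - q%:R * ga) = y - x by ring.
  have -> : g x - g y = (Ph (x - q%:R * ga) - Ph (y - q%:R * ga)) - W * (x - y) by rewrite /g; ring.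
  by apply: (le_trans (ler_normB _ _)); rewrite mulrDl normrM lerD2r.
have bg := lip_per_bmf gl; have bphi := lip_per_bmf hphi.
exists (W * rho + C0) => nu H n0; have nu1 := inv_probT H.
have mo := @measurable_off_arc R q ga.
have bT : bmf (fun x => g (Tmap q x)) by apply: bmf_comp => //; exact: measurable_Tmap.
have D1 : bmf (fun x => cmap q ga x - x) := displacement_bmf 1.
have b1 : bmf (fun x => g (Tmap q x) - g x) by exact: bmfB.
have b2 : bmf (fun x => W * (cmap q ga x - x)) by exact: bmfZ.
have b3 : bmf (fun x => g (Tmap q x) - g x + W * (cmap q ga x - x)) by exact: bmfD.
rewrite (@Ex_ae _ _ _ (fun x => g (Tmap q x) - g x + W * (cmap q ga x - x) + C0) (off_arc q ga)) //.
- rewrite (ExD nu1 b3 (bmf_cst _)) (ExD nu1 b1 b2) (ExB nu1 bT bg) (ExZ nu1 _ D1) (Ex_cst nu1).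
  by rewrite (Ex_Tmap H bg) (Ex_displacement H n0); ring.
- by apply: bmfD => //; exact: bmf_cst.
- move=> x hx; rewrite -(frac_Tmap _ hx); last by case: gl.
  move: hx => /negP; rewrite -leNgt => h.
  have /andP[u0 u1] := frac_itv (x - ga).
  set u := frac _ in h u0 u1; set j := Num.floor (x - ga).
  have ex : x = ga + j%:~R + u by have := floorD_frac (x - ga); rewrite -/u -/j; lra.
  have qu : q%:R * u <= 1 by rewrite -ler_pdivlMl // mulr1.
  have cx : cmap q ga x = q%:R * ga + j%:~R + q%:R * u.
    rewrite (@cmap_def R q hq ga x j u) //; last by rewrite u0 ltW.
    by congr (_ + _); apply/min_idPl.
  have hv : 0 <= q%:R * u <= 1 by rewrite qu mulr_ge0 // ltW.
  have E := eqn _ hv.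
  have eu : q%:R * u / q%:R = u by rewrite mulrAC divff ?mul1r // gt_eqF.
  rewrite eu in E.
  rewrite /g cx.
  have -> : q%:R * ga + j%:~R + q%:R * u - q%:R * ga = q%:R * u + j%:~R by ring.
  have -> : x - q%:R * ga = d + u + j%:~R by rewrite ex /d; ring.
  rewrite !(quasiperZ _ _ qp) E /e eu -/W /C0.
  have -> : phi x = phi (ga + u) by rewrite ex addrAC (perZ per).
  ring.
Qed.

End Uniqueness.

(** * Lipschitz functions determine the measure *)

Section Determination.
Variable R : realType.
Implicit Types (nu mu : {measure set R -> \bar R}) (f phi : R -> R) (L a x y : R).
Notation torus := (@torus R).

(* Circle distance to the arc [0, a]. *)
Definition adist a x : R := Num.min (Num.max 0 (frac x - a)) (1 - frac x).

Lemma adist_ge0 a x : 0 <= adist a x.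
Proof. by have /andP[_ h] := frac_itv x; rewrite /adist le_min le_max lexx /= subr_ge0 ltW. Qed.

Lemma adist_lip a x y : 0 <= a -> `|adist a x - adist a y| <= `|x - y|.
Proof.
move=> a0; wlog xy : x y / x <= y.
  by move=> W; case: (leP x y) => [|/ltW] h; [exact: W|rewrite distrC [`|x - y|]distrC; exact: W].
have yx : 0 <= y - x by rewrite subr_ge0.
rewrite [`|x - y|]distrC (ger0_norm yx).
have ax := adist_ge0 a x; have ay := adist_ge0 a y.
have ex := floorD_frac x; have ey := floorD_frac y.
have /andP[u0 u1] := frac_itv x; have /andP[v0 v1] := frac_itv y.
have fl : Num.floor x <= Num.floor y by exact: le_floor.
rewrite /adist in ax ay *.
move: (Num.floor x) (Num.floor y) (frac x) (frac y) fl ax ay ex ey u0 u1 v0 v1 => i j u v fl ax ay ex ey u0 u1 v0 v1.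
rewrite ler_norml.
have [e|ne] := eqVneq i j.
  have euv : y - x = v - u by rewrite ex ey e; ring.
  have uv : u <= v by lra.
  rewrite euv; clear -uv u0 u1 v0 v1 a0.
  case: (leP 0 (u - a)) => h1; case: (leP 0 (v - a)) => h2.
  - by case: (leP (u - a) (1 - u)) => h3; case: (leP (v - a) (1 - v)) => h4; lra.
  - by case: (leP (u - a) (1 - u)) => h3; case: (leP 0 (1 - v)) => h4; lra.
  - by case: (leP 0 (1 - u)) => h3; case: (leP (v - a) (1 - v)) => h4; lra.
  - by case: (leP 0 (1 - u)) => h3; case: (leP 0 (1 - v)) => h4; lra.
have ij : i + 1 <= j by rewrite lezD1 lt_neqAle ne.
have ij' : i%:~R + 1 <= j%:~R :> R by have := ij; rewrite -(ler_int R) intrD.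
have b1 : Num.min (Num.max 0 (u - a)) (1 - u) <= 1 - u by rewrite ge_min lexx orbT.
have b2 : Num.min (Num.max 0 (v - a)) (1 - v) <= v.
  by rewrite ge_min ge_max v0 /= lerBlDr lerDl a0.
move: (Num.min _ _) (Num.min _ _) ax ay b1 b2 => A B ax ay b1 b2.
by lra.
Qed.

Definition ramp a (n : nat) x : R := Num.max 0 (1 - n%:R * adist a x).

Lemma ramp_lip_per a n : 0 <= a -> lip_per n%:R (ramp a n).
Proof.
move=> a0; split => // [x|x y]; first by rewrite /ramp /adist fracD1.
have h := adist_lip x y a0.
have h2 : n%:R * `|adist a x - adist a y| <= n%:R * `|x - y| by rewrite ler_wpM2l.
apply: le_trans h2.
have -> : n%:R * `|adist a x - adist a y| = `|n%:R * adist a x - n%:R * adist a y|.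
  by rewrite -mulrBr normrM ger0_norm.
rewrite /ramp.
move: (n%:R * _) (n%:R * _) => A B.
have h1 := ler_norm (A - B); have h3 := ler_norm (B - A); have h4 := distrC A B.
rewrite ler_norml.
by case: (leP 0 (1 - A)) => ?; case: (leP 0 (1 - B)) => ?; lra.
Qed.

Lemma ramp_itv a n x : 0 <= ramp a n x <= 1.
Proof.
rewrite /ramp le_max lexx /= ge_max ler01 /= gerBl mulr_ge0 ?adist_ge0 //.
Qed.

Lemma ramp_in a n x : frac x <= a -> ramp a n x = 1.
Proof.
move=> h; have /andP[_ u1] := frac_itv x.
have e1 : Num.max 0 (frac x - a) = 0 by apply/max_idPl; rewrite subr_le0.
have e2 : Num.min 0 (1 - frac x) = 0 by apply/min_idPl; rewrite subr_ge0 ltW.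
rewrite /ramp /adist e1 e2 mulr0 subr0.
by apply/max_idPr.
Qed.

Lemma ramp_out a x : a < frac x -> exists N, forall n, (N <= n)%N -> ramp a n x = 0.
Proof.
move=> h; have /andP[_ u1] := frac_itv x.
have d0 : 0 < adist a x by rewrite /adist lt_min lt_max !subr_gt0 h u1 orbT.
exists (Num.truncn (1 / adist a x)).+1 => n hn; apply/max_idPl; rewrite subr_le0 -ler_pdivrMr //.
apply: (le_trans (ltW (truncnS_gt _))); by rewrite ler_nat.
Qed.

Definition below a : set R := [set x | frac x <= a].

Lemma measurable_below a : measurable (below a).
Proof.
have -> : below a = setT `&` (@Defs.frac R) @^-1` `]-oo, a]%classic.
  by rewrite setTI; apply/seteqP; split => x; rewrite /below /preimage /= in_itv.
exact: (measurable_frac measurableT).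
Qed.

Lemma ramp_limit nu a : nu setT = 1%E -> 0 <= a ->
  (Ex nu (ramp a n))%:E @[n --> \oo] --> nu (below a).
Proof.
move=> nu1 a0; have mb := measurable_below a.
have br n : bmf (ramp a n) := lip_per_bmf (ramp_lip_per n a0).
have -> : nu (below a) = (\int[nu]_x (\1_(below a) x)%:E)%E by rewrite integral_indic // setIT.
under eq_fun do rewrite -(Ex_EFin nu1 (br _)).
have [//|||||] := @dominated_convergence _ _ R nu setT measurableT (fun n x => (ramp a n x)%:E)
  (fun x => (\1_(below a) x)%:E) (fun=> 1%E).
- by move=> n; apply/measurable_EFinP; exact: (br n).1.
- by apply/measurable_EFinP; exact: measurable_indic.
- apply: aeW => x _; apply: cvg_EFin; first by apply: nearW.
  rewrite indicE; case: (leP (frac x) a) => h.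
    rewrite mem_set //; apply: cvg_near_cst; apply: nearW => n /=; exact: ramp_in.
  rewrite memNset; last by rewrite /below /= => h2; move: h; rewrite ltNge h2.
  have [N hN] := ramp_out h.
  by apply: cvg_near_cst; exists N => // n /= Nn; exact: hN.
- exact: (@bmf_integrable R nu nu1 (fun=> 1) (bmf_cst 1)).
- apply: aeW => x n _; have /andP[r0 r1] := ramp_itv a n x.
  by rewrite gee0_abs lee_fin.
by move=> _ _.
Qed.

(** The ramps are Lipschitz and decrease to the indicator of [below a]. Hence both measures agree on
    the half-lines ]a, +oo[, a generating family stable under intersection. *)
Lemma measure_determined nu mu : nu torus = 1%E -> nu (~` torus) = 0%E -> mu torus = 1%E -> mu (~` torus) = 0%E ->
  (forall L f, lip_per L f -> Ex nu f = Ex mu f) -> forall A, measurable A -> nu A = mu A.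
Proof.
move=> n1 n0 m1 m0 H.
have nT : nu setT = 1%E by rewrite -(measure_torusI n0) // setIT.
have mT : mu setT = 1%E by rewrite -(measure_torusI m0) // setIT.
have mt := @measurable_torus R.
have eqb a : 0 <= a -> nu (below a) = mu (below a).
  move=> a0; have l1 := ramp_limit nT a0; have l2 := ramp_limit mT a0.
  have e : (fun n => (Ex nu (ramp a n))%:E) = (fun n => (Ex mu (ramp a n))%:E).
    by apply/funext => n; rewrite (H _ _ (ramp_lip_per n a0)).
  by rewrite e in l1; exact: (cvg_unique _ l1 l2).
have fin (m : {measure set R -> \bar R}) (A : set R) : m setT = 1%E -> measurable A -> (m A < +oo)%E.
  move=> m1' mA; apply: (@le_lt_trans _ _ (m setT)); last by rewrite m1' ltry.
  by apply: le_measure; rewrite ?inE.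
have half (m : {measure set R -> \bar R}) a : m torus = 1%E -> m setT = 1%E -> m (~` torus) = 0%E ->
    m `]a, +oo[%classic = if a < 0 then 1%E else (1 - m (below a))%E.
  move=> m1' mT' m0'; rewrite -(measure_torusI m0') //.
  case: ltP => ha.
    have -> : torus `&` `]a, +oo[%classic = torus; last exact: m1'.
    by apply/setIidPl => x /andP[x0 _]; rewrite /= in_itv /= andbT; exact: lt_le_trans x0.
  have mb := measurable_below a.
  have eT : torus = (torus `&` `]a, +oo[%classic) `|` (torus `&` below a).
    rewrite -setIUr; apply/seteqP; split => x; last by case.
    move=> tx; split => //; rewrite /below /= in_itv /= andbT frac_id //.
    by case: (leP x a) => h; [right|left].
  have dT : (torus `&` `]a, +oo[%classic) `&` (torus `&` below a) = set0.
    apply/seteqP; split => // x [[tx +] [_ +]]; rewrite /below /= in_itv /= andbT frac_id // => h1 h2.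
    by move: h1; rewrite ltNge h2.
  have mA : measurable (torus `&` `]a, +oo[%classic) by exact: measurableI.
  have mB : measurable (torus `&` below a) by exact: measurableI.
  have E : (m torus = m (torus `&` `]a, +oo[%classic) + m (below a))%E.
    by rewrite {1}eT -(measure_torusI m0' mb); exact: (measureU m mA mB dT).
  have fb : m (below a) \is a fin_num by rewrite ge0_fin_numE ?measure_ge0 // fin.
  by rewrite -m1' E addeK.
move=> A mA.
apply: (@measure_unique _ R R (@RGenOInfty.G R) (fun k => `]- k%:R, +oo[%classic) _ _ _ _ nu mu _ _ A mA).
- exact: RGenOInfty.measurableE.
- move=> X Y [x ->] [y ->]; exists (Num.max x y); apply/seteqP; split => z /=; rewrite !in_itv /= !andbT.
    by case=> h1 h2; rewrite gt_max h1 h2.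
  by rewrite gt_max => /andP[h1 h2].
- by move=> k; exists (- k%:R).
- apply/seteqP; split => // x _; exists (Num.truncn (- x)).+1 => //=.
  by rewrite in_itv /= andbT ltrNl; apply: truncnS_gt.
- move=> X [x ->]; rewrite !half //; case: ltP => // h; by rewrite eqb.
- by move=> k; exact: fin.
Qed.

End Determination.

(** * Existence, uniqueness and support of the maximizing measure *)

Section Maximizing.
Variables (R : realType) (q : nat) (hq : (2 <= q)%N).
Implicit Types (nu mu : {measure set R -> \bar R}) (c ga be : R) (psi : R -> R).
Notation torus := (@torus R).
Notation w := (omega R q).

Lemma arc_measure_unique ga nu mu : inv_prob q nu -> inv_prob q mu ->
  nu (off_arc q ga) = 0%E -> mu (off_arc q ga) = 0%E -> forall A, measurable A -> nu A = mu A.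
Proof.
move=> Hn Hm on om; have [rho Hrot] := cmap_rotation hq ga.
have [n1 [n0 _]] := Hn; have [m1 [m0 _]] := Hm.
apply: measure_determined => // L f hf.
by have [k hk] := Ex_lip_per hq Hrot hf; rewrite !hk.
Qed.

Lemma measurable_tball (x e : R) : measurable (tball x e).
Proof.
have m1 : measurable_fun setT (fun y : R => frac (x - y)).
  by apply: (measurableT_comp (@measurable_frac R)); exact: measurable_funB.
have m2 : measurable_fun setT (fun y : R => frac (y - x)).
  by apply: (measurableT_comp (@measurable_frac R)); exact: measurable_funB.
have mt : measurable_fun setT (tdist x) by exact: measurable_minr.
have -> : tball x e = torus `&` (setT `&` tdist x @^-1` `]-oo, e[%classic).
  by rewrite setTI; apply/seteqP; split => y; rewrite /tball /preimage /= in_itv.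
by apply: measurableI; [exact: measurable_torus|exact: mt].
Qed.

Lemma sturmian_of_off_arc ga mu : inv_prob q mu -> mu (off_arc q ga) = 0%E -> sturmian q mu.
Proof.
move=> H om; split => //; exists ga => x [tx hx]; split => //.
rewrite leNgt; apply/negP => hu.
have /andP[u0 u1] := frac_itv (x - ga).
set u := frac (x - ga) in hu u0 u1.
have Q : 0 < q%:R^-1 :> R by rewrite invr_gt0 q_gt0.
(* The point x lies u - 1/q past the right end of the arc and 1 - u before its left end, so the
   circle ball of radius e misses the arc. *)
pose e := Num.min (u - q%:R^-1) (1 - u).
have e0 : 0 < e by rewrite lt_min !subr_gt0 hu u1.
have e1 : e <= u - q%:R^-1 by rewrite ge_min lexx.
have e2 : e <= 1 - u by rewrite ge_min lexx orbT.
have ex : x = ga + u + (Num.floor (x - ga))%:~R by have := floorD_frac (x - ga); rewrite -/u; lra.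
have : (mu (tball x e) <= mu (off_arc q ga))%E.
  apply: le_measure; rewrite ?inE; [exact: measurable_tball|exact: measurable_off_arc|].
  move=> y [ty]; rewrite /tdist gt_min /off_arc /= => /orP[] h.
    have /andP[s0 s1] := frac_itv (x - y); have E := floorD_frac (x - y).
    have [_ ->] := @frac_eq R (y - ga) (Num.floor (x - ga) - Num.floor (x - y)) (u - frac (x - y))
      ltac:(lra) ltac:(rewrite intrB; lra).
    lra.
  have /andP[s0 s1] := frac_itv (y - x); have E := floorD_frac (y - x).
  have [_ ->] := @frac_eq R (y - ga) (Num.floor (x - ga) + Num.floor (y - x)) (u + frac (y - x))
    ltac:(lra) ltac:(rewrite intrD; lra).
  lra.
by rewrite om leNgt (hx e e0).
Qed.

Lemma beta_subaction c ga be psi : subaction q c ga be psi -> beta q c = be%:E.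
Proof.
move=> S; have [rho Hrot] := cmap_rotation hq ga.
have [mu [H om]] := exists_invariant hq Hrot.
apply/eqP; rewrite eq_le; apply/andP; split.
  by apply: ge_ereal_sup => _ [nu Hn <-]; exact: (integral_fc_le hq S).
by apply: ereal_sup_ubound; exists mu => //; apply/(integral_fc_eq hq S).
Qed.

Lemma subaction_exists c : exists al Ph be psi, [/\ arc_eta R q <= al <= w - arc_eta R q,
  coh q (arc_shift q al (pi * (q%:R - 1) * c)) (arc_incr q al) (2 * arc_lip R q) Ph, Ph 1 = 0 &
  subaction q c (arc_start c al) be psi].
Proof.
have [e0 e1] := eta_itv R hq.
have [al [Ph [hal C W]]] := sturmian_param hq (pi * (q%:R - 1) * c).
have hal' : 0 < al < w by lra.
have H := sturmian_of_coh hq hal' C W.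
exists al, Ph; eexists; eexists; split => //.
exact: (subaction_of_sturmian hq H).
Qed.

Theorem unique_maximizing_measure c : exists mu : {measure set R -> \bar R},
  inv_prob q mu /\ integral_fc q c mu = beta q c /\
  (forall nu : {measure set R -> \bar R}, inv_prob q nu -> integral_fc q c nu = beta q c ->
     forall A : set R, measurable A -> nu A = mu A) /\
  sturmian q mu.
Proof.
have [al [Ph [be [psi [_ _ _ S]]]]] := subaction_exists c.
have [rho Hrot] := cmap_rotation hq (arc_start c al).
have [mu [H om]] := exists_invariant hq Hrot.
rewrite (beta_subaction S); exists mu; split => //; split.
  exact/(integral_fc_eq hq S H).
split; last exact: sturmian_of_off_arc om.
by move=> nu Hn /(integral_fc_eq hq S Hn) on; exact: arc_measure_unique on om.
Qed.

End Maximizing.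

(** * Exponential sums *)

Section DigitSums.
Variables (q : nat) (hq : (2 <= q)%N).

Lemma digsum_widen K n : (n < K)%N -> digsum q n = (\sum_(k < K) ((n %/ q ^ k) %% q))%N.
Proof.
move=> nK; rewrite /digsum -!(big_mkord xpredT (fun k => (n %/ q ^ k) %% q)%N).
rewrite (big_cat_nat (n := n.+1) (p := K)) //= [X in _ = (_ + X)%N]big1_seq ?addn0 // => k /andP[_].
rewrite mem_index_iota => /andP[h1 h2]; rewrite divn_small ?mod0n //.
by apply: (leq_trans (ltn_expl n hq)); rewrite leq_exp2l // ltnW.
Qed.

Lemma digsum_rec m d : (d < q)%N -> digsum q (q * m + d) = (digsum q m + d)%N.
Proof.
move=> dq; have q0 : (0 < q)%N by exact: ltn_trans hq.
rewrite (@digsum_widen (q * m + d).+2) ?ltnS ?leqnSn // big_ord_recl /= expn0 divn1.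
rewrite mulnC modnMDl modn_small // addnC; congr (_ + _)%N.
rewrite (@digsum_widen (m * q + d).+1 m); last first.
  by rewrite ltnS (leq_trans _ (leq_addr _ _)) // leq_pmulr.
apply: eq_bigr => k _; rewrite /bump /= add1n expnS divnMA divnMDl // (divn_small dq) addn0 //.
Qed.

End DigitSums.

Section ExponentialSums.
Variable R : realType.
Implicit Types (t x y c a b : R).

(** The modulus of a + i b; the complex sums are carried as pairs of real and imaginary parts. *)
Definition nrm a b : R := Num.sqrt (a ^+ 2 + b ^+ 2).

Lemma nrm_sqr a b : nrm a b ^+ 2 = a ^+ 2 + b ^+ 2.
Proof. by rewrite /nrm sqr_sqrtr // addr_ge0 ?sqr_ge0. Qed.

Lemma nrmD a b a' b' : nrm (a + a') (b + b') <= nrm a b + nrm a' b'.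
Proof.
have p (u v : R) : 0 <= u ^+ 2 + v ^+ 2 by rewrite addr_ge0 ?sqr_ge0.
have s0 : 0 <= nrm a b + nrm a' b' by rewrite addr_ge0 ?sqrtr_ge0.
rewrite -[leRHS](ger0_norm s0) -sqrtr_sqr; apply: ler_wsqrtr.
rewrite [X in _ <= X]sqrrD !nrm_sqr.
have cs : a * a' + b * b' <= nrm a b * nrm a' b'.
  rewrite /nrm -sqrtrM //; apply: (le_trans (ler_norm _)); rewrite -sqrtr_sqr; apply: ler_wsqrtr.
  by have := sqr_ge0 (a * b' - b * a'); lra.
lra.
Qed.

Lemma nrmM a b a' b' : nrm (a * a' - b * b') (a * b' + b * a') = nrm a b * nrm a' b'.
Proof.
rewrite /nrm -sqrtrM ?addr_ge0 ?sqr_ge0 //; congr Num.sqrt; ring.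
Qed.

Lemma nrm_cos_sin t : nrm (cos t) (sin t) = 1.
Proof. by rewrite /nrm cos2Dsin2 sqrtr1. Qed.

Lemma sum_cos_sin n t : \sum_(d < n) cos (d%:R * (2 * t)) = U n t * cos (n%:R * t - t) /\
  \sum_(d < n) sin (d%:R * (2 * t)) = U n t * sin (n%:R * t - t).
Proof.
elim: n => [|n [IH1 IH2]]; first by rewrite !big_ord0 /= !mul0r.
have e1 : n.+1%:R * t - t = n%:R * t by rewrite -natr1; ring.
have e2 : n%:R * (2 * t) = n%:R * t + n%:R * t by ring.
have hU := U_sin n t; have hc := cos2Dsin2 (n%:R * t).
rewrite !big_ord_recr /= IH1 IH2 e1 e2 cosB sinB cosD sinD; split.
  have -> : U n t * (cos (n%:R * t) * cos t + sin (n%:R * t) * sin t) =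
    U n t * cos (n%:R * t) * cos t + sin (n%:R * t) * (U n t * sin t) by ring.
  by rewrite hU; ring.
have -> : U n t * (sin (n%:R * t) * cos t - cos (n%:R * t) * sin t) =
  U n t * sin (n%:R * t) * cos t - cos (n%:R * t) * (U n t * sin t) by ring.
by rewrite hU; ring.
Qed.

Lemma nrm_kernel (q : nat) y : nrm (\sum_(d < q) cos (d%:R * (2 * (pi * y)))) (\sum_(d < q) sin (d%:R * (2 * (pi * y))))
  = dirichlet_abs q y.
Proof.
have [-> ->] := sum_cos_sin q (pi * y).
rewrite /nrm !exprMn -mulrDr cos2Dsin2 mulr1 sqrtr_sqr dirichlet_absE //.
Qed.

Variables (q : nat) (hq : (2 <= q)%N).

Definition phase c x (n : nat) : R := 2 * pi * (c * (digsum q n)%:R + n%:R * x).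
Definition sumC c x N := \sum_(n < N) cos (phase c x n).
Definition sumS c x N := \sum_(n < N) sin (phase c x n).

Lemma phase_rec c x m d : (d < q)%N -> phase c x (q * m + d) = phase c (q%:R * x) m + d%:R * (2 * (pi * (x + c))).
Proof. by move=> dq; rewrite /phase digsum_rec // !natrD natrM; ring. Qed.

(** Since the digit sum of q m + d is that of m plus d, the sum of length q M at x is the kernel at
    x + c times the sum of length M at q x. The two equations are the real and imaginary parts of
    this product. *)
Lemma sum_blocks c x M :
  let Dc := \sum_(d < q) cos (d%:R * (2 * (pi * (x + c)))) in
  let Ds := \sum_(d < q) sin (d%:R * (2 * (pi * (x + c)))) in
  sumC c x (q * M) = Dc * sumC c (q%:R * x) M - Ds * sumS c (q%:R * x) M /\
  sumS c x (q * M) = Dc * sumS c (q%:R * x) M + Ds * sumC c (q%:R * x) M.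
Proof.
move=> Dc Ds; elim: M => [|M [IH1 IH2]].
  by rewrite muln0 /sumC /sumS !big_ord0 !mulr0 subr0 addr0.
rewrite /sumC /sumS in IH1 IH2 *.
rewrite mulnS addnC !big_split_ord /= IH1 IH2 !big_ord_recr /=.
have ec : \sum_(i < q) cos (phase c x (q * M + i)) =
    cos (phase c (q%:R * x) M) * Dc - sin (phase c (q%:R * x) M) * Ds.
  rewrite /Dc /Ds !mulr_sumr -sumrB; apply: eq_bigr => i _.
  by rewrite phase_rec ?ltn_ord // cosD.
have es : \sum_(i < q) sin (phase c x (q * M + i)) =
    sin (phase c (q%:R * x) M) * Dc + cos (phase c (q%:R * x) M) * Ds.
  rewrite /Dc /Ds !mulr_sumr -big_split /=; apply: eq_bigr => i _.
  by rewrite phase_rec ?ltn_ord // sinD.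
by rewrite ec es; split; ring.
Qed.

Lemma nrm_sum_le (f : nat -> R) r : nrm (\sum_(n < r) cos (f n)) (\sum_(n < r) sin (f n)) <= r%:R.
Proof.
elim: r => [|r IH]; first by rewrite !big_ord0 /nrm !expr0n /= addr0 sqrtr0.
rewrite !big_ord_recr /= -natr1; apply: (le_trans (nrmD _ _ _ _)).
by rewrite nrm_cos_sin lerD2r.
Qed.

Lemma sum_step c x N : nrm (sumC c x N) (sumS c x N) <=
  dirichlet_abs q (x + c) * nrm (sumC c (q%:R * x) (N %/ q)) (sumS c (q%:R * x) (N %/ q)) + q%:R.
Proof.
have q0 : (0 < q)%N by exact: ltn_trans hq.
have E : N = (q * (N %/ q) + N %% q)%N by rewrite {1}(divn_eq N q) mulnC.
have [h1 h2] := sum_blocks c x (N %/ q).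
have e1 : sumC c x N = sumC c x (q * (N %/ q)) + \sum_(i < N %% q) cos (phase c x (q * (N %/ q) + i)).
  by rewrite {1}E /sumC big_split_ord.
have e2 : sumS c x N = sumS c x (q * (N %/ q)) + \sum_(i < N %% q) sin (phase c x (q * (N %/ q) + i)).
  by rewrite {1}E /sumS big_split_ord.
rewrite e1 e2; apply: (le_trans (nrmD _ _ _ _)); apply: lerD.
  by rewrite h1 h2 nrmM nrm_kernel.
apply: (le_trans (nrm_sum_le (fun i => phase c x (q * (N %/ q) + i)) _)).
by rewrite ler_nat ltnW // ltn_mod.
Qed.

Lemma dirichlet_subaction c ga be psi x : subaction q c ga be psi ->
  dirichlet_abs q (x + c) * expR (psi x) <= expR be * expR (psi (q%:R * x)).
Proof.
move=> [_ _ H1 H2].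
have [->|d0] := eqVneq (dirichlet_abs q (x + c)) 0.
  by rewrite mul0r mulr_ge0 // expR_ge0.
have dp : 0 < dirichlet_abs q (x + c) by rewrite lt_neqAle eq_sym d0 dirichlet_abs_ge0.
have I : ln (dirichlet_abs q (x + c)) + psi x - psi (q%:R * x) <= be.
  by case: (leP (frac (x - ga)) q%:R^-1) => hx; [have [_ ->] := H1 x hx|apply/ltW/H2].
rewrite -{1}(lnK dp) -!expRD ler_expR; lra.
Qed.

(** With the weight exp (psi x), removing the last digit of N gives s(k+1) <= L s(k) + q exp M,
    where L = exp be. The statement is the sum of the resulting geometric series, cleared of the
    denominator L - 1, which is positive because be > 0. *)
Lemma sum_bound c ga be psi M : subaction q c ga be psi -> (forall x, `|psi x| <= M) ->
  forall k N x, (N < q ^ k)%N ->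
  nrm (sumC c x N) (sumS c x N) * expR (psi x) * (expR be - 1) <= q%:R * expR M * (expR be ^+ k - 1).
Proof.
move=> S hM; have be0 := subaction_value_gt0 hq S.
have lam1 : 1 < expR be by rewrite expR_gt1.
elim=> [|k IH] N x hN.
  have -> : N = 0%N by case: N hN.
  by rewrite /sumC /sumS !big_ord0 /nrm !expr0n /= addr0 sqrtr0 !mul0r subrr mulr0.
have q0 : (0 < q)%N by exact: ltn_trans hq.
have hN' : (N %/ q < q ^ k)%N by rewrite ltn_divLR // -expnSr.
have {}IH := IH _ (q%:R * x) hN'.
set A := nrm _ _ in IH.
have st := sum_step c x N; rewrite -/A in st.
have ex0 : 0 < expR (psi x) := expR_gt0 _.
have eM : expR (psi x) <= expR M by rewrite ler_expR; apply: le_trans (hM x); exact: ler_norm.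
have A0 : 0 <= A by rewrite sqrtr_ge0.
have l0 : 0 <= expR be - 1 by rewrite subr_ge0 ltW.
have s1 : nrm (sumC c x N) (sumS c x N) * expR (psi x) <= expR be * (A * expR (psi (q%:R * x))) + q%:R * expR M.
  have t1 := ler_wpM2r (ltW ex0) st; apply: (le_trans t1); rewrite mulrDl; apply: lerD; last first.
    by apply: ler_wpM2l.
  rewrite mulrAC mulrC [X in _ <= X]mulrCA; apply: ler_wpM2l => //.
  exact: dirichlet_subaction S.
have s2 := ler_wpM2r l0 s1; apply: (le_trans s2).
have s3 : expR be * (A * expR (psi (q%:R * x)) * (expR be - 1)) <= expR be * (q%:R * expR M * (expR be ^+ k - 1)).
  by apply: ler_wpM2l => //; exact: expR_ge0.
rewrite exprS; lra.
Qed.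

Theorem gelfond_bound c : exists C : R, 0 < C /\
  forall (x : R) (N : nat), 0 <= x < 1 -> (1 <= N)%N ->
    Num.sqrt ((\sum_(n < N) cos (2 * pi * (c * (digsum q n)%:R + n%:R * x))) ^+ 2
            + (\sum_(n < N) sin (2 * pi * (c * (digsum q n)%:R + n%:R * x))) ^+ 2)
    <= C * powR (N%:R) (fine (beta q c) / ln (q%:R)).
Proof.
have [al [Ph [be [psi [_ _ _ S]]]]] := subaction_exists hq c.
have [M [M0 hM]] := subaction_bounded S.
have be0 := subaction_value_gt0 hq S.
rewrite (beta_subaction hq S) /=.
have lam1 : 1 < expR be by rewrite expR_gt1.
have Q := q_gt0 R hq; have q1 : (1 < q)%N := hq.
exists (expR M * (q%:R * expR M) * expR be / (expR be - 1)); split.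
  by rewrite divr_gt0 ?subr_gt0 // !mulr_gt0 // ?expR_gt0.
move=> x N _ N1; rewrite -/(phase _ _ _).
(* With q^j <= N < q^(j+1), the bound is used with j + 1 digits, and exp (j be) = (q^j)^(be / ln q)
   is at most N^(be / ln q). *)
have /andP[j1 j2] := trunc_log_bounds q1 N1; set j := trunc_log q N in j1 j2.
have lq : 0 < ln q%:R :> R by rewrite ln_gt0 // ltr1n.
have pw : expR be ^+ j <= powR N%:R (be / ln q%:R).
  have -> : expR be ^+ j = powR (q ^ j)%N%:R (be / ln q%:R).
    rewrite /powR gt_eqF ?ltr0n ?expn_gt0 ?(ltnW q1) // natrX lnXn // -expRM_natr -[ln _ *+ j]mulr_natr.
    by congr expR; field; exact: lt0r_neq0.
  apply: ge0_ler_powR; rewrite ?nnegrE ?ler0n ?ler_nat //.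
  by rewrite divr_ge0 // ltW.
have B := sum_bound S hM x j2.
have ex1 : expR (- M) <= expR (psi x) by rewrite ler_expR; have := hM x; rewrite ler_norml => /andP[].
have l0 : 0 < expR be - 1 by rewrite subr_gt0.
set A := nrm _ _ in B.
have A0 : 0 <= A by rewrite sqrtr_ge0.
change (A <= expR M * (q%:R * expR M) * expR be / (expR be - 1) * powR N%:R (be / ln q%:R)).
have b1 : A * expR (- M) * (expR be - 1) <= q%:R * expR M * (expR be * powR N%:R (be / ln q%:R)).
  apply: (@le_trans _ _ (A * expR (psi x) * (expR be - 1))).
    by apply: ler_wpM2r; [exact: ltW|apply: ler_wpM2l].
  apply: (le_trans B); apply: ler_wpM2l; first by rewrite mulr_ge0 // expR_ge0.
  rewrite exprS; apply: (@le_trans _ _ (expR be * expR be ^+ j)); first by rewrite gerBl.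
  by apply: ler_wpM2l => //; exact: expR_ge0.
rewrite mulrAC ler_pdivlMr //.
have := ler_wpM2l (expR_ge0 M) b1.
have -> : expR M * (A * expR (- M) * (expR be - 1)) = (expR M * expR (- M)) * (A * (expR be - 1)) by ring.
rewrite -expRD subrr expR0 mul1r => h; apply: (le_trans h).
by rewrite le_eqVlt; apply/orP; left; apply/eqP; ring.
Qed.

End ExponentialSums.

(** * Non-periodic parameters *)

Section Comparison.
Variables (R : realType) (q : nat) (hq : (2 <= q)%N).
Implicit Types (al ka d K ga x y : R) (e Ph : R -> R).
Notation w := (omega R q).
Notation LU := (@logU R q).
Notation V := (@dlogU R q).

(** A one-sided form of [coh_dep] that keeps the signed slope B of e - e'; for B < 0 the middle term
    is a strict gain. *)
Lemma coh_compare d d' e e' K Ph Ph' B : coh q d e K Ph -> coh q d' e' K Ph' ->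
  (forall u v, 0 <= u -> u <= v -> v <= 1 -> (e v - e' v) - (e u - e' u) <= B * (v - u)) ->
  forall n, Ph 1 - Ph' 1 <= 2 ^+ n.+1 * (2 * K * `|d - d'|) + B * q%:R / (q%:R - 1) +
    (2 * K + `|B * q%:R / (q%:R - 1)|) / 2 ^+ n.
Proof.
move=> [qp eqn lip] [qp' eqn' lip'] he n.
have Q2 := q_ge2 R hq; have Q0 := q_gt0 R hq.
have [S SE SB] : exists2 S, S = B * q%:R / (q%:R - 1) & B = S - S / q%:R.
  by exists (B * q%:R / (q%:R - 1)) => //; field; apply/andP; split; apply: lt0r_neq0; lra.
rewrite -SE; set E := 2 * K * _.
have Qi : q%:R^-1 <= 2^-1 :> R by rewrite lef_pV2 ?posrE.
have K0 : 0 <= K by have := lip 0 1 ler01; rewrite subr0 mulr1; exact: le_trans.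
have E0 : 0 <= E by rewrite !mulr_ge0.
have [M ME M0] : exists2 M, M = 2 * K + `|S| & 0 <= M.
  by exists (2 * K + `|S|) => //; rewrite addr_ge0 // mulr_ge0.
rewrite -ME.
pose D v := Ph v - Ph' v.
have qD : quasiper D by move=> v; rewrite /D qp qp'; ring.
have lip2 x y : `|Ph' y - Ph' x| <= K * `|y - x|.
  case: (leP x y) => xy; first by rewrite (ger0_norm (_ : 0 <= y - x)) ?subr_ge0 //; exact: lip'.
  have x0 : 0 <= x - y by rewrite subr_ge0 ltW.
  by rewrite distrC [`|y - x|]distrC (ger0_norm x0); exact: lip' (ltW xy).
have claim m x y : x <= y -> y <= x + 1 ->
    D y - D x <= (2 ^+ m.+1 - 2) * E + (S + M / 2 ^+ m) * (y - x).
  elim: m x y => [|m IH] x y xy yx.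
    rewrite expr1 subrr mul0r add0r expr0 divr1.
    have h1 := lip x y xy; have h2 := lip' x y xy.
    have h3 : 2 * K * (y - x) <= (S + M) * (y - x).
      by apply: ler_wpM2r; rewrite ?subr_ge0 //; have := ler_norm (- S); rewrite normrN ME; lra.
    by rewrite /D; rewrite !ler_norml in h1 h2; lra.
  have loc u v : 0 <= u -> u <= v -> v <= 1 ->
      D v - D u <= (2 ^+ m.+1 - 1) * E + (S + M / 2 ^+ m.+1) * (v - u).
    move=> u0 uv v1.
    have dq : d + v / q%:R - (d + u / q%:R) = (v - u) / q%:R by field; rewrite gt_eqF.
    have i1 : (v - u) / q%:R <= v - u by rewrite ler_piMr ?subr_ge0 // invf_le1 //; lra.
    have duv : d + u / q%:R <= d + v / q%:R by rewrite lerD2l ler_pM2r ?invr_gt0.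
    have G := IH _ _ duv; rewrite dq in G.
    have {}G := G ltac:(lra).
    have H := he u v u0 uv v1.
    have L1 := lip2 (d + v / q%:R) (d' + v / q%:R); have L2 := lip2 (d + u / q%:R) (d' + u / q%:R).
    have ds z : `|d' + z - (d + z)| = `|d - d'| by rewrite distrC; congr `|_|; ring.
    rewrite !ds in L1 L2.
    have i2 : M / 2 ^+ m * ((v - u) / q%:R) <= M / 2 ^+ m.+1 * (v - u).
      have -> : M / 2 ^+ m.+1 * (v - u) = M / 2 ^+ m * ((v - u) * 2^-1).
        by rewrite exprS; field; rewrite expf_neq0.
      apply: ler_wpM2l; first by rewrite divr_ge0 // exprn_ge0.
      by apply: ler_wpM2l => //; rewrite subr_ge0.
    have j1 : 0 <= v <= 1 by lra.
    have j2 : 0 <= u <= 1 by lra.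
    have i3 : (2 ^+ m.+1 - 1) * E = (2 ^+ m.+1 - 2) * E + 2 * K * `|d - d'| by rewrite /E; ring.
    have i4 : B * (v - u) + S * ((v - u) / q%:R) = S * (v - u) by rewrite SB; ring.
    rewrite i3 /D (eqn v j1) (eqn u j2) (eqn' v j1) (eqn' u j2).
    rewrite (mulrDl S) in G; rewrite (mulrDl S) -i4.
    clear -G H L1 L2 i2; rewrite /D !ler_norml in G H L1 L2 *; lra.
  have a0 : 0 <= (2 ^+ m.+1 - 1) * E.
    by rewrite mulr_ge0 // subr_ge0 exprn_ege1 // ler1n.
  have i4 : (2 ^+ m.+2 - 2) * E = 2 * ((2 ^+ m.+1 - 1) * E) by rewrite [in LHS]exprS; ring.
  by rewrite i4; apply: (quasiper_split qD).
have := claim n 0 1 ler01; rewrite add0r => /(_ (lexx _)).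
have D0 : D 0 = 0 := quasiper0 qD.
rewrite D0 !subr0 mulr1 => h; apply: (le_trans h).
have : (2 ^+ n.+1 - 2) * E <= 2 ^+ n.+1 * E by apply: ler_wpM2r => //; lra.
lra.
Qed.

(** The equation depends on c only through the left end of the arc, which is why comparing left ends
    suffices below. *)
Lemma shift_start c al : arc_shift q al (pi * (q%:R - 1) * c) = - ((q%:R - 1) * arc_start c al).
Proof.
rewrite /arc_shift /arc_start.
have -> : ((q%:R - 1) * al + pi * (q%:R - 1) * c) / pi = (q%:R - 1) * (al / pi) + (q%:R - 1) * c * (pi / pi) by ring.
by rewrite divff ?gt_eqF ?pi_gt0 //; ring.
Qed.

Definition cmp_const : R := (16 * (q%:R * arc_lip R q) + 8 * w) / w.

Lemma cmp_const_ge0 : 0 <= cmp_const.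
Proof.
have w0 := omega_gt0 R hq; have Q := q_gt0 R hq; have a0 := arc_lip_ge0 R hq.
apply: divr_ge0; last exact: ltW.
by apply: addr_ge0; apply: mulr_ge0 => //; [apply: mulr_ge0 => //; exact: ltW|exact: ltW].
Qed.

(** Suppose al < al'. Strong concavity of [LU] makes arc_incr al - arc_incr al' decrease at rate at
    least w (al' - al) / 2. As Ph 1 = Ph' 1 = 0, [coh_compare] then bounds w (al' - al) / 2 by the
    distance of the left ends, magnified by a multiple of 2^n, plus a tail of order 2^-n. *)
Lemma arc_compare c c' al al' Ph Ph' n :
  arc_eta R q <= al <= w - arc_eta R q -> arc_eta R q <= al' <= w - arc_eta R q ->
  coh q (arc_shift q al (pi * (q%:R - 1) * c)) (arc_incr q al) (2 * arc_lip R q) Ph ->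
  coh q (arc_shift q al' (pi * (q%:R - 1) * c')) (arc_incr q al') (2 * arc_lip R q) Ph' ->
  Ph 1 = 0 -> Ph' 1 = 0 ->
  `|al - al'| <= cmp_const * (2 ^+ n * `|arc_start c al - arc_start c' al'| + 1 / 2 ^+ n).
Proof.
have [e0 e1] := eta_itv R hq; have w0 := omega_gt0 R hq; have p0 := @pi_gt0 R.
have Q2 := q_ge2 R hq; have Q := q_gt0 R hq; have A0 := arc_lip_ge0 R hq.
move=> h h' C C' W W'.
wlog hle : c c' al al' Ph Ph' h h' C C' W W' / al <= al'.
  move=> G; case: (leP al al') => hl; first exact: G C C' W W' hl.
  by rewrite distrC [`|arc_start _ _ - _|]distrC; exact: G C' C W' W (ltW hl).
move: hle; rewrite le_eqVlt => /predU1P[->|hlt].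
  rewrite subrr normr0 mulr_ge0 ?cmp_const_ge0 // addr_ge0 ?mulr_ge0 ?divr_ge0 ?exprn_ge0 //.
pose de := al' - al.
have d0 : 0 < de by rewrite subr_gt0.
have dw : de <= w by rewrite /de; lra.
have hcmp u v : 0 <= u -> u <= v -> v <= 1 ->
   (arc_incr q al v - arc_incr q al' v) - (arc_incr q al u - arc_incr q al' u) <= - (w * de / 2) * (v - u).
  move=> u0; rewrite le_eqVlt => /predU1P[->|uv] v1; first by rewrite !subrr mulr0.
  have i1 : w * u < w * v by rewrite ltr_pM2l.
  have i2 : w * v <= w by rewrite ler_piMr // ltW.
  have i3 : 0 <= w * u by rewrite mulr_ge0 // ltW.
  have lt : - al' + w * u < - al' + w * v by rewrite ltrD2l.
  have [x hx|z [hz E]] := @mvt_cc R (fun z => LU (z + de) - LU z) (fun z => V (z + de) * (1 + 0) - V z) _ _ lt.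
    apply: hderivB; last by apply: hderiv_LU => //; lra.
    apply: (@hderiv_comp R LU); last by apply: hderivD; [exact: hderiv_id|exact: hderiv_cst].
    by apply: hderiv_LU => //; rewrite /de; lra.
  have s1 : - al' + w * v + de = - al + w * v by rewrite /de; ring.
  have s2 : - al' + w * u + de = - al + w * u by rewrite /de; ring.
  rewrite s1 s2 addr0 mulr1 in E.
  have -> : arc_incr q al v - arc_incr q al' v - (arc_incr q al u - arc_incr q al' u) =
    LU (- al + w * v) - LU (- al' + w * v) - (LU (- al + w * u) - LU (- al' + w * u)) by rewrite /arc_incr; ring.
  rewrite E.
  have vd : V (z + de) - V z <= - (de / 2).
    have hz2 : z <= z + de by rewrite lerDl ltW.
    have := @V_decr R q hq z (z + de) ltac:(lra) hz2 ltac:(rewrite /de; lra).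
    by have -> : z + de - z = de by ring.
  have -> : - al' + w * v - (- al' + w * u) = w * (v - u) by ring.
  have -> : - (w * de / 2) * (v - u) = - (de / 2) * (w * (v - u)) by ring.
  by apply: ler_wpM2r => //; rewrite mulr_ge0 ?subr_ge0 ?ltW.
have := coh_compare C C' hcmp n; rewrite W W' subrr.
have -> : `|arc_shift q al (pi * (q%:R - 1) * c) - arc_shift q al' (pi * (q%:R - 1) * c')| =
    (q%:R - 1) * `|arc_start c al - arc_start c' al'|.
  have -> : arc_shift q al (pi * (q%:R - 1) * c) - arc_shift q al' (pi * (q%:R - 1) * c') =
    - ((q%:R - 1) * (arc_start c al - arc_start c' al')).
    by rewrite !shift_start; ring.
  by rewrite normrN normrM ger0_norm // subr_ge0; lra.
set g := `|arc_start c al - _|; have g0 : 0 <= g := normr_ge0 _.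
have T0 : 0 < 2 ^+ n :> R by rewrite exprn_gt0.
have q1 : 0 < q%:R - 1 :> R by lra.
have r1 : 1 <= q%:R / (q%:R - 1) :> R by rewrite ler_pdivlMr //; lra.
have r2 : q%:R / (q%:R - 1) <= 2 :> R by rewrite ler_pdivrMr //; lra.
have wd0 : 0 < w * de by rewrite mulr_gt0.
have b1 : - (w * de / 2) * q%:R / (q%:R - 1) <= - (w * de / 2).
  by rewrite -mulrA mulNr lerN2 ler_peMr // divr_ge0 ?ltW.
have b2 : `|- (w * de / 2) * q%:R / (q%:R - 1)| <= w * w.
  rewrite -mulrA mulNr normrN ger0_norm; last by rewrite !mulr_ge0 ?invr_ge0 ?ltW.
  have : w * de / 2 * (q%:R / (q%:R - 1)) <= w * w / 2 * 2.
    by apply: ler_pM; [rewrite divr_ge0 // ltW|rewrite divr_ge0 // ltW|rewrite ler_pM2r // ler_pM2l|exact: r2].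
  lra.
rewrite [`|al - al'|]distrC -/de (ger0_norm (ltW d0)).
move=> I.
have i1 : (2 * (2 * arc_lip R q) + `|- (w * de / 2) * q%:R / (q%:R - 1)|) / 2 ^+ n <= (4 * arc_lip R q + w * w) * (1 / 2 ^+ n).
  by rewrite mul1r; apply: ler_wpM2r; [rewrite invr_ge0 ltW|lra].
have i2 : 2 ^+ n.+1 * (2 * (2 * arc_lip R q) * ((q%:R - 1) * g)) <= 8 * (q%:R * arc_lip R q) * (2 ^+ n * g).
  have -> : 2 ^+ n.+1 * (2 * (2 * arc_lip R q) * ((q%:R - 1) * g)) = 8 * ((q%:R - 1) * arc_lip R q) * (2 ^+ n * g).
    by rewrite exprS; ring.
  apply: ler_wpM2r; first by rewrite mulr_ge0 // ltW.
  by apply: ler_wpM2l => //; apply: ler_wpM2r => //; clear; lra.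
have tg : 0 <= 2 ^+ n * g by rewrite mulr_ge0 // ltW.
have t1 : 0 <= 1 / 2 ^+ n :> R by rewrite divr_ge0 // ltW.
have wle : w <= 4 by have := omega_le R hq; have := @pi_lt R; clear; lra.
have ww : w * w <= 4 * w by rewrite ler_pM2r.
have qA : arc_lip R q <= q%:R * arc_lip R q by rewrite ler_peMl //; clear -Q2; lra.
have k1 : 8 * (q%:R * arc_lip R q) * (2 ^+ n * g) <= (8 * (q%:R * arc_lip R q) + 4 * w) * (2 ^+ n * g).
  by apply: ler_wpM2r => //; clear -w0; lra.
have k2 : (4 * arc_lip R q + w * w) * (1 / 2 ^+ n) <= (8 * (q%:R * arc_lip R q) + 4 * w) * (1 / 2 ^+ n).
  have qa0 : 0 <= q%:R * arc_lip R q by rewrite mulr_ge0 // ltW.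
  by apply: ler_wpM2r => //; clear -ww qA qa0; lra.
have fin : w * de <= (16 * (q%:R * arc_lip R q) + 8 * w) * (2 ^+ n * g + 1 / 2 ^+ n).
  have -> : (16 * (q%:R * arc_lip R q) + 8 * w) * (2 ^+ n * g + 1 / 2 ^+ n) =
    2 * ((8 * (q%:R * arc_lip R q) + 4 * w) * (2 ^+ n * g) + (8 * (q%:R * arc_lip R q) + 4 * w) * (1 / 2 ^+ n)) by ring.
  lra.
by rewrite /cmp_const mulrAC ler_pdivlMr // mulrC.
Qed.

End Comparison.

(** * Rotation codes, and periodic orbits for rational rotation numbers *)

Section Coding.
Variables (R : realType) (q : nat) (hq : (2 <= q)%N).
Implicit Types (ga rho x : R).

Definition rotation ga rho := forall n x, `|iter n (cmap q ga) x - x - n%:R * rho| <= 2.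
Definition irrational_slope rho := forall (n : nat) (m : int), (0 < n)%N -> n%:R * rho != m%:~R.

Lemma iter_ge ga n (j : int) x p : x + j%:~R <= iter n (cmap q ga) x ->
  x + p%:R * j%:~R <= iter (n * p) (cmap q ga) x.
Proof.
move=> h; elim: p => [|p IH]; first by rewrite mul0r addr0 muln0.
rewrite mulnS iterD; apply: le_trans (cmap_iter_mono hq ga n IH).
have -> : x + p%:R * j%:~R = x + (p%:Z * j)%:~R by rewrite intrM.
by rewrite cmap_iterDz intrM -natr1; have := h; lra.
Qed.

Lemma iter_le ga n (j : int) x p : iter n (cmap q ga) x <= x + j%:~R ->
  iter (n * p) (cmap q ga) x <= x + p%:R * j%:~R.
Proof.
move=> h; elim: p => [|p IH]; first by rewrite mul0r addr0 muln0.
rewrite mulnS iterD; apply: le_trans (cmap_iter_mono hq ga n IH) _.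
have -> : x + p%:R * j%:~R = x + (p%:Z * j)%:~R by rewrite intrM.
by rewrite cmap_iterDz intrM -natr1; have := h; lra.
Qed.

Lemma arch_le (a b : R) : (forall p : nat, p%:R * a <= p%:R * b + 2) -> a <= b.
Proof.
move=> h; rewrite -subr_le0; apply: (@le_half_pow0 _ _ 2) => n.
rewrite ler_pdivlMr ?exprn_gt0 // mulrC mulrBr.
by have := h (2 ^ n)%N; rewrite natrX; lra.
Qed.

Lemma rotation_ge ga rho n (j : int) x : rotation ga rho -> x + j%:~R <= iter n (cmap q ga) x -> j%:~R <= n%:R * rho.
Proof.
move=> H h; apply: arch_le => p; have := iter_ge p h; have := H (n * p)%N x.
by rewrite natrM ler_norml; lra.
Qed.

Lemma rotation_le ga rho n (j : int) x : rotation ga rho -> iter n (cmap q ga) x <= x + j%:~R -> n%:R * rho <= j%:~R.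
Proof.
move=> H h; apply: arch_le => p; have := iter_le p h; have := H (n * p)%N x.
by rewrite natrM ler_norml; lra.
Qed.

(** If the orbit of ga entered a gap, say in the cell of ga + j, [cmap] would send that point to the
    image of ga + j + 1. Then cmap ga would return to itself up to the integer j + 1 after finitely
    many steps, and rho would be rational. *)
Lemma orbit_code ga rho m : rotation ga rho -> irrational_slope rho ->
  exists2 u, 0 <= u <= q%:R^-1 & iter m (cmap q ga) ga = ga + (Num.floor (m%:R * rho))%:~R + u.
Proof.
move=> H irr; have Q := q_gt0 R hq; have Q2 := q_ge2 R hq.
have qi : 0 < q%:R^-1 :> R by rewrite invr_gt0.
case: m => [|m]; first by exists 0; rewrite ?lexx ?(ltW qi) // mul0r floor0 /= !addr0.
set z := iter m.+1 (cmap q ga) ga; set j := Num.floor (z - ga); set u := frac (z - ga).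
have /andP[u0 u1] : 0 <= u < 1 := frac_itv (z - ga).
have ez : z = ga + j%:~R + u by have := floorD_frac (z - ga); rewrite -/j -/u; lra.
have l1 : j%:~R <= m.+1%:R * rho by apply: (rotation_ge (x := ga) H); rewrite -/z; lra.
have l2 : m.+1%:R * rho <= (j + 1)%:~R by apply: (rotation_le (x := ga) H); rewrite -/z intrD; lra.
have fl : Num.floor (m.+1%:R * rho) = j by apply: floor_def; rewrite l1 lt_neqAle l2 irr.
exists u; last by rewrite fl.
rewrite u0 leNgt; apply/negP => hu.
have g0 : cmap q ga ga = q%:R * ga.
  rewrite (@cmap_def R q hq ga ga 0 0) ?lexx ?ler01 //; last by rewrite !addr0.
  by rewrite mulr0 addr0 (min_idPl _) ?addr0.
have Fz : cmap q ga z = cmap q ga ga + (j + 1)%:~R.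
  by rewrite (@cmap_gap R q hq ga z j) ?g0 ?intrD; [ring|lra].
have E : iter m.+1 (cmap q ga) (cmap q ga ga) = cmap q ga ga + (j + 1)%:~R by rewrite -Fz -iterS -iterSr.
have r1 : (j + 1)%:~R <= m.+1%:R * rho by apply: (rotation_ge (x := cmap q ga ga) H); rewrite E.
by have := irr m.+1 (j + 1) isT; rewrite eq_le l2 r1.
Qed.

(** Along the arc [cmap] is affine with slope q and a constant fixed by the code, so equal codes
    give a difference q^n (ga - ga') after n steps. Both n-th points also lie in the same translate
    of their own arcs, so this difference is ga - ga' up to an error at most 1. *)
Lemma same_code_close ga ga' rho rho' n : rotation ga rho -> irrational_slope rho -> rotation ga' rho' -> irrational_slope rho' ->
  (forall m, (m <= n)%N -> Num.floor (m%:R * rho) = Num.floor (m%:R * rho')) ->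
  (q%:R ^+ n - 1) * `|ga - ga'| <= 1.
Proof.
move=> H irr H' irr' same; have Q := q_gt0 R hq; have Q2 := q_ge2 R hq.
have qi : q%:R^-1 <= 1 :> R by rewrite invf_le1 //; lra.
have step g r m : rotation g r -> irrational_slope r ->
    iter m.+1 (cmap q g) g = q%:R * iter m (cmap q g) g - (q%:R - 1) * (Num.floor (m%:R * r))%:~R.
  move=> h i; rewrite iterS; have [u hu ->] := orbit_code m h i.
  have qu : q%:R * u <= 1 by rewrite -ler_pdivlMl // mulr1; case/andP: hu.
  rewrite (@cmap_def R q hq g _ (Num.floor (m%:R * r)) u) //; last by case/andP: hu => -> h1; exact: le_trans h1 qi.
  by rewrite (min_idPl qu); ring.
have lin m : (m <= n)%N -> iter m (cmap q ga) ga - iter m (cmap q ga') ga' = q%:R ^+ m * (ga - ga').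
  elim: m => [|m IH] hm; first by rewrite expr0 mul1r.
  by rewrite (step _ _ _ H irr) (step _ _ _ H' irr') (same m (ltnW hm)) exprS -mulrA -(IH (ltnW hm)); ring.
have E := lin n (leqnn n).
have [u hu e1] := orbit_code n H irr; have [u' hu' e2] := orbit_code n H' irr'.
rewrite e1 e2 (same n (leqnn n)) in E.
have p1 : 0 <= q%:R ^+ n - 1 :> R by rewrite subr_ge0 exprn_ege1 //; lra.
rewrite -(ger0_norm p1) -normrM mulrBl mul1r -E ler_norml; lra.
Qed.


Lemma sum_cyclic (f : nat -> R) n : f n = f 0 -> \sum_(k < n) f k.+1 = \sum_(k < n) f k.
Proof.
case: n => [|n] e; first by rewrite !big_ord0.
by rewrite big_ord_recr [RHS]big_ord_recl /= e addrC.
Qed.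

Section PeriodicMeasure.
Variables (x0 : R) (n : nat).
Hypothesis n0 : (0 < n)%N.
Hypothesis tx : torus x0.
Hypothesis per : iter n (Tmap q) x0 = x0.

Lemma orbit_torus k : torus (iter k (Tmap q) x0).
Proof. by case: k => [//|k]; rewrite iterS; exact: torus_frac. Qed.

Lemma orbit_measure : exists mu : {measure set R -> \bar R}, inv_prob q mu /\
  (forall A, measurable A -> (forall k, (k < n)%N -> ~ A (iter k (Tmap q) x0)) -> mu A = 0%E) /\
  mu [set y | exists k : nat, (k < n)%N /\ y = iter k (Tmap q) x0] = 1%E.
Proof.
pose o k := iter k (Tmap q) x0.
have rn : 0 <= n%:R^-1 :> R by rewrite invr_ge0.
pose m : {measure set R -> \bar R} := mscale (NngNum rn) (msum (fun k => dirac (o k)) n).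
have nz : n%:R != 0 :> R by rewrite pnatr_eq0 -lt0n.
have mE A : m A = (n%:R^-1 * \sum_(k < n) (o k \in A)%:R)%:E.
  rewrite /m /= /mscale /= /msum EFinM; congr (_ * _)%E.
  by rewrite -sumEFin; apply: eq_bigr => k _; rewrite /= diracE.
have full A : (forall k, (k < n)%N -> A (o k)) -> m A = 1%E.
  move=> h; rewrite mE (eq_bigr (fun=> 1)); last by move=> k _; rewrite mem_set //; exact: h.
  by rewrite sumr_const card_ord mulVf.
have empty A : (forall k, (k < n)%N -> ~ A (o k)) -> m A = 0%E.
  move=> h; rewrite mE big1 ?mulr0 // => k _; rewrite memNset //; exact: h.
exists m; split; [split; [|split]|split] => //.
- by apply: full => k _; exact: orbit_torus.
- by apply: empty => k _; apply; exact: orbit_torus.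
- move=> A mA sA; rewrite !mE; congr (_ * _)%:E.
  have -> : \sum_(k < n) (o k \in @torus R `&` Tmap q @^-1` A)%:R = \sum_(k < n) (o k.+1 \in A)%:R :> R.
    apply: eq_bigr => k _; congr (nat_of_bool _)%:R; apply/idP/idP; rewrite !inE /=.
      by case.
    by split => //; exact: orbit_torus.
  by apply: (@sum_cyclic (fun k => (o k \in A)%:R)); rewrite /o per.
- by move=> A _; exact: empty.
- by apply: full => k kn; exists k.
Qed.

End PeriodicMeasure.

(** A rational rotation has periodic points; their image under [conj_proj] is a periodic orbit of
    [Tmap] in the arc. The uniform measure along it is carried by the arc, so it agrees with mu by
    uniqueness. *)
Lemma rational_periodic c ga be psi rho mu : subaction q c ga be psi -> rotation ga rho ->
  ~ irrational_slope rho -> inv_prob q mu -> integral_fc q c mu = beta q c -> periodic_measure q mu.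
Proof.
move=> S H nirr Hm Im.
have [n [m [n0 e]]] : exists (n : nat) (m : int), (0 < n)%N /\ n%:R * rho = m%:~R.
  apply: contrapT => h; apply: nirr => n m n0; apply/eqP => e; apply: h; by exists n, m.
pose x0 := conj_proj q ga rho 0.
have it k : iter k (Tmap q) x0 = conj_proj q ga rho (k%:R * rho).
  elim: k => [|k IH]; first by rewrite mul0r.
  by rewrite iterS IH (conj_proj_Tmap hq H) -natr1 mulrDl mul1r.
have per : iter n (Tmap q) x0 = x0.
  by rewrite it e -[m%:~R]add0r (perZ (conj_projD1 H)).
have tx : torus x0 := torus_frac _.
have [nu [Hn [emp full]]] := orbit_measure n0 tx per.
have on : nu (off_arc q ga) = 0%E.
  apply: emp; first exact: measurable_off_arc.
  by move=> k _; rewrite it /off_arc /= ltNge (conj_proj_arc hq H).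
have om : mu (off_arc q ga) = 0%E.
  by apply/(integral_fc_eq hq S Hm); rewrite Im; exact: beta_subaction S.
exists x0, n; split => //; split => //; split => //.
rewrite -full; apply: (arc_measure_unique hq Hm Hn om on).
have -> : [set y | exists k : nat, (k < n)%N /\ y = iter k (Tmap q) x0] =
   \bigcup_(k in [set k | (k < n)%N]) [set iter k (Tmap q) x0].
  by apply/seteqP; split => y /= [k]; [move=> [kn ->]; exists k|move=> kn ->; exists k].
by apply: bigcup_measurable => k _; exact: measurable_set1.
Qed.

End Coding.

(** * A covering criterion for Hausdorff dimension zero *)

Section HausdorffDimension.
Variable R : realType.
Implicit Types (E U : set R) (s C : R).

Lemma hterm_ge0 s U : (0 <= hterm s U)%E.
Proof. by rewrite /hterm; case: (pselect (U = set0)) => h //=; rewrite lee_fin powR_ge0. Qed.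

Lemma hterm_le s U d : 0 <= s -> 0 <= d -> (diam U <= d%:E)%E -> (hterm s U <= (powR d s)%:E)%E.
Proof.
move=> s0 d0 hU; rewrite /hterm; case: (pselect (U = set0)) => [h|ne] /=; first by rewrite lee_fin powR_ge0.
have [x Ux] : U !=set0 by apply/set0P/eqP.
have dx : (0 <= diam U)%E.
  by apply: ereal_sup_ubound; exists x => //; exists x => //; rewrite subrr normr0.
have fd : diam U \is a fin_num by rewrite ge0_fin_numE // (le_lt_trans hU) ?ltry.
rewrite lee_fin; apply: ge0_ler_powR; rewrite ?nnegrE ?fine_ge0 //.
by rewrite -lee_fin fineK.
Qed.

Lemma sum_le_const (u : nat -> \bar R) N (h : R) : 0 <= h ->
  (forall i, (i < N)%N -> (u i <= h%:E)%E) -> (forall i, (N <= i)%N -> u i = 0%E) ->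
  (forall i, (0 <= u i)%E) -> (\sum_(0 <= i <oo) u i <= (N%:R * h)%:E)%E.
Proof.
move=> h0 hN hz u0.
apply: lime_le; first by apply: is_cvg_nneseries => n _ _; exact: u0.
apply: nearW => k.
have : (\sum_(0 <= i < k) u i <= ((minn k N)%:R * h)%:E)%E.
  elim: k => [|k IH]; first by rewrite big_nil min0n mul0r.
  rewrite big_nat_recr //=.
  have [kN|Nk] := ltnP k N.
    rewrite (minn_idPl kN) -natr1 mulrDl mul1r EFinD; apply: leeD; last exact: hN.
    by apply: (le_trans IH); rewrite lee_fin ler_wpM2r // ler_nat geq_minl.
  by rewrite hz // adde0; apply: (le_trans IH); rewrite lee_fin ler_wpM2r // ler_nat !(minn_idPr _) // leqW.
move/le_trans; apply; rewrite lee_fin ler_wpM2r // ler_nat; exact: geq_minr.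
Qed.

Lemma poly_exp_small (A : nat) C s ep de : 0 < C -> 0 < s -> 0 < ep -> 0 < de ->
  exists n : nat, (A * n.+1 ^ 2)%N%:R * powR (C / 2 ^+ n) s <= ep /\ C / 2 ^+ n <= de.
Proof.
move=> C0 s0 ep0 de0.
have l2 : 0 < ln 2 :> R by apply: ln_gt0; lra.
pose h := s * ln 2; have h0 : 0 < h by rewrite mulr_gt0.
pose K := A%:R * powR C s * 24 / h ^+ 3.
have K0 : 0 <= K by rewrite divr_ge0 ?exprn_ge0 ?(ltW h0) // !mulr_ge0 // powR_ge0.
have [n [n0 t1 t2]] : exists n : nat, [/\ (0 < n)%N, K / ep < n%:R & C / de < n%:R].
  exists (Num.truncn (K / ep) + Num.truncn (C / de)).+1; split => //.
    by apply: (lt_le_trans (truncnS_gt _)); rewrite ler_nat ltnS leq_addr.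
  by apply: (lt_le_trans (truncnS_gt _)); rewrite ler_nat ltnS leq_addl.
have n1 : (n.+1 ^ 2)%N%:R <= 4 * n%:R ^+ 2 :> R.
  by rewrite -natrX -natrM ler_nat; nia.
have {}n0 : 0 < n%:R :> R by rewrite ltr0n.
have T0 : 0 < 2 ^+ n :> R by rewrite exprn_gt0.
exists n; split; last first.
  rewrite ler_pdivrMr // mulrC; rewrite ltr_pdivrMr // in t2.
  apply: (le_trans (ltW t2)); apply: ler_wpM2r; first exact: ltW.
  by rewrite -natrX ler_nat ltnW // ltn_expl.
have E : powR (C / 2 ^+ n) s = powR C s / expR (n%:R * h).
  rewrite /powR !gt_eqF ?divr_gt0 // -expRB; congr expR.
  by rewrite ln_div ?posrE // lnXn // -[ln 2 *+ n]mulr_natl /h mulrBr mulrCA.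
(* The cubic term of the exponential is enough against a number of cells quadratic in n. *)
have e3 : (n%:R * h) ^+ 3 / 6 <= expR (n%:R * h).
  have := @expR_ge1Dxn R (n%:R * h) 2 (ltW (mulr_gt0 n0 h0)).
  by apply: le_trans; rewrite (_ : 3`! = 6)%N // lerDr.
have x3 : 0 < (n%:R * h) ^+ 3 / 6 by rewrite divr_gt0 // exprn_gt0 // mulr_gt0.
have e4 : powR C s / expR (n%:R * h) <= powR C s / ((n%:R * h) ^+ 3 / 6).
  by apply: ler_wpM2l; [exact: powR_ge0|rewrite lef_pV2 ?posrE // expR_gt0].
rewrite natrM E.
apply: (@le_trans _ _ (A%:R * (4 * n%:R ^+ 2) * (powR C s / ((n%:R * h) ^+ 3 / 6)))).
  apply: ler_pM => //; first by rewrite divr_ge0 ?powR_ge0 // expR_ge0.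
  exact: ler_wpM2l.
have -> : A%:R * (4 * n%:R ^+ 2) * (powR C s / ((n%:R * h) ^+ 3 / 6)) = K / n%:R.
  by rewrite /K; field; rewrite !gt_eqF.
by rewrite ler_pdivrMr // mulrC -ler_pdivrMr // ltW.
Qed.

Lemma hausdorff_dim0 E (A : nat) C : 0 < C ->
  (forall n, exists U : nat -> set R, [/\ E `<=` \bigcup_i U i,
     (forall i, (diam (U i) <= (C / 2 ^+ n)%:E)%E) &
     (forall i, (A * n.+1 ^ 2 <= i)%N -> U i = set0)]) ->
  hausdorff_dim E = 0%E.
Proof.
move=> C0 H.
have c0 s de : 0 < s -> 0 < de -> hcontent s de E = 0%E.
  move=> s0 de0; apply/eqP; rewrite eq_le; apply/andP; split; last first.
    apply: le_ereal_inf_tmp => _ [U [_ _] <-].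
    by apply: nneseries_ge0 => n _ _; exact: hterm_ge0.
  apply/lee_addgt0Pr => ep ep0; rewrite add0e.
  have [n [h1 h2]] := poly_exp_small A C0 s0 ep0 de0.
  have [U [cov dU zU]] := H n.
  have d0 : 0 <= C / 2 ^+ n by rewrite divr_ge0 ?(ltW C0) // exprn_ge0.
  apply: (@le_trans _ _ (\sum_(0 <= i <oo) hterm s (U i))%E).
    apply: ereal_inf_lbound; exists U => //; split => // i.
    by apply: (le_trans (dU i)); rewrite lee_fin.
  have : (((A * n.+1 ^ 2)%N%:R * powR (C / 2 ^+ n) s)%:E <= ep%:E)%E by rewrite lee_fin.
  apply: le_trans; apply: sum_le_const.
  - exact: powR_ge0.
  - by move=> i _; apply: hterm_le => //; exact: ltW.
  - by move=> i hi; rewrite zU // /hterm; case: (pselect (set0 = set0 :> set R)) => // h.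
  - by move=> i; exact: hterm_ge0.
have m0 s : 0 < s -> hausdorff_measure s E = 0%E.
  move=> s0; apply/eqP; rewrite eq_le; apply/andP; split.
    by apply: ge_ereal_sup => _ [de de0 <-]; rewrite c0.
  by apply: ereal_sup_ubound; exists 1 => //=; rewrite ?ltr01 // c0.
apply/eqP; rewrite eq_le; apply/andP; split; last first.
  by apply: le_ereal_inf_tmp => _ [s [s0 _] <-]; rewrite lee_fin.
apply/lee_addgt0Pr => ep ep0; rewrite add0e.
by apply: ereal_inf_lbound; exists ep => //; split; [exact: ltW|exact: m0].
Qed.

End HausdorffDimension.

(** * Covering the non-periodic parameters by cells of equal code *)

Section NonPeriodic.
Variables (R : realType) (q : nat) (hq : (2 <= q)%N).
Implicit Types (c al rho : R).
Notation w := (omega R q).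

Definition nonperiodic_set : set R := [set c : R | 0 <= c < 1 /\
  exists mu : {measure set R -> \bar R},
    inv_prob q mu /\ integral_fc q c mu = beta q c /\ ~ periodic_measure q mu].

Definition code_data c al rho := [/\ arc_eta R q <= al <= w - arc_eta R q,
  (exists Ph, coh q (arc_shift q al (pi * (q%:R - 1) * c)) (arc_incr q al) (2 * arc_lip R q) Ph /\ Ph 1 = 0),
  rotation q (arc_start c al) rho & irrational_slope rho].

Lemma nonperiodic_data c : nonperiodic_set c -> exists al rho, code_data c al rho.
Proof.
move=> [_ [mu [Hm [Im np]]]].
have [al [Ph [be [psi [hal C W S]]]]] := subaction_exists hq c.
have [rho Hrot] := cmap_rotation hq (arc_start c al).
exists al, rho; split => //; first by exists Ph.
apply: contrapT => nirr; apply: np.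
exact: (rational_periodic hq S Hrot nirr Hm Im).
Qed.

(** Each floor is nondecreasing in rho, so equality of the sums forces equality of all terms: one
    integer of size O(n^2) stands for the whole code, which makes counting codes trivial. The length
    2 (n + 1) brings left ends within order 4^-(n+1), leaving 2^-(n+1) after the loss in
    [arc_compare]. *)
Definition code_index rho n : int := \sum_(m < (2 * n.+1).+1) Num.floor (m%:R * rho).

Lemma code_index_inj rho rho' n : code_index rho n = code_index rho' n ->
  forall m, (m <= 2 * n.+1)%N -> Num.floor (m%:R * rho) = Num.floor (m%:R * rho').
Proof.
wlog hr : rho rho' / rho <= rho'.
  move=> G e m hm; case: (leP rho rho') => [h|/ltW h]; first exact: G.
  by symmetry; apply: G.
move=> e m hm.
have mono (i : 'I_(2 * n.+1).+1) : Num.floor (i%:R * rho) <= Num.floor (i%:R * rho').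
  by apply: le_floor; rewrite ler_wpM2l.
have : \sum_(i < (2 * n.+1).+1) (Num.floor (i%:R * rho') - Num.floor (i%:R * rho)) == 0.
  by rewrite sumrB subr_eq0 -/(code_index rho n) e.
rewrite psumr_eq0; last by move=> i _; rewrite subr_ge0.
move/allP => /(_ (Ordinal (hm : (m < (2 * n.+1).+1)%N))); rewrite mem_index_enum => /(_ isT).
by rewrite /= subr_eq0 => /eqP.
Qed.

Lemma arc_start_bound c al : 0 <= c < 1 -> arc_eta R q <= al <= w - arc_eta R q -> `|arc_start c al| <= 2.
Proof.
move=> hc hal; have [e0 e1] := eta_itv R hq; have p0 := @pi_gt0 R; have wp := omega_le R hq.
have a1 : 0 <= al / pi by rewrite divr_ge0 // ?ltW //; lra.
have a2 : al / pi <= 1 by rewrite ler_pdivrMr //; lra.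
by rewrite /arc_start ler_norml mulNr; lra.
Qed.

Lemma rotation_bound c al rho : 0 <= c < 1 -> code_data c al rho -> `|rho| <= 2 * q%:R.
Proof.
move=> hc [hal _ H _]; have Q := q_gt0 R hq; have Q2 := q_ge2 R hq.
have g2 := arc_start_bound hc hal; set ga := arc_start c al in H g2.
have g0 : cmap q ga ga = q%:R * ga.
  rewrite (@cmap_def R q hq ga ga 0 0) ?lexx ?ler01 //; last by rewrite !addr0.
  by rewrite mulr0 addr0 (min_idPl _) ?addr0.
have := H 1%N ga; rewrite /= g0 mul1r => h.
have e : rho = (q%:R - 1) * ga - (q%:R * ga - ga - rho) by ring.
rewrite e; apply: (le_trans (ler_normB _ _)).
have : `|(q%:R - 1) * ga| <= (q%:R - 1) * 2 by rewrite normrM ger0_norm ?ler_wpM2l //; lra.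
lra.
Qed.

Lemma code_index_bound rho n : `|rho| <= 2 * q%:R ->
  (`|code_index rho n| <= 32 * q * n.+1 ^ 2)%N.
Proof.
move=> hr; have Q := q_gt0 R hq.
pose b : nat := (4 * q * n.+1 + 1)%N.
have hb (i : 'I_(2 * n.+1).+1) : `|Num.floor (i%:R * rho)| <= b%:Z.
  have hi : i%:R <= 2 * n.+1%:R :> R by rewrite -natrM ler_nat -ltnS ltn_ord.
  have h1 : `|i%:R * rho| <= b%:R - 1.
    rewrite normrM normr_nat /b natrD addrK !natrM.
    apply: (@le_trans _ _ (2 * n.+1%:R * (2 * q%:R))); first exact: ler_pM.
    by have -> : 2 * n.+1%:R * (2 * q%:R) = 4 * q%:R * n.+1%:R :> R by ring.
  have /andP[f1 f2] := floor_itv (i%:R * rho).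
  rewrite -(ler_int R) intr_norm -pmulrn ler_norml.
  by move: h1; rewrite ler_norml => /andP[h1 h2]; rewrite intrD in f2; lra.
have : `|code_index rho n| <= ((2 * n.+1).+1 * b)%N%:Z.
  apply: (le_trans (ler_norm_sum _ _ _)); apply: (le_trans (ler_sum _ (fun i _ => hb i))).
  by rewrite sumr_const card_ord -mulr_natl PoszM natz.
rewrite -abszE lez_nat => /leq_trans; apply; rewrite /b.
by nia.
Qed.

(** The parameter is recovered as c = - al / pi - arc_start c al, so closeness of the left ends and
    of al gives closeness of c. *)
Lemma cell_small c c' al al' rho rho' n : code_data c al rho -> code_data c' al' rho' ->
  code_index rho n = code_index rho' n -> `|c - c'| <= (2 + 3 * cmp_const R q) / 2 ^+ n.
Proof.
move=> [hal [Ph [C W]] H irr] [hal' [Ph' [C' W']] H' irr'] e.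
have p0 := @pi_gt0 R; have Q2 := q_ge2 R hq; have k0 := cmp_const_ge0 R hq.
have cl := same_code_close hq H irr H' irr' (code_index_inj e).
have cmp := arc_compare hq n.+1 hal hal' C C' W W'.
set g := `|_ - arc_start c' al'| in cl cmp.
have g0 : 0 <= g := normr_ge0 _.
have T0 : 0 < 2 ^+ n.+1 :> R by rewrite exprn_gt0.
have T1 : 2 <= 2 ^+ n.+1 :> R by rewrite exprS ler_peMr // exprn_ege1 // ler1n.
have g1 : 2 ^+ n.+1 * g <= 2 / 2 ^+ n.+1.
  rewrite ler_pdivlMr //.
  have q2 : 2 ^+ n.+1 * 2 ^+ n.+1 <= q%:R ^+ (2 * n.+1) :> R.
    rewrite -exprD addnn -mul2n; apply: lerXn2r; rewrite ?nnegrE ?ler0n //.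
  have : (2 ^+ n.+1 * 2 ^+ n.+1 - 1) * g <= 1.
    by apply: le_trans cl; apply: ler_wpM2r => //; lra.
  have : 2 ^+ n.+1 * 2 ^+ n.+1 * g <= 2 * ((2 ^+ n.+1 * 2 ^+ n.+1 - 1) * g).
    by rewrite mulrA; apply: ler_wpM2r => //; nra.
  rewrite mulrAC; lra.
have g2 : g <= 2 / 2 ^+ n.+1 by apply: le_trans g1; rewrite ler_peMl //; lra.
have al1 : `|al - al'| <= 3 * cmp_const R q / 2 ^+ n.+1.
  apply: (le_trans cmp); have -> : 3 * cmp_const R q / 2 ^+ n.+1 = cmp_const R q * (2 / 2 ^+ n.+1 + 1 / 2 ^+ n.+1) by field; rewrite gt_eqF.
  by apply: ler_wpM2l => //; rewrite lerD2r.
have ce : c - c' = - (arc_start c al - arc_start c' al') - (al - al') / pi by rewrite /arc_start; ring.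
have pi1 : 1 <= pi :> R by have := @pihalf_ge1 R; lra.
have al2 : `|(al - al') / pi| <= `|al - al'|.
  rewrite normrM normfV (gtr0_norm p0) ler_pdivrMr // ler_peMr //.
have tot : `|c - c'| <= (2 + 3 * cmp_const R q) / 2 ^+ n.+1.
  rewrite ce; apply: (le_trans (ler_normB _ _)); rewrite normrN -/g [leRHS]mulrDl; apply: lerD => //.
  exact: le_trans al1.
apply: (le_trans tot); apply: ler_wpM2l; first by rewrite addr_ge0 // mulr_ge0.
by rewrite lef_pV2 ?posrE ?exprn_gt0 // ler_eXn2l // ltr1n.
Qed.

Theorem nonperiodic_dim : hausdorff_dim nonperiodic_set = 0%E.
Proof.
have k0 := cmp_const_ge0 R hq.
have /choice[f hf] : forall c : R, exists p : R * R, nonperiodic_set c -> code_data c p.1 p.2.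
  move=> c; case: (pselect (nonperiodic_set c)) => h; last by exists (0, 0).
  by have [al [rho hd]] := nonperiodic_data h; exists (al, rho).
(* Shifted by B, the code index runs through 0, ..., 2 B with B = 32 q (n + 1)^2, hence at most 65 q
   (n + 1)^2 cells. *)
apply: (@hausdorff_dim0 R _ (65 * q)%N (2 + 3 * cmp_const R q)); first by lra.
move=> n; pose B : nat := (32 * q * n.+1 ^ 2)%N.
pose U i := [set c | nonperiodic_set c /\ code_index (f c).2 n + B%:Z = i%:Z].
have bd c : nonperiodic_set c -> (`|code_index (f c).2 n|%N <= B)%N.
  move=> h; apply: code_index_bound; have [hc _] := h; exact: rotation_bound hc (hf c h).
exists U; split.
- move=> c h; exists (absz (code_index (f c).2 n + B%:Z)) => //; split => //.
  rewrite gez0_abs //; have := bd c h; lia.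
- move=> i; rewrite /diam; apply: ge_ereal_sup => _ [x [hx ex] [y [hy ey] <-]].
  rewrite lee_fin; apply: (cell_small (hf x hx) (hf y hy)).
  by apply: (addIr B%:Z); rewrite ex ey.
- move=> i hi; apply/seteqP; split => // c [h e]; have := bd c h.
  by move: hi; rewrite /B; lia.
Qed.

End NonPeriodic.

Theorem mainTheorem1 (R : realType) (q : nat) (hq : (2 <= q)%N) :
  (* (1) unique maximizing measure, which is q-Sturmian *)
  (forall c : R, 0 <= c < 1 ->
     exists mu : {measure set R -> \bar R},
       inv_prob q mu /\ integral_fc q c mu = beta q c /\
       (forall nu : {measure set R -> \bar R},
          inv_prob q nu -> integral_fc q c nu = beta q c ->
          forall A : set R, measurable A -> nu A = mu A) /\
       sturmian q mu)
  /\
  (* (2) non-periodic parameters have Hausdorff dimension zero *)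
  hausdorff_dim [set c : R | 0 <= c < 1 /\
     exists mu : {measure set R -> \bar R},
       inv_prob q mu /\ integral_fc q c mu = beta q c /\
       ~ periodic_measure q mu] = 0%E
  /\
  (* (3) Gelfond-type bound with exponent gamma(c) = beta(c) / log q *)
  (forall c : R, 0 <= c < 1 ->
     exists C : R, 0 < C /\
       forall (x : R) (N : nat), 0 <= x < 1 -> (1 <= N)%N ->
         Num.sqrt ((\sum_(n < N) cos (2 * pi * (c * (digsum q n)%:R + n%:R * x))) ^+ 2
                 + (\sum_(n < N) sin (2 * pi * (c * (digsum q n)%:R + n%:R * x))) ^+ 2)
         <= C * powR (N%:R) (fine (beta q c) / ln (q%:R))).
Proof.
split; first by move=> c _; exact: unique_maximizing_measure hq c.
split; first exact: nonperiodic_dim hq.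
by move=> c _; exact: gelfond_bound hq c.
Qed.
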